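(* Let $p>\max\{d/2,1\}$. There exists a constant $K>0$ such that $$\|S(u_1)-S(u_2)\|_{L^\infty(\Omega)}\le K\,\|u_1-u_2\|_{L^p(\Omega)}\quad\text{for all } u_1,u_2\in L^p(\Omega).$$
   Context: Let $\Omega\subset\mathbb{R}^d$, $d\ge1$, be a bounded domain with regular boundary satisfying the cone condition, $V:=H^1_0(\Omega)$, and let $\langle\cdot,\cdot\rangle$ be the dual pairing between $V^*$ and $V$. $A:V\to V^*$ is the linear second-order elliptic operator $$\langle Ay,v\rangle=\int_\Omega\Big(\sum_{i,j=1}^d a_{ij}\frac{\partial y}{\partial x_j}\frac{\partial v}{\partial x_i}+\sum_{i=1}^d b_i\frac{\partial y}{\partial x_i}v+\gamma yv\Big)dx$$ with $a_{ij},b_i,\gamma\in L^\infty(\Omega)$, $\gamma\ge0$, and $A$ coercive: $\langle Ay,y\rangle\ge\alpha\|y\|_V^2$ for all $y\in V$ with some $\alpha>0$. For $u\in V^*$, $S(u)=y\in V$ is the unique solution of $$\langle Ay,v-y\rangle+\int_\Omega|v|\,dx-\int_\Omega|y|\,dx\ge\langle u,v-y\rangle\quad\text{for all } v\in V.$$ Functions $u\in L^p(\Omega)$, $p>\max\{d/2,1\}$, are identified with elements of $V^*$. *)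

(* Defs.v *)
From HB Require Import structures.
From mathcomp Require Import all_boot all_order all_algebra.
From mathcomp Require Import all_classical all_reals all_analysis.

Set Implicit Arguments.
Unset Strict Implicit.
Unset Printing Implicit Defensive.

Import Order.TTheory GRing.Theory Num.Theory.
Import numFieldNormedType.Exports.

Local Open Scope classical_set_scope.
Local Open Scope ring_scope.

(** * Lebesgue measure on R^d *)

(* The sigma-algebra on 'rV[R]_d is generated by the coordinate functions,
   as the library does for n.-tuple; it is the Borel sigma-algebra. *)
Definition rV_display : measure_display. Proof. exact: default_measure_display. Qed.

Section rV_measurable.
Context {R : realType} (d : nat).

Definition rV_coord (i : 'I_d) (x : 'rV[R]_d) : measurableTypeR R := x ord0 i.

Let rV_set0 : g_sigma_preimage rV_coord set0.
Proof. exact: sigma_algebra0. Qed.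

Let rV_setC A : g_sigma_preimage rV_coord A -> g_sigma_preimage rV_coord (~` A).
Proof. exact: sigma_algebraC. Qed.

Let rV_bigcup (F : (set 'rV[R]_d)^nat) :
  (forall i, g_sigma_preimage rV_coord (F i)) ->
  g_sigma_preimage rV_coord (\bigcup_i (F i)).
Proof. exact: sigma_algebra_bigcup. Qed.

HB.instance Definition _ := @isMeasurable.Build rV_display
  'rV[R]_d (g_sigma_preimage rV_coord) rV_set0 rV_setC rV_bigcup.

End rV_measurable.

Lemma measurable_rV_coord (R : realType) (d : nat) (i : 'I_d) :
  measurable_fun [set: 'rV[R]_d] (@rV_coord R d i).
Proof.
move=> _ Y mY; rewrite setTI; apply: sub_sigma_algebra => /=.
rewrite -bigcup_seq/=; exists i => /=; first by rewrite mem_index_enum.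
by exists Y => //; rewrite setTI.
Qed.

Lemma measurable_fun_rVP d1 (T : measurableType d1) (R : realType) (d : nat)
    (f : T -> 'rV[R]_d) :
  (forall i, measurable_fun [set: T] (rV_coord i \o f)) ->
  measurable_fun [set: T] f.
Proof.
move=> mf _ A mA; rewrite setTI.
have sub : g_sigma_preimage (@rV_coord R d) `<=`
    [set B | measurable (f @^-1` B)].
  apply: smallest_sub.
    split=> [|B mB|F mF] /=; first by rewrite preimage_set0.
      by rewrite setTD -preimage_setC; exact: measurableC.
    by rewrite preimage_bigcup; apply: bigcup_measurable => n _; exact: mF.
  move=> B; rewrite -bigcup_seq => -[i _ [C mC <-]] /=.
  by rewrite setTI -comp_preimage -[X in measurable X]setTI; exact: mf.
exact: sub.
Qed.

Section lebesgue_rV.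
Context {R : realType}.

Definition rV_cons (d : nat) (x : measurableTypeR R * 'rV[R]_d) : 'rV[R]_d.+1 :=
  \row_i (if unlift ord0 i is Some j then x.2 ord0 j else x.1).

Lemma measurable_rV_cons d : measurable_fun [set: _] (@rV_cons d).
Proof.
apply: measurable_fun_rVP => i; case: (unliftP ord0 i) => [j|] ->.
  rewrite (_ : _ \o _ = rV_coord j \o snd).
    apply: (measurableT_comp (measurable_rV_coord j)); exact: measurable_snd.
  by apply/funext => x; rewrite /= /rV_coord mxE liftK.
rewrite (_ : _ \o _ = fst); first exact: measurable_fst.
by apply/funext => x; rewrite /= /rV_coord mxE unlift_none.
Qed.

Section step.
Variables (d : nat) (m : {sigma_finite_measure set 'rV[R]_d -> \bar R}).

Definition rV_product : set 'rV[R]_d.+1 -> \bar R :=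
  pushforward (lebesgue_measure \x m)%E (@rV_cons d).

Let mpre A : measurable A -> measurable (@rV_cons d @^-1` A).
Proof.
by move=> mA; rewrite -[X in measurable X]setTI; exact: measurable_rV_cons.
Qed.

Let rV_product0 : rV_product set0 = 0%E.
Proof. by rewrite /rV_product /pushforward preimage_set0 measure0. Qed.

Let rV_product_ge0 A : (0 <= rV_product A)%E.
Proof. rewrite /rV_product /pushforward; exact: measure_ge0. Qed.

Let rV_product_sigma_additive : semi_sigma_additive rV_product.
Proof.
move=> F mF tF mUF; rewrite /rV_product /pushforward preimage_bigcup.
apply: measure_semi_sigma_additive => [n||].
- exact: mpre.
- apply/trivIsetP => /= i j _ _ ij; rewrite -preimage_setI.
  by move/trivIsetP : tF => /(_ _ _ _ _ ij) ->//; rewrite preimage_set0.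
- by rewrite -preimage_bigcup; exact: mpre.
Qed.

HB.instance Definition _ := isMeasure.Build _ _ _ rV_product
  rV_product0 rV_product_ge0 rV_product_sigma_additive.

Let rV_head (x : 'rV[R]_d.+1) : measurableTypeR R := rV_coord ord0 x.
Let rV_tail (x : 'rV[R]_d.+1) : 'rV[R]_d := \row_j x ord0 (lift ord0 j).

Let rV_uncons x : (measurableTypeR R * 'rV[R]_d)%type := (rV_head x, rV_tail x).

Let measurable_rV_uncons : measurable_fun setT rV_uncons.
Proof.
apply/measurable_fun_pair; first exact: measurable_rV_coord.
apply: measurable_fun_rVP => j.
rewrite (_ : _ \o _ = @rV_coord R d.+1 (lift ord0 j)).
  exact: measurable_rV_coord.
by apply/funext => x; rewrite /= /rV_coord mxE.
Qed.

Let rV_consK : cancel (@rV_cons d) rV_uncons.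
Proof.
move=> [a v]; rewrite /rV_uncons /rV_head /rV_tail /rV_coord mxE unlift_none.
by congr pair; apply/rowP => j; rewrite !mxE liftK.
Qed.

Let rV_product_sigma_finite : sigma_finite setT rV_product.
Proof.
have /sigma_finiteP[F [TF ndF Foo]] :=
  sigma_finiteT (lebesgue_measure : {sigma_finite_measure set (measurableTypeR R) -> \bar R}).
have /sigma_finiteP[G [TG ndG Goo]] := sigma_finiteT m.
exists (fun n => rV_uncons @^-1` (F n `*` G n)).
  rewrite -preimage_bigcup (_ : \bigcup_i _ = setT) ?preimage_setT//.
  apply/seteqP; split=> // -[x v] _.
  have [n _ Fn] : (\bigcup_i F i) x by rewrite -TF.
  have [k _ Gk] : (\bigcup_i G i) v by rewrite -TG.
  exists (maxn n k) => //; split=> /=.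
    by move: x Fn; exact/subsetPset/ndF/leq_maxl.
  by move: v Gk; exact/subsetPset/ndG/leq_maxr.
move=> n; have [mF Fn] := Foo n; have [mG Gn] := Goo n; split.
  rewrite -[X in measurable X]setTI; apply: measurable_rV_uncons => //.
  exact: measurableX.
rewrite /rV_product /pushforward -comp_preimage.
rewrite (_ : _ \o _ = id); last by apply/funext => x; exact: rV_consK.
by rewrite preimage_id product_measure1E// lte_mul_pinfty// ge0_fin_numE.
Qed.

HB.instance Definition _ := Measure_isSigmaFinite.Build _ _ _ rV_product
  rV_product_sigma_finite.

End step.

Fixpoint lebesgue_rV (d : nat) : {sigma_finite_measure set 'rV[R]_d -> \bar R} :=
  match d with
  | 0 => dirac (0 : 'rV[R]_0)
  | d'.+1 => rV_product (lebesgue_rV d')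
  end.


Lemma lebesgue_rV_box (d : nat) (l r : 'I_d -> R) : (forall i, l i <= r i) ->
  lebesgue_rV d [set x : 'rV[R]_d | forall i, x ord0 i \in `[l i, r i]] =
  (\prod_i (r i - l i))%:E.
Proof.
elim: d l r => [|d IH] l r lr.
  rewrite big_ord0 /= diracE.
  by rewrite mem_set//= => -[].
rewrite [LHS]/= /rV_product /pushforward.
rewrite (_ : _ @^-1` _ = `[l ord0, r ord0]%classic `*`
    [set x : 'rV[R]_d | forall i, x ord0 i \in `[l (lift ord0 i), r (lift ord0 i)]]).
  rewrite product_measure1E//.
    rewrite IH// [X in (X * _)%E](_ : _ = (r ord0 - l ord0)%:E).
      by rewrite -EFinM big_ord_recl.
    transitivity (lebesgue_measure `[l ord0, r ord0]%classic) => //.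
    rewrite lebesgue_measure_itv/= lte_fin.
    by case: ltgtP (lr ord0) => // -> _; rewrite subrr.
  rewrite (_ : [set _ | _] = \bigcap_(i in [set: 'I_d])
     (rV_coord i @^-1` `[l (lift ord0 i), r (lift ord0 i)]%classic)).
    apply: fin_bigcap_measurable => // i _.
    by rewrite -[X in measurable X]setTI; exact: measurable_rV_coord.
  by apply/seteqP; split=> x/= H i; [move=> _; exact: H|exact: (H i I)].
apply/seteqP; split=> [[x v]/= H|[x v]/= [H0 H] i].
  split; first by have := H ord0; rewrite mxE unlift_none.
  by move=> i; have := H (lift ord0 i); rewrite mxE liftK.
by rewrite mxE; case: (unliftP ord0 i) => [j|] ->.
Qed.

End lebesgue_rV.

(** * Function spaces on an open set Om of R^d

   Functions on Om are represented by total functions on R^d whose values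
   outside Om are irrelevant; elements of L^p(Om) are represented by functions,
   with equality almost everywhere left implicit. *)

Section sobolev.
Context {R : realType} {d : nat}.
Local Notation mu := (lebesgue_rV d : {measure set 'rV[R]_d -> \bar R}).
Implicit Types (Om : set 'rV[R]_d) (f g phi : 'rV[R]_d -> R) (i : 'I_d).

Definition Lp_norm Om (p : \bar R) f : \bar R := 'N[mu]_p[EFin \o (f \_ Om)].

Definition Lp Om (p : \bar R) : set ('rV[R]_d -> R) :=
  [set f | measurable_fun Om f /\ (Lp_norm Om p f < +oo)%E].

Definition partial i f : 'rV[R]_d -> R := 'D_(delta_mx ord0 i) f.

Definition smooth f := forall s : seq 'I_d,
  continuous (foldr partial f s) /\
  forall i x, derivable (foldr partial f s) x (delta_mx ord0 i).

Definition tsupport f : set 'rV[R]_d := closure [set x | f x != 0].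

Definition test_function Om phi :=
  [/\ smooth phi, compact (tsupport phi) & tsupport phi `<=` Om].

Definition weak_partial Om i f g := forall phi, test_function Om phi ->
  \int[mu]_(x in Om) (f x * partial i phi x) =
  - \int[mu]_(x in Om) (g x * phi x).

End sobolev.

(* A Sobolev function is carried together with its weak gradient, so that
   y.1 stands for y and y.2 i for dy/dx_i; the weak gradient is determined by
   y.1 up to a null set. Sums and differences are componentwise. *)
Notation sobolev_pair R d :=
  (('rV[R]_d -> R) * ('I_d -> 'rV[R]_d -> R))%type.

Section H10.
Context {R : realType} {d : nat}.
Local Notation mu := (lebesgue_rV d : {measure set 'rV[R]_d -> \bar R}).
Implicit Types (Om : set 'rV[R]_d) (y v : sobolev_pair R d).

Definition H1 Om : set (sobolev_pair R d) :=
  [set y | Lp Om 2%:E y.1 /\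
     forall i, Lp Om 2%:E (y.2 i) /\ weak_partial Om i y.1 (y.2 i)].

Definition H1_norm Om y : R :=
  Num.sqrt (\int[mu]_(x in Om) (y.1 x ^+ 2) +
            \sum_i \int[mu]_(x in Om) (y.2 i x ^+ 2)).

Definition with_gradient (phi : 'rV[R]_d -> R) : sobolev_pair R d :=
  (phi, fun i => partial i phi).

(* The closure in H1 of the test functions. *)
Definition H10 Om : set (sobolev_pair R d) :=
  [set y | H1 Om y /\
     forall e : R, 0 < e -> exists phi,
       test_function Om phi /\ H1_norm Om (y - with_gradient phi) < e].

(** * The elliptic operator and the variational inequality *)

(* < A y, v > *)
Definition elliptic_form Om (a : 'I_d -> 'I_d -> 'rV[R]_d -> R)
    (b : 'I_d -> 'rV[R]_d -> R) (gam : 'rV[R]_d -> R) y v : R :=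
  \int[mu]_(x in Om)
    (\sum_i \sum_j a i j x * y.2 j x * v.2 i x +
     \sum_i b i x * y.2 i x * v.1 x + gam x * y.1 x * v.1 x).

Definition coercive Om (A : sobolev_pair R d -> sobolev_pair R d -> R) :=
  exists alpha : R, 0 < alpha /\
    forall y, H10 Om y -> alpha * H1_norm Om y ^+ 2 <= A y y.

(* The functional on H10 with which u in L^p is identified. *)
Definition L_functional Om (u : 'rV[R]_d -> R) (v : sobolev_pair R d) : R :=
  \int[mu]_(x in Om) (u x * v.1 x).

(* is_S Om A F y says that y = S(F): since A is coercive, y is the only
   solution in H10, up to null sets. *)
Definition is_S Om (A : sobolev_pair R d -> sobolev_pair R d -> R)
    (F : sobolev_pair R d -> R) y :=
  H10 Om y /\
  forall v, H10 Om v ->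
    F (v - y) <= A y (v - y) + \int[mu]_(x in Om) `|v.1 x|
                             - \int[mu]_(x in Om) `|y.1 x|.

End H10.

(** * Domains *)

Section domains.
Context {R : realType} {d : nat}.
Implicit Types (Om : set 'rV[R]_d) (x v : 'rV[R]_d).

Definition bounded_domain Om :=
  [/\ open Om, connected Om, Om !=set0 & bounded_set Om].

Definition dot x v : R := \sum_i x ord0 i * v ord0 i.

(* The library norm on 'rV[R]_d is the sup norm. *)
Definition euclidean_norm x : R := Num.sqrt (dot x x).

(* The closed finite cone with vertex x, axis direction v (a unit vector),
   aperture angle theta and height h. *)
Definition finite_cone x v (theta h : R) : set 'rV[R]_d :=
  [set x + z | z in [set z | euclidean_norm z <= h /\
                             cos (theta / 2) * euclidean_norm z <= dot z v]].

(* Two finite cones are congruent iff they have the same aperture and height. *)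
Definition cone_condition Om := exists theta h : R,
  [/\ 0 < theta <= pi, 0 < h &
      forall x, Om x -> exists v,
        euclidean_norm v = 1 /\ finite_cone x v theta h `<=` Om].

End domains.

(* Main.v *)
Require Import Defs.
From HB Require Import structures.
From mathcomp Require Import all_boot all_order all_algebra.
From mathcomp Require Import all_classical all_reals all_analysis.
From mathcomp Require Import measurable_realfun ess_sup_inf.
From mathcomp Require Import ring lra.

(** Proof idea (Stampacchia's truncation method). Put w = S(u1) - S(u2) and, for
   k >= 0, z = sign(w) (|w| - k)^+. Testing the two inequalities with S(u1) - z
   and S(u2) + z, the L^1 terms cancel favourably because z lies between 0 and w,
   and since z and its gradient live on {|w| > k}, where the gradients of z and w
   agree, one gets < A z, z > <= \int (u1 - u2) z. Coercivity, the Sobolev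
   inequality |z|_q <= C |z|_V with some q such that 2 / q < 1 - 1 / p (this is
   where p > d / 2 enters) and Hoelder's inequality give
     |z|_q <= C' |u1 - u2|_p |{|w| > k}|^(1 - 1/p - 1/q).
   Chebyshev's inequality turns this into
     |{|w| > h}| <= (C' |u1 - u2|_p / (h - k))^q |{|w| > k}|^b,  h > k,  b > 1,
   and iterating along the levels k_n = K |u1 - u2|_p (1 - 2^-n) forces
   |w| <= K |u1 - u2|_p almost everywhere. *)

Set Implicit Arguments.
Unset Strict Implicit.
Unset Printing Implicit Defensive.

Import Order.TTheory GRing.Theory Num.Theory.
Import numFieldNormedType.Exports.

Local Open Scope classical_set_scope.
Local Open Scope ring_scope.

(** * Functions with compact support on R^d *)

(** Membership in [H10] means being a limit of smooth compactly supported functions, whereas z is a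
    kinked function of w, so much of the work lies in showing that truncation preserves [H10]. The
    corners are replaced by square-root regularizations, whose compositions with test functions stay
    infinitely differentiable. Two limits are needed: from test functions to w for a fixed smooth
    profile, and from smooth profiles to the truncation. The Sobolev inequality comes from an L^1
    gradient inequality applied to a power of |phi|. It is stated in dual form, pairing |f| with
    h^(1/d), so that an induction on the dimension can start at d = 1, where the exponent d/(d - 1)
    makes no sense. Pairing with h = |phi|^m yields at once every q > 2 with q (d - 2) <= 2 d, which
    treats d <= 2 and d > 2 together. The iteration needs a positive increment even when |u1 - u2|_p
    = 0; this is why the final bound is proved up to an arbitrary e > 0. *)

Lemma open_measurable_rV (R : realType) (d : nat) (U : set 'rV[R]_d) :
  open U -> measurable U.
Proof.
move=> oU.
(* Balls of the sup norm are boxes, hence finite intersections of preimages of intervals under the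
   coordinates. Rational centres and radii suffice; boxes that leave [U] are replaced by the empty
   set below, so that the union runs over a whole countable type. *)
pose B (c : 'rV[rat]_d * rat) : set 'rV[R]_d :=
  \bigcap_(i in [set: 'I_d])
    (rV_coord i @^-1` `](ratr (c.1 ord0 i) - ratr c.2), (ratr (c.1 ord0 i) + ratr c.2)[%classic).
have mB c : measurable (B c).
  apply: fin_bigcap_measurable => // i _.
  by rewrite -[X in measurable X]setTI; exact: measurable_rV_coord.
pose B' c := if `[< B c `<=` U >] then B c else set0.
suff -> : U = \bigcup_c B' c.
  apply: countable_bigcupT_measurable; first exact: countableP.
  by move=> c; rewrite /B'; case: ifP.
apply/seteqP; split=> [x Ux|x [c _]]; last first.
  by rewrite /B'; case: ifPn => // /asboolP BU /BU.
have /nbhs_ballP[e /= e0 xeU] : nbhs x U by exact: open_nbhs_nbhs.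
have [r /andP[r0 re]] : exists r : rat, 0 < (ratr r : R) < e / 2.
  have [r] := rat_in_itvoo (divr_gt0 e0 (ltr0n R 2)).
  by rewrite in_itv/=; exists r.
have cP i : {q : rat | x ord0 i - ratr r < ratr q < x ord0 i + ratr r}.
  apply: cid; have [q] : exists q : rat, (ratr q : R) \in `](x ord0 i - ratr r), (x ord0 i + ratr r)[.
    by apply: rat_in_itvoo; lra.
  by rewrite in_itv/=; exists q.
exists (\row_i sval (cP i), r) => //.
have Bx : B (\row_i sval (cP i), r) x.
  move=> i _; rewrite /= in_itv/= mxE /rV_coord; case: (cP i) => q /=; lra.
rewrite /B'; case: ifPn => // /asboolP BNU; exfalso; apply: BNU => y By; apply: xeU.
split=> // i j; rewrite (ord1 i).
have := By j I; have := Bx j I; rewrite /= /rV_coord !in_itv/= mxE /ball/= ltr_norml.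
by move: re; lra.
Qed.

Lemma continuous_measurable_rV (R : realType) (d : nat) (f : 'rV[R]_d -> R) :
  continuous f -> measurable_fun [set: 'rV[R]_d] f.
Proof.
move=> /continuousP cf; apply: (measurability _ (measurable_realfun.RGenOpens.measurableE R)).
move=> _ [_ [a [b ->] <-]]; rewrite setTI; apply: open_measurable_rV.
exact/cf/interval_open.
Qed.

Lemma le_mxnorm (R : realType) (d : nat) (x : 'rV[R]_d) i : `|x ord0 i| <= `|x|.
Proof.
rewrite [leRHS]mx_normrE.
exact: (le_bigmax _ (fun ij : 'I_1 * 'I_d => `|x ij.1 ij.2|) (ord0, i)).
Qed.

Lemma mxnorm_le (R : realType) (d : nat) (x : 'rV[R]_d) (M : R) :
  0 <= M -> (forall i, `|x ord0 i| <= M) -> `|x| <= M.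
Proof.
move=> M0 H; rewrite [leLHS]mx_normrE; apply/bigmax_leP; split=> // -[i j] _ /=.
by rewrite (ord1 i).
Qed.


Section compact_support.
Context {R : realType}.
Implicit Types d : nat.

Definition Cc d (f : 'rV[R]_d -> R) :=
  continuous f /\ exists M : R, forall x, M < `|x| -> f x = 0.

Definition C1c d (f : 'rV[R]_d -> R) :=
  Cc f /\ forall i, (forall x, derivable f x (delta_mx ord0 i)) /\
                    Cc (partial i f).

Lemma closed_norm_le d (M : R) : closed [set x : 'rV[R]_d | `|x| <= M].
Proof.
have : closed ((fun x : 'rV[R]_d => `|x|) @^-1` [set r : R | r <= M]).
  by apply: closed_comp => [x _|]; [exact: norm_continuous|exact: closed_le].
exact.
Qed.

Lemma Cc_bounded d (f : 'rV[R]_d -> R) : Cc f ->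
  exists2 B : R, 0 <= B & forall x, `|f x| <= B.
Proof.
move=> [cf [M Mf]].
have cK : compact [set x : 'rV[R]_d | `|x| <= M].
  apply: bounded_closed_compact.
    exists M; split; first exact: num_real.
    by move=> N MN x /= xM; apply: le_trans xM (ltW MN).
  exact: closed_norm_le.
have : compact (f @` [set x : 'rV[R]_d | `|x| <= M]).
  by apply: continuous_compact => //; exact: continuous_subspaceT.
move=> /compact_bounded[B [Br HB]].
exists (Num.max 0 (B + 1)); first by rewrite le_max lexx.
move=> x; have [xM|/Mf ->] := leP `|x| M; last by rewrite normr0 le_max lexx.
by rewrite le_max; apply/orP; right; apply: HB; [rewrite ltrDl|exists x].
Qed.

Lemma bounded_set_measure_finite d (A : set 'rV[R]_d) (M : R) : measurable A ->
  (forall x, A x -> `|x| <= M) -> (lebesgue_rV d A < +oo)%E.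
Proof.
move=> mA AM.
have [M0|M0] := ltP M 0.
  suff -> : A = set0 by rewrite measure0.
  by apply/seteqP; split=> // x /AM; rewrite leNgt => /negP; apply; rewrite (lt_le_trans M0).
pose B := [set x : 'rV[R]_d | forall i, x ord0 i \in `[- M, M]].
have mB : measurable B.
  rewrite (_ : B = \bigcap_(i in [set: 'I_d]) (rV_coord i @^-1` `[- M, M]%classic)).
    apply: fin_bigcap_measurable => // i _.
    by rewrite -[X in measurable X]setTI; exact: measurable_rV_coord.
  by apply/seteqP; split=> x/= H i; [move=> _; exact: H|exact: (H i I)].
apply: (@le_lt_trans _ _ (lebesgue_rV d B)).
  apply: le_measure; rewrite ?inE// => x /AM xM i.
  by rewrite in_itv/= -ler_norml (le_trans (le_mxnorm _ _)).
by rewrite /B (@lebesgue_rV_box _ _ (fun=> - M) (fun=> M)) ?ltry// => i; lra.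
Qed.

Lemma Cc_integrable d (f : 'rV[R]_d -> R) : Cc f ->
  (lebesgue_rV d).-integrable setT (EFin \o f).
Proof.
move=> Cf; have [B B0 fB] := Cc_bounded Cf; case: Cf => cf [M Mf].
pose K := [set x : 'rV[R]_d | `|x| <= M].
have mK : measurable K.
  rewrite -(setCK K); apply: measurableC; apply: open_measurable_rV.
  rewrite openC; exact: closed_norm_le.
have Kfin : (lebesgue_rV d K < +oo)%E.
  by apply: (@bounded_set_measure_finite _ _ M).
rewrite (_ : EFin \o f = (EFin \o f) \_ K).
  apply/(integrable_mkcond _ mK)/measurable_bounded_integrable => //.
    by apply: measurable_funTS; exact: continuous_measurable_rV.
  exists B; split; first exact: num_real.
  by move=> N BN x _ /=; apply: (le_trans (fB x)); exact: ltW.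
apply/funext => x; rewrite patchE; case: ifPn => // /negP xK /=.
by rewrite Mf// ltNge; apply/negP => H; apply: xK; rewrite inE.
Qed.

End compact_support.

(** * Slices along the first coordinate, Fubini and the fundamental theorem of calculus *)

Section slices.
Context {R : realType}.
Implicit Types (d : nat) (t : R).

Lemma rV_consP d (z : 'rV[R]_d.+1) :
  z = rV_cons (z ord0 ord0, \row_j z ord0 (lift ord0 j)).
Proof.
apply/rowP => i; rewrite mxE; case: (unliftP ord0 i) => [j|] -> //=.
by rewrite mxE.
Qed.

Lemma norm_rV_cons_sub d t (x y : 'rV[R]_d) :
  `|rV_cons (t, x) - rV_cons (t, y)| <= `|x - y|.
Proof.
apply: mxnorm_le => // i; rewrite !mxE; case: (unliftP ord0 i) => [j|] _ /=.
  by have := le_mxnorm (x - y) j; rewrite !mxE.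
by rewrite subrr normr0.
Qed.

Lemma norm_rV_cons_subl d t s (x : 'rV[R]_d) :
  `|rV_cons (t, x) - rV_cons (s, x)| <= `|t - s|.
Proof.
apply: mxnorm_le => // i; rewrite !mxE; case: (unliftP ord0 i) => [j|] _ //=.
by rewrite subrr normr0.
Qed.

Lemma norm_rV_cons_tail d t (x : 'rV[R]_d) : `|x| <= `|rV_cons (t, x)|.
Proof.
apply: mxnorm_le => // i; have := le_mxnorm (rV_cons (t, x)) (lift ord0 i).
by rewrite mxE liftK.
Qed.

Lemma norm_rV_cons_head d t (x : 'rV[R]_d) : `|t| <= `|rV_cons (t, x)|.
Proof. by have := le_mxnorm (rV_cons (t, x)) ord0; rewrite mxE unlift_none. Qed.

Lemma nonexpansive_continuous (V W : normedModType R) (f : V -> W) :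
  (forall x y, `|f x - f y| <= `|x - y|) -> continuous f.
Proof.
move=> H x; apply/cvgrPdist_lt => e e0; near=> y.
by apply: le_lt_trans (H _ _) _; near: y; apply: cvgr_dist_lt.
Unshelve. all: by end_near. Qed.

Lemma continuous_rV_consr d t : continuous (fun x : 'rV[R]_d => rV_cons (t, x)).
Proof. by apply: nonexpansive_continuous => x y; exact: norm_rV_cons_sub. Qed.

Lemma continuous_rV_consl d (x : 'rV[R]_d) :
  continuous (fun t : R => rV_cons (t, x) : 'rV[R]_d.+1).
Proof. by apply: nonexpansive_continuous => s t; exact: norm_rV_cons_subl. Qed.

Lemma Cc_slice d (f : 'rV[R]_d.+1 -> R) t : Cc f -> Cc (fun x => f (rV_cons (t, x))).
Proof.
move=> [cf [M Mf]]; split.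
  by move=> x; apply: continuous_comp; [exact: continuous_rV_consr|exact: cf].
by exists M => x Mx; apply: Mf; apply: lt_le_trans Mx (norm_rV_cons_tail _ _).
Qed.

(** The difference quotients agree as functions of the increment, so derivability and the value of
    the derivative transfer together from [f] to its slices. *)
Lemma derive_slice_tail d (f : 'rV[R]_d.+1 -> R) t x j :
  (fun h : R => h^-1 *: (((fun x => f (rV_cons (t, x))) \o shift x) (h *: delta_mx ord0 j)
     - f (rV_cons (t, x)))) =
  (fun h : R => h^-1 *: ((f \o shift (rV_cons (t, x))) (h *: delta_mx ord0 (lift ord0 j))
     - f (rV_cons (t, x)))).
Proof.
apply/funext => h /=; congr (_ *: (f _ - _)); apply/rowP => i; rewrite !mxE.
case: (unliftP ord0 i) => [k|] -> /=; rewrite ?mxE /=.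
  by rewrite (inj_eq lift_inj).
by rewrite mulr0 add0r.
Qed.

Lemma derive_slice_head d (f : 'rV[R]_d.+1 -> R) t (x : 'rV[R]_d) :
  (fun h : R => h^-1 *: (((fun t => f (rV_cons (t, x))) \o shift t) (h *: 1)
     - f (rV_cons (t, x)))) =
  (fun h : R => h^-1 *: ((f \o shift (rV_cons (t, x))) (h *: delta_mx ord0 ord0)
     - f (rV_cons (t, x)))).
Proof.
apply/funext => h /=; congr (_ *: (f _ - _)); apply/rowP => i; rewrite !mxE.
case: (unliftP ord0 i) => [k|] -> /=; rewrite ?mxE /=.
  by rewrite mulr0 add0r.
by [].
Qed.

Lemma partial_slice_tail d (f : 'rV[R]_d.+1 -> R) t j :
  partial j (fun x => f (rV_cons (t, x))) =
  (fun x => partial (lift ord0 j) f (rV_cons (t, x))).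
Proof. by apply/funext => x; rewrite /partial /derive derive_slice_tail. Qed.

Lemma C1c_slice d (f : 'rV[R]_d.+1 -> R) t : C1c f -> C1c (fun x => f (rV_cons (t, x))).
Proof.
move=> [Cf Df]; split; first exact: Cc_slice.
move=> i; have [df Cdf] := Df (lift ord0 i); split.
  by move=> x; rewrite /derivable derive_slice_tail; exact: df.
by rewrite partial_slice_tail; exact: Cc_slice.
Qed.

Lemma is_derive_slice_head d (f : 'rV[R]_d.+1 -> R) (x : 'rV[R]_d) t : C1c f ->
  is_derive t 1 (fun t => f (rV_cons (t, x))) (partial ord0 f (rV_cons (t, x))).
Proof.
move=> [_ /(_ ord0)[df _]]; apply: DeriveDef.
  by rewrite /derivable derive_slice_head; exact: df.
by rewrite /partial /derive derive_slice_head.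
Qed.

Lemma continuous_slice_head d (f : 'rV[R]_d.+1 -> R) (x : 'rV[R]_d) : continuous f ->
  continuous (fun t : R => f (rV_cons (t, x))).
Proof.
by move=> cf t; apply: continuous_comp; [exact: continuous_rV_consl|exact: cf].
Qed.

Lemma FTC_slice d (f : 'rV[R]_d.+1 -> R) (x : 'rV[R]_d) (a b : R) : C1c f -> a < b ->
  (\int[lebesgue_measure]_(t in `[a, b]) (partial ord0 f (rV_cons (t, x)))%:E =
   (f (rV_cons (b, x)))%:E - (f (rV_cons (a, x)))%:E)%E.
Proof.
move=> C1f ab; have [[cf _] /(_ ord0)[_ [cdf _]]] := C1f.
apply: (@continuous_FTC2 _ _ (fun t => f (rV_cons (t, x)))) => //.
- by apply: continuous_subspaceT; exact: continuous_slice_head.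
- split.
  + by move=> t _; have [] := is_derive_slice_head x t C1f.
  + by apply: cvg_at_right_filter; exact: continuous_slice_head.
  + by apply: cvg_at_left_filter; exact: continuous_slice_head.
- by move=> t _; rewrite derive1E; have [_ ->] := is_derive_slice_head x t C1f.
Qed.

(** [lebesgue_rV d.+1] is the image of a product measure under [rV_cons], so this is Tonelli's
    theorem after a change of variables. *)
Lemma integral_rV_cons12 d (f : 'rV[R]_d.+1 -> \bar R) :
  measurable_fun [set: 'rV[R]_d.+1] f -> (forall x, (0 <= f x)%E) ->
  (\int[lebesgue_rV d.+1]_z f z =
   \int[lebesgue_measure]_t \int[lebesgue_rV d]_x f (rV_cons (t, x)))%E.
Proof.
move=> mf f0; rewrite [LHS](@ge0_integral_pushforward _ _ _ _ _ _ (@measurable_rV_cons R d))//=.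
rewrite preimage_setT fubini_tonelli1//.
by apply: measurableT_comp => //; exact: measurable_rV_cons.
Qed.

Lemma integral_rV_cons21 d (f : 'rV[R]_d.+1 -> \bar R) :
  measurable_fun [set: 'rV[R]_d.+1] f -> (forall x, (0 <= f x)%E) ->
  (\int[lebesgue_rV d.+1]_z f z =
   \int[lebesgue_rV d]_x \int[lebesgue_measure]_t f (rV_cons (t, x)))%E.
Proof.
move=> mf f0; rewrite [LHS](@ge0_integral_pushforward _ _ _ _ _ _ (@measurable_rV_cons R d))//=.
rewrite preimage_setT fubini_tonelli2//.
by apply: measurableT_comp => //; exact: measurable_rV_cons.
Qed.

Lemma integrable_rV_cons d (f : 'rV[R]_d.+1 -> \bar R) :
  (lebesgue_rV d.+1).-integrable setT f ->
  (lebesgue_measure \x lebesgue_rV d)%E.-integrable setT (f \o @rV_cons R d).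
Proof.
move=> /integrableP[mf foo]; apply/integrableP; split.
  by apply: measurableT_comp => //; exact: measurable_rV_cons.
apply: le_lt_trans foo; rewrite [leRHS](@ge0_integral_pushforward _ _ _ _ _ _ (@measurable_rV_cons R d))//=.
exact: measurableT_comp.
Qed.

Lemma integral_rV_cons d (f : 'rV[R]_d.+1 -> \bar R) :
  (lebesgue_rV d.+1).-integrable setT f ->
  (\int[lebesgue_rV d.+1]_z f z =
   \int[(lebesgue_measure \x lebesgue_rV d)]_z f (rV_cons z))%E.
Proof.
move=> fi; rewrite [LHS](@integral_pushforward _ _ _ _ _ _ (@measurable_rV_cons R d))//=.
  by case/integrableP: fi.
exact: integrable_rV_cons.
Qed.

(** For the head coordinate, the fundamental theorem of calculus applies on each line between two
    points beyond the support; for a tail coordinate, slicing off the head reduces to the smaller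
    dimension. *)
Lemma integral_partial_eq0 d (f : 'rV[R]_d -> R) (i : 'I_d) : C1c f ->
  (\int[lebesgue_rV d]_x (partial i f x)%:E = 0)%E.
Proof.
elim: d f i => [f []//|d IH] f i C1f.
have [_ /(_ i)[_ Cdf]] := C1f.
have ifi := Cc_integrable Cdf.
rewrite (integral_rV_cons ifi); case: (unliftP ord0 i) => [j|] E; subst i.
  rewrite -(integral12_prod_meas1 (integrable_rV_cons ifi)).
  apply: integral0_eq => t _; rewrite /fubini_F.
  by rewrite -(IH _ j (C1c_slice t C1f)) partial_slice_tail.
rewrite -(integral21_prod_meas1 (integrable_rV_cons ifi)).
apply: integral0_eq => x _; rewrite /fubini_G /=.
case: Cdf => _ [M Mdf]; have [[_ [N Nf]] _] := C1f.
(* [L] exceeds the radii beyond which [f] and its derivative vanish. The [+ 1] makes this strict, as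
   [Cc] requires, and the 0 keeps [L] positive, so that the interval is nondegenerate. *)
pose L := Num.max 0 (Num.max M N) + 1.
have L0 : 0 < L by rewrite /L ltr_wpDl// le_max lexx.
have LM : M < L by rewrite /L ltr_pwDr// !le_max lexx orbT.
have LN : N < L by rewrite /L ltr_pwDr// !le_max lexx !orbT.
transitivity (\int[lebesgue_measure]_(t in `[(- L)%R, L])
   (partial ord0 f (rV_cons (t, x)))%:E)%E.
  rewrite [RHS]integral_mkcond; apply: eq_integral => t _; rewrite patchE.
  case: ifPn => // /negP tL; congr EFin; apply: Mdf.
  apply: lt_le_trans (norm_rV_cons_head t x); apply: (lt_trans LM).
  by rewrite ltNge; apply/negP => H; apply: tL; rewrite inE/= in_itv/= -ler_norml.
rewrite FTC_slice//; last by lra.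
by rewrite !Nf ?subee//; apply: lt_le_trans (norm_rV_cons_head _ x);
  rewrite ?normrN gtr0_norm.
Qed.

(** The value at [t] is the integral of the derivative from a point left of [t] where [f] vanishes;
    enlarging the interval to the whole line makes the bound independent of [t]. *)
Lemma le_integral_partial d (f : 'rV[R]_d.+1 -> R) (t : R) (x : 'rV[R]_d) : C1c f ->
  (`|f (rV_cons (t, x))|%:E <=
   \int[lebesgue_measure]_s `|partial ord0 f (rV_cons (s, x))|%:E)%E.
Proof.
move=> C1f; have [[_ [N Nf]] /(_ ord0)[_ [cdf _]]] := C1f.
pose L := Num.max 0 (Num.max N (- t)) + 1.
have L0 : 0 < L by rewrite /L ltr_wpDl// le_max lexx.
have LN : N < L by rewrite /L ltr_pwDr// !le_max lexx !orbT.
have Lt : - L < t by rewrite ltrNl /L ltr_pwDr// !le_max lexx !orbT.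
have fL : f (rV_cons (- L, x)) = 0.
  by rewrite Nf//; apply: lt_le_trans (norm_rV_cons_head _ x); rewrite normrN gtr0_norm.
have mdf : measurable_fun setT (fun s => partial ord0 f (rV_cons (s, x))).
  by apply: continuous_measurable_fun; exact: continuous_slice_head.
have := FTC_slice x C1f Lt; rewrite fL sube0 => H.
rewrite -abse_EFin -H; apply: (le_trans (le_abse_integral _ _ _)) => //.
  by apply/measurable_EFinP; apply: measurable_funTS.
apply: ge0_subset_integral => //.
by apply/measurable_EFinP; apply: measurableT_comp.
Qed.

End slices.

(** * The Gagliardo-Nirenberg inequality *)

Lemma le_poweR (R : realType) (x y : \bar R) (r : R) : (0 <= r)%R ->
  (0 <= x)%E -> (x <= y)%E -> (x `^ r <= y `^ r)%E.
Proof.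
move=> r0 x0 xy; apply: gt0_ler_poweR => //; rewrite in_itv/= leey andbT//.
exact: le_trans xy.
Qed.

Section hoelder_on.
Context d (T : measurableType d) (R : realType) (mu : {measure set T -> \bar R}).
Local Open Scope ereal_scope.

(** Hoelder's inequality on the whole space for the extensions by 0 outside [D]; since the exponents
    are positive, the powers of these extensions also vanish there. *)
Lemma hoelder_ge0 (D : set T) (f g : T -> R) (p q : R) :
  measurable D -> measurable_fun D f -> measurable_fun D g ->
  (forall x, D x -> 0 <= f x)%R -> (forall x, D x -> 0 <= g x)%R ->
  (0 < p)%R -> (0 < q)%R -> (p^-1 + q^-1 = 1)%R ->
  \int[mu]_(x in D) (f x * g x)%:E <=
  (\int[mu]_(x in D) (f x `^ p)%:E) `^ p^-1 *
  (\int[mu]_(x in D) (g x `^ q)%:E) `^ q^-1.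
Proof.
move=> mD mf mg f0 g0 p0 q0 pq.
have mfD : measurable_fun setT (f \_ D) by apply/(measurable_restrictT _ mD).
have mgD : measurable_fun setT (g \_ D) by apply/(measurable_restrictT _ mD).
have := @hoelder _ _ _ mu _ _ _ _ mfD mgD p0 q0 pq.
rewrite Lnorm1 unlock.
have aux (k : T -> R) r : (0 < r)%R -> (forall x, D x -> 0 <= k x)%R ->
   \int[mu]_x (`|((EFin \o k \_ D) x)| `^ r) = \int[mu]_(x in D) (k x `^ r)%:E.
  move=> r0 k0; rewrite [RHS]integral_mkcond; apply: eq_integral => x _ /=.
  rewrite !patchE; case: ifPn => [|_]; rewrite ?inE.
    by move=> Dx; rewrite ger0_norm ?k0.
  by rewrite normr0 powR0// gt_eqF.
rewrite !aux//; apply: le_trans.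
rewrite [leLHS]integral_mkcond le_eqVlt; apply/orP; left; apply/eqP.
apply: eq_integral => x _ /=; rewrite !patchE; case: ifPn; rewrite ?inE => Dx.
  by rewrite ger0_norm// mulr_ge0 ?f0 ?g0.
by rewrite mul0r normr0.
Qed.

End hoelder_on.

Section gagliardo_nirenberg.
Context {R : realType}.
Local Open Scope ereal_scope.

(** The L^1 norm of the gradient, kept in the extended reals so that Tonelli's theorem applies
    without integrability conditions. *)
Definition grad1 d (f : 'rV[R]_d -> R) : \bar R :=
  \sum_i \int[lebesgue_rV d]_x (`|partial i f x|%R)%:E.

Lemma grad1_ge0 d (f : 'rV[R]_d -> R) : 0 <= grad1 f.
Proof. by apply: sume_ge0 => i _; exact: integral_ge0. Qed.

Lemma measurable_C1c d (f : 'rV[R]_d -> R) : C1c f -> measurable_fun setT f.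
Proof. by move=> [[cf _] _]; exact: continuous_measurable_rV. Qed.

Lemma measurable_partial_C1c d (f : 'rV[R]_d -> R) i : C1c f ->
  measurable_fun setT (fun x => (`|partial i f x|%R)%:E).
Proof.
move=> [_ /(_ i)[_ [cf _]]]; apply/measurable_EFinP/measurableT_comp => //.
exact: continuous_measurable_rV.
Qed.

Lemma integral_partial_rV_cons12 d (f : 'rV[R]_d.+1 -> R) i : C1c f ->
  \int[lebesgue_rV d.+1]_x (`|partial i f x|%R)%:E =
  \int[lebesgue_measure]_t \int[lebesgue_rV d]_x (`|partial i f (rV_cons (t, x))|%R)%:E.
Proof.
move=> C1f; apply: (integral_rV_cons12 (measurable_partial_C1c i C1f)) => x.
by rewrite lee_fin.
Qed.

Lemma integral_partial_rV_cons21 d (f : 'rV[R]_d.+1 -> R) i : C1c f ->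
  \int[lebesgue_rV d.+1]_x (`|partial i f x|%R)%:E =
  \int[lebesgue_rV d]_x \int[lebesgue_measure]_t (`|partial i f (rV_cons (t, x))|%R)%:E.
Proof.
move=> C1f; apply: (integral_rV_cons21 (measurable_partial_C1c i C1f)) => x.
by rewrite lee_fin.
Qed.

Lemma measurable_partial_slice d (f : 'rV[R]_d.+1 -> R) i : C1c f ->
  measurable_fun setT (fun t : R => \int[lebesgue_rV d]_x
    (`|partial i (fun x => f (rV_cons (t, x))) x|%R)%:E).
Proof.
move=> C1f; rewrite (_ : (fun _ => _) =
   fubini_F (lebesgue_rV d) (fun z => (`|partial (lift ord0 i) f (rV_cons z)|%R)%:E)).
  apply: measurable_fun_fubini_tonelli_F => //.
  exact: (measurableT_comp (measurable_partial_C1c _ C1f) (@measurable_rV_cons R d)).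
by apply/funext => t; rewrite partial_slice_tail.
Qed.

Lemma measurable_grad1_slice d (f : 'rV[R]_d.+1 -> R) : C1c f ->
  measurable_fun setT (fun t : R => grad1 (fun x => f (rV_cons (t, x)))).
Proof.
by move=> C1f; apply: emeasurable_sum => i; exact: measurable_partial_slice.
Qed.

Lemma integral_grad1_slice d (f : 'rV[R]_d.+1 -> R) : C1c f ->
  grad1 f = \int[lebesgue_rV d.+1]_x (`|partial ord0 f x|%R)%:E +
    \int[lebesgue_measure]_t grad1 (fun x => f (rV_cons (t, x))).
Proof.
move=> C1f; rewrite /grad1 big_ord_recl; congr (_ + _).
rewrite ge0_integral_sum//; last 2 first.
- by move=> i; exact: measurable_partial_slice.
- by move=> i t _; apply: integral_ge0.
apply: eq_bigr => i _.
rewrite [LHS]integral_partial_rV_cons12; last exact: C1f.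
by apply: eq_integral => t _; rewrite partial_slice_tail.
Qed.

Lemma grad1_slice_le d (f : 'rV[R]_d.+1 -> R) : C1c f ->
  \int[lebesgue_measure]_t grad1 (fun x => f (rV_cons (t, x))) <= grad1 f.
Proof. by move=> C1f; rewrite integral_grad1_slice// leeDr// integral_ge0. Qed.

(** Integrating the pointwise bound by the line integral of the first partial derivative over the
    slice gives a bound uniform in [t]. In the induction on the dimension this uniformity lets a
    power of the slice integral be pulled out of the integral over [t]. *)
Lemma integral_slice_le_grad1 d (f : 'rV[R]_d.+1 -> R) t : C1c f ->
  \int[lebesgue_rV d]_x (`|f (rV_cons (t, x))|)%:E <= grad1 f.
Proof.
move=> C1f; apply: (@le_trans _ _ (\int[lebesgue_rV d.+1]_x (`|partial ord0 f x|%R)%:E)).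
  rewrite [leRHS]integral_partial_rV_cons21; last exact: C1f.
  apply: ge0_le_integral => //.
  - apply/measurable_EFinP; apply: measurableT_comp => //.
    by apply: measurable_C1c; exact: C1c_slice.
  - apply: (@measurable_fun_fubini_tonelli_G _ _ _ _ _ lebesgue_measure
       (fun z => (`|partial ord0 f (rV_cons z)|%R)%:E)) => //.
    exact: (measurableT_comp (measurable_partial_C1c _ C1f) (@measurable_rV_cons R d)).
  - by move=> x _; exact: le_integral_partial.
rewrite integral_grad1_slice// leeDl//; apply: integral_ge0 => s _; exact: grad1_ge0.
Qed.

(* Dual version of W^(1,1) -> L^(n/(n-1)). For n = 1 it is the bound of |f| by the
   integral of |f'|, where the induction on the dimension starts. *)
Lemma gagliardo_nirenberg_rV n (f : 'rV[R]_n.+1 -> R) (h : 'rV[R]_n.+1 -> R) :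
  C1c f -> measurable_fun setT h -> (forall x, 0 <= h x)%R ->
  \int[lebesgue_rV n.+1]_x (`|f x| * h x `^ (n.+1%:R^-1))%:E <=
  grad1 f * (\int[lebesgue_rV n.+1]_x (h x)%:E) `^ (n.+1%:R^-1).
Proof.
elim: n f h => [|n IH] f h C1f mh h0.
  have fG x : (`|f x|)%:E <= grad1 f.
    rewrite (rV_consP x); apply: le_trans (le_integral_partial _ _ C1f) _.
    rewrite /grad1 big_ord1 [leRHS]integral_partial_rV_cons12; last exact: C1f.
    apply: ge0_le_integral => //.
    - apply/measurable_EFinP; apply: measurableT_comp => //.
      apply: continuous_measurable_fun; apply: continuous_slice_head.
      by have [_ /(_ ord0)[_ []]] := C1f.
    - apply: (@measurable_fun_fubini_tonelli_F _ _ _ _ _ (lebesgue_rV 0)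
         (fun z => (`|partial ord0 f (rV_cons z)|%R)%:E)) => //.
      exact: (measurableT_comp (measurable_partial_C1c _ C1f) (@measurable_rV_cons R 0)).
    (* The space of dimension 0 is a point of mass 1, so the double integral reduces to the line
       integral. *)
    - move=> t _ /=; rewrite integral_dirac//.
        by rewrite diracT mul1e (thinmx0 (\row__ _)).
      apply: (measurableT_comp (measurable_partial_C1c ord0 C1f)).
      apply: measurableT_comp (@measurable_rV_cons R 0) _.
      exact: measurable_pair1.
  rewrite invr1 poweRe1; last by apply: integral_ge0 => x _; rewrite lee_fin.
  rewrite -ge0_integralZl//; last 3 first.
    exact/measurable_EFinP.
    by move=> x _; rewrite lee_fin.
    exact: grad1_ge0.
  apply: ge0_le_integral => //.
  - by move=> x _; rewrite lee_fin mulr_ge0// powR_ge0.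
  - apply/measurable_EFinP; apply: measurable_funM.
      by apply: measurableT_comp => //; exact: measurable_C1c.
    by under eq_fun do rewrite powRr1//.
  - by apply: measurable_funeM; exact/measurable_EFinP.
  - by move=> x _; rewrite EFinM powRr1// lee_wpmul2r// lee_fin.
have mf := measurable_C1c C1f.
(* [p] = (n + 2)/(n + 1) is the conjugate exponent of n + 2, and |f|^p = |f| |f|^(1/(n + 1)) is the
   integrand of the induction hypothesis on a slice, with |f| itself in the role of [h]. *)
pose p : R := (1 + n.+1%:R^-1)%R.
have p0 : (0 < p)%R by rewrite /p ltr_wpDr.
have key : \int[lebesgue_rV n.+2]_x (`|f x| `^ p)%:E <= grad1 f `^ p.
  rewrite [leLHS]integral_rV_cons12; last 2 first.
  - apply/measurable_EFinP; apply: (measurableT_comp (measurable_powR _)).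
    exact: measurableT_comp.
  - by move=> x; rewrite lee_fin powR_ge0.
  apply: (@le_trans _ _ (\int[lebesgue_measure]_t
     (grad1 (fun x => f (rV_cons (t, x))) * grad1 f `^ (n.+1%:R^-1)))).
    apply: ge0_le_integral => //.
    - by move=> t _; apply: integral_ge0 => x _; rewrite lee_fin powR_ge0.
    - apply: (@measurable_fun_fubini_tonelli_F _ _ _ _ _ (lebesgue_rV n.+1)
         (fun z => (`|f (rV_cons z)| `^ p)%:E)) => //.
        apply/measurable_EFinP; apply: (measurableT_comp (measurable_powR _)).
        apply: measurableT_comp => //; apply: measurableT_comp => //.
        exact: measurable_rV_cons.
    - apply: emeasurable_funM => //; exact: measurable_grad1_slice.
    - move=> t _; have C1ft := C1c_slice t C1f.
have mft : measurable_fun setT (fun x => `|f (rV_cons (t, x))|%R).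
        by apply: measurableT_comp => //; exact: measurable_C1c.
      rewrite [leLHS](_ : _ = \int[lebesgue_rV n.+1]_x
         (`|f (rV_cons (t, x))| * `|f (rV_cons (t, x))| `^ (n.+1%:R^-1))%:E).
        apply: le_trans (IH _ _ C1ft mft _) _ => //.
        apply: lee_wpmul2l; first exact: grad1_ge0.
        apply: le_poweR; [by []| |]; first by apply: integral_ge0 => x _; rewrite lee_fin.
        exact: integral_slice_le_grad1.
      apply: eq_integral => x _; congr EFin; rewrite /p.
      have [->|fx0] := eqVneq `|f (rV_cons (t, x))|%R 0%R.
        by rewrite mul0r powR0// gt_eqF.
      by rewrite powRD ?fx0 ?implybT// powRr1.
  rewrite ge0_integralZr//; last 3 first.
  - exact: measurable_grad1_slice.
  - by move=> t _; exact: grad1_ge0.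
  - exact: poweR_ge0.
  apply: (@le_trans _ _ (grad1 f * grad1 f `^ (n.+1%:R^-1))).
    by apply: lee_wpmul2r; [exact: poweR_ge0|exact: grad1_slice_le].
  rewrite -[X in X * _](poweRe1 (grad1_ge0 f)) -poweRD//.
  by rewrite /poweRD_def gt_eqF.
have p1 : (p^-1 + n.+2%:R^-1 = 1)%R.
  rewrite /p; field.
  by rewrite !gt_eqF// -?natr1; have := ler0n R n; lra.
(* Hoelder's inequality separates [h] from [f], and by [key] the factor containing [f] is at most
   [grad1 f]. *)
have := @hoelder_ge0 _ _ _ (lebesgue_rV n.+2) setT (fun x => `|f x|%R) (fun x => h x `^ (n.+2%:R^-1))%R
   p n.+2%:R measurableT _ _ _ _ p0 _ p1.
have -> // : \int[lebesgue_rV n.+2]_x ((h x `^ n.+2%:R^-1) `^ n.+2%:R)%R%:E =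
    \int[lebesgue_rV n.+2]_x (h x)%:E.
  by apply: eq_integral => x _; rewrite -powRrM mulVf// powRr1.
move=> H; apply: le_trans (H _ _ _ _ _) _ => //.
- exact: measurableT_comp.
- exact: (measurableT_comp (measurable_powR _)).
- by move=> x _; exact: powR_ge0.
apply: lee_wpmul2r; first exact: poweR_ge0.
rewrite -[leRHS]poweRe1 ?grad1_ge0// -(@divff _ p) ?gt_eqF// poweRrM.
apply: le_poweR => //.
- by rewrite invr_ge0 ltW.
- by apply: integral_ge0; move=> x _; rewrite lee_fin powR_ge0.
Qed.

End gagliardo_nirenberg.

(** * Smooth functions and truncations *)

Section chain_rule.
Context {R : realType}.

(** Along the line h -> h v + x, [g] becomes a function of one real variable, so its directional
    derivative alone is enough; full differentiability of [g] is not assumed. *)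
Lemma is_derive_comp_dir (V : normedModType R) (k : R -> R) (g : V -> R) (x v : V) (dk dg : R) :
  is_derive (g x) 1 k dk -> is_derive x v g dg -> is_derive x v (k \o g) (dk * dg).
Proof.
move=> kd gd.
have lineE (f : V -> R) : (fun h : R => h^-1 *: ((f \o shift x) (h *: v) - f x)) =
   (fun h : R => h^-1 *: (((fun h : R => f (h *: v + x)) \o shift 0) (h *: 1) - (fun h : R => f (h *: v + x)) 0)).
  by apply/funext => h /=; rewrite scale0r add0r addr0 [_%:A]mulr1.
have gd0 : is_derive (0 : R) 1 (fun h : R => g (h *: v + x)) dg.
  case: gd => gd gE; apply: DeriveDef; first exact: (proj1 (derivable1P g x v) gd).
  by rewrite -gE /derive lineE.
have kd0 : is_derive ((fun h : R => g (h *: v + x)) 0) 1 k dk.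
  by rewrite /= scale0r add0r; exact: kd.
have [dkg kgE] := is_derive1_comp kd0 gd0.
apply: DeriveDef; first exact: (proj2 (derivable1P (k \o g) x v) dkg).
by rewrite -kgE /derive lineE.
Qed.

(** The profile is |t|^(2 r). At 0, where the power itself has no usable derivative, (h^2)^r <= h^2
    for |h| < 1 bounds the difference quotient by |h|. *)
Lemma is_derive_powR_sqr (r : R) (t : R) : 1 < r ->
  is_derive t 1 (fun t => (t ^+ 2) `^ r) (2 * r * t * (t ^+ 2) `^ (r - 1)).
Proof.
move=> r1; have [->|t0] := eqVneq t 0.
  rewrite mulr0 mul0r.
  have H : (fun h : R => h^-1 *: (((fun t : R => (t ^+ 2) `^ r) \o shift 0) (h *: 1)
      - (0 ^+ 2) `^ r)) @ 0^' --> (0 : R).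
    apply/cvgr0Pnorm_lt => e e0; near=> h.
    have h0 : h != 0 by near: h; exact: nbhs_dnbhs_neq.
    have he : `|h| < e.
      near: h; exact: dnbhs0_lt.
    have h1 : `|h| < 1.
      near: h; exact: dnbhs0_lt.
    rewrite /= addr0 [_%:A]mulr1 expr0n/= (@powR0 _ r) ?gt_eqF//; last lra.
    rewrite subr0 normrM normfV (ger0_norm (powR_ge0 _ _)).
    apply: le_lt_trans he; rewrite ler_pdivrMl ?normr_gt0//.
    rewrite -normrM -expr2 ger0_norm ?sqr_ge0//.
    rewrite -[leRHS]powRr1 ?sqr_ge0//; apply: ger_powR; last exact: ltW.
    apply/andP; split; first by rewrite exprn_even_gt0.
    by rewrite -real_normK ?num_real// expr_le1// ltW.
  apply: DeriveDef; first by apply/cvg_ex; exists 0.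
  by apply/cvg_lim.
have t20 : 0 < t ^+ 2 by rewrite exprn_even_gt0.
have H := is_derive1_powR r t20.
have Ht : is_derive t 1 (fun t : R => t ^+ 2) (2 * t).
  apply: DeriveDef; first exact: exprn_derivable.
  by rewrite exp_derive /= expr1 [_ *: 1]mulr1 [_ *: t]scaler_nat mulr_natl.
have := @is_derive1_comp _ (fun u => u `^ r) (fun t => t ^+ 2) _ _ _ H Ht.
by rewrite (_ : _ * (2 * t) = 2 * r * t * (t ^+ 2) `^ (r - 1))//; ring.
Unshelve. all: by end_near. Qed.

Lemma continuous_powR_sqr (r : R) : 1 < r ->
  continuous (fun t : R => 2 * r * t * (t ^+ 2) `^ (r - 1)).
Proof.
move=> r1 t; have [->|t0] := eqVneq t 0.
  suff H : (fun t : R => 2 * r * t * (t ^+ 2) `^ (r - 1)) @ (0 : R) --> (0 : R).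
    by rewrite /continuous_at mulr0 mul0r.
  apply/cvgr0Pnorm_lt => e e0; near=> h.
  have he : `|h| < e / (2 * r).
    near: h; exists (e / (2 * r)) => /=; first by apply: divr_gt0 => //; lra.
    by move=> h /=; rewrite sub0r normrN.
  have h1 : `|h| < 1.
    by near: h; exists 1 => //= h /=; rewrite sub0r normrN.
  rewrite normrM (ger0_norm (powR_ge0 _ _)) normrM gtr0_norm; last lra.
  have hr : (h ^+ 2) `^ (r - 1) <= 1.
    apply: (@le_trans _ _ (1 `^ (r - 1))); last by rewrite powR1.
    apply: ge0_ler_powR; rewrite ?nnegrE ?sqr_ge0//; first lra.
    by rewrite -real_normK ?num_real// expr_le1// ltW.
  apply: (@le_lt_trans _ _ (2 * r * `|h|)).
    by rewrite ler_piMr// mulr_ge0//; lra.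
  by rewrite -ltr_pdivlMl; [rewrite mulrC|lra].
have t20 : 0 < t ^+ 2 by rewrite exprn_even_gt0.
have H : {for (t ^+ 2), continuous (fun u : R => u `^ (r - 1))}.
  by apply: differentiable_continuous; apply/derivable1_diffP; have [] := is_derive1_powR (r - 1) t20.
apply: (@continuousM _ _ (fun t : R => 2 * r * t) (fun t : R => (t ^+ 2) `^ (r - 1))).
  exact: mulrl_continuous.
apply: (@continuous_comp _ _ _ (fun t : R => t ^+ 2) (fun u : R => u `^ (r - 1))).
  exact: exprn_continuous.
exact: H.
Unshelve. all: by end_near. Qed.

End chain_rule.

(** * Smooth functions as a class stable under partial derivatives *)

Section smooth_functions.
Context {R : realType} {d : nat}.
Implicit Types f g : 'rV[R]_d -> R.

(** Smoothness speaks of all iterated partial derivatives, so it is the largest class of continuous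
    derivable functions stable under partial derivatives; exhibiting one invariant class [P]
    suffices. *)
Lemma smooth_coind (P : ('rV[R]_d -> R) -> Prop) :
  (forall f, P f -> continuous f /\
     forall i, (forall x, derivable f x (delta_mx ord0 i)) /\ P (partial i f)) ->
  forall f, P f -> smooth f.
Proof.
move=> H f Pf s; have : P (foldr (@partial R d) f s).
  by elim: s => [//|i s IH] /=; have [_ /(_ i)[]] := H _ IH.
by move=> /H[cf df]; split => // i x; have [] := df i.
Qed.

Lemma smooth_continuous f : smooth f -> continuous f.
Proof. by move=> /(_ [::])[]. Qed.

Lemma smooth_derivable f : smooth f -> forall i x, derivable f x (delta_mx ord0 i).
Proof. by move=> /(_ [::])[]. Qed.

Lemma smooth_partial f i : smooth f -> smooth (partial i f).
Proof. by move=> sf s; have := sf (rcons s i); rewrite foldr_rcons. Qed.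

Lemma smooth_cst (c : R) : smooth (cst c : 'rV[R]_d -> R).
Proof.
apply: (@smooth_coind (fun f => exists c : R, f = cst c)); last by exists c.
move=> _ [{}c ->]; split; first exact: cst_continuous.
move=> i; split=> [x|]; first exact: derivable_cst.
by exists 0; apply/funext => x; rewrite /partial derive_cst.
Qed.

(** The algebra generated by [r] and the smooth functions. By the product rule it is stable under
    partial derivatives as soon as those of [r] belong to it, which makes it an invariant class for
    [smooth_coind]. *)
Inductive smooth_alg (r : 'rV[R]_d -> R) : ('rV[R]_d -> R) -> Prop :=
| smooth_alg_smooth f : smooth f -> smooth_alg r f
| smooth_alg_gen : smooth_alg r r
| smooth_algD f g : smooth_alg r f -> smooth_alg r g -> smooth_alg r (f + g)
| smooth_algM f g : smooth_alg r f -> smooth_alg r g -> smooth_alg r (f * g).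

(* Meant for [r = 1 / sqrt (g ^ 2 + e)] with [g] smooth: [partial i r] is then
   [- g * partial i g * r ^ 3]. *)
Lemma smooth_alg_sub r : continuous r ->
  (forall i, (forall x, derivable r x (delta_mx ord0 i)) /\ smooth_alg r (partial i r)) ->
  forall f, smooth_alg r f -> smooth f.
Proof.
move=> cr dr; apply: smooth_coind => f; elim=> {f}.
- move=> f sf; split; first exact: smooth_continuous.
  move=> i; split; first exact: smooth_derivable.
  by apply: smooth_alg_smooth; exact: smooth_partial.
- by [].
- move=> f g Hf [cf df] Hg [cg dg]; split.
    by move=> x; apply: continuousD; [exact: cf|exact: cg].
  move=> i; have [df1 df2] := df i; have [dg1 dg2] := dg i; split.
    by move=> x; exact: derivableD.
  rewrite (_ : partial i _ = partial i f + partial i g); first exact: smooth_algD.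
  by apply/funext => x; rewrite /partial deriveD.
- move=> f g Hf [cf df] Hg [cg dg]; split.
    by move=> x; apply: continuousM; [exact: cf|exact: cg].
  move=> i; have [df1 df2] := df i; have [dg1 dg2] := dg i; split.
    by move=> x; exact: derivableM.
  rewrite (_ : partial i _ = f * partial i g + g * partial i f).
    by apply: smooth_algD; apply: smooth_algM.
  by apply/funext => x; rewrite /partial deriveM.
Qed.

(** With the trivial generator 0 the algebra contains only smooth functions; this is how sums and
    products of smooth functions are obtained. *)
Lemma smooth_alg_cst0 f : smooth_alg (cst 0) f -> smooth f.
Proof.
have s0 := smooth_cst 0; apply: smooth_alg_sub; first exact: smooth_continuous.
move=> i; split; first exact: smooth_derivable.
by apply: smooth_alg_smooth; exact: smooth_partial.
Qed.

Lemma smoothD f g : smooth f -> smooth g -> smooth (f + g).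
Proof.
by move=> sf sg; apply: smooth_alg_cst0; apply: smooth_algD; apply: smooth_alg_smooth.
Qed.

Lemma smoothM f g : smooth f -> smooth g -> smooth (f * g).
Proof.
by move=> sf sg; apply: smooth_alg_cst0; apply: smooth_algM; apply: smooth_alg_smooth.
Qed.

Lemma smoothZ (c : R) f : smooth f -> smooth (c \*: f).
Proof. by move=> sf; have := smoothM (smooth_cst c) sf. Qed.

End smooth_functions.

(** * Smooth regularization of the absolute value *)

Section sqrt_regularization.
Context {R : realType}.

Definition sqrt_reg (e t : R) : R := Num.sqrt (t ^+ 2 + e).

Lemma sqrt_reg_arg_gt0 (e t : R) : 0 < e -> 0 < t ^+ 2 + e.
Proof. by move=> e0; rewrite ltr_wpDl// sqr_ge0. Qed.

Lemma sqrt_reg_gt0 (e t : R) : 0 < e -> 0 < sqrt_reg e t.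
Proof. by move=> e0; rewrite sqrtr_gt0 sqrt_reg_arg_gt0. Qed.

Lemma sqr_sqrt_reg (e t : R) : 0 < e -> sqrt_reg e t ^+ 2 = t ^+ 2 + e.
Proof. by move=> e0; rewrite sqr_sqrtr// ltW// sqrt_reg_arg_gt0. Qed.

Lemma is_derive_sqrt_reg (e c t : R) : 0 < e ->
  is_derive t 1 (fun t => sqrt_reg e (t - c)) ((t - c) / sqrt_reg e (t - c)).
Proof.
move=> e0; pose u := fun t : R => (t - c) ^+ 2 + e.
have Hu : is_derive t 1 u (2 * (t - c)).
  have H1 : is_derive t 1 (fun t : R => t - c) 1 by apply: is_derive_eq; rewrite subr0.
  have H2 : is_derive (t - c) 1 (fun t : R => t ^+ 2) (2 * (t - c)).
    apply: DeriveDef; first exact: exprn_derivable.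
    by rewrite exp_derive /= expr1 [_ *: 1]mulr1 [_ *: _]scaler_nat mulr_natl.
  have H3 := @is_derive1_comp _ (fun t => t ^+ 2) (fun t => t - c) _ _ _ H2 H1.
  rewrite mulr1 in H3.
  by have := is_deriveD H3 (is_derive_cst e t 1); rewrite addr0.
have H := is_derive1_sqrt (sqrt_reg_arg_gt0 (t - c) e0).
have := @is_derive1_comp _ Num.sqrt u _ _ _ H Hu.
rewrite (_ : _ * (2 * (t - c)) = (t - c) / sqrt_reg e (t - c))// /sqrt_reg.
by field; rewrite gt_eqF// sqrt_reg_gt0.
Qed.

Lemma continuous_sqrt_reg (e c : R) : 0 < e -> continuous (fun t => sqrt_reg e (t - c)).
Proof.
move=> e0 t; apply: differentiable_continuous; apply/derivable1_diffP.
by have [] := is_derive_sqrt_reg c t e0.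
Qed.

Lemma normr_le_sqrt_reg (e t : R) : 0 < e -> `|t| <= sqrt_reg e t.
Proof.
by move=> e0; rewrite -sqrtr_sqr ler_wsqrtr// lerDl ltW.
Qed.

Lemma sqrt_reg_le (e t : R) : 0 < e -> sqrt_reg (e ^+ 2) t <= `|t| + e.
Proof.
move=> e0; have te0 : 0 <= `|t| + e by rewrite addr_ge0// ltW.
apply: (@le_trans _ _ (Num.sqrt ((`|t| + e) ^+ 2))); last by rewrite sqrtr_sqr ger0_norm.
apply: ler_wsqrtr.
by rewrite sqrrD real_normK ?num_real// lerD2r lerDl mulrn_wge0// mulr_ge0// ltW.
Qed.

Lemma smooth_sqrt_reg d (g : 'rV[R]_d -> R) (e c : R) : 0 < e -> smooth g ->
  smooth (fun x => sqrt_reg e (g x - c)).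
Proof.
move=> e0 sg; pose r x := (sqrt_reg e (g x - c))^-1.
have nz x : sqrt_reg e (g x - c) != 0 by rewrite gt_eqF// sqrt_reg_gt0.
have Hr x i : is_derive x (delta_mx ord0 i) r
   (- (g x - c) * r x * r x * r x * partial i g x).
  have H1 := is_derive_sqrt_reg c (g x) e0.
  have H2 : is_derive (g x) 1 (fun t => (sqrt_reg e (t - c))^-1)
      (- (sqrt_reg e (g x - c)) ^- 2 * ((g x - c) / sqrt_reg e (g x - c))).
    exact: (is_deriveV _ H1).
  have H3 : is_derive x (delta_mx ord0 i) g (partial i g x).
    by apply: DeriveDef => //; exact: smooth_derivable.
  have := is_derive_comp_dir H2 H3.
  rewrite (_ : _ * partial i g x = - (g x - c) * r x * r x * r x * partial i g x)//.
  by rewrite /r; field.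
have csg : continuous (fun x => sqrt_reg e (g x - c)).
  move=> x; apply: (@continuous_comp _ _ _ g (fun t => sqrt_reg e (t - c))).
    exact: smooth_continuous.
  exact: continuous_sqrt_reg.
have cr : continuous r by move=> x; exact: (cvgV (nz x) (csg x)).
have sgc : smooth_alg r (fun x => g x - c).
  by apply: smooth_alg_smooth; exact: (smoothD sg (smooth_cst (- c))).
apply: (@smooth_alg_sub _ _ r) => //.
- move=> i; split; first by move=> x; have [] := Hr x i.
  rewrite (_ : partial i r = ((cst (-1)) * (fun x => g x - c)) * r * r * r * partial i g).
    have sr := smooth_alg_gen r.
    apply: smooth_algM; last by apply: smooth_alg_smooth; exact: smooth_partial.
    do 3 (apply: smooth_algM; last exact: sr).
    apply: smooth_algM; last exact: sgc.
    by apply: smooth_alg_smooth; exact: smooth_cst.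
  apply/funext => x; have [_] := Hr x i; rewrite /partial => ->.
  change (- (g x - c) * r x * r x * r x * partial i g x =
    - 1 * (g x - c) * r x * r x * r x * partial i g x).
  by rewrite mulN1r.
(* The square root is its square times its reciprocal [r], hence lies in the algebra generated by
   [r]. *)
- rewrite (_ : (fun x => sqrt_reg e (g x - c)) = ((fun x => g x - c) * (fun x => g x - c) + cst e) * r).
    apply: smooth_algM; last exact: smooth_alg_gen.
    apply: smooth_algD; first exact: smooth_algM.
    by apply: smooth_alg_smooth; exact: smooth_cst.
  apply/funext => x; change (sqrt_reg e (g x - c) =
    ((g x - c) * (g x - c) + e) * (sqrt_reg e (g x - c))^-1).
  by rewrite -expr2 -(sqr_sqrt_reg _ e0) expr2 mulfK.
Qed.

End sqrt_regularization.

(** * The truncation sign(t) (|t| - c)^+ and its smooth approximations *)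

Section truncation_regularization.
Context {R : realType}.

(** The profiles that act on test functions: [k 0 = 0] preserves the support, and the bound on [k']
    makes composition Lipschitz in L^2. The bound 2 is the one available for [trunc_reg'].
    Smoothness of compositions is demanded outright, because it is verified on the explicit formula
    and not through a chain rule of all orders. *)
Definition smooth_nonlinearity d (k k' : R -> R) :=
  [/\ k 0 = 0, forall t : R, is_derive t (1 : R) k (k' t), continuous k',
      forall t : R, `|k' t| <= 2 &
      forall g : 'rV[R]_d -> R, smooth g -> smooth (k \o g)].

(** For c >= 0 the truncation sign(t) (|t| - c)^+ equals t + (|t - c| - |t + c|) / 2; here both
    absolute values are replaced by their regularizations. *)
Definition trunc_reg (c e t : R) : R :=
  t + (sqrt_reg e (t - c) - sqrt_reg e (t + c)) / 2.

Definition trunc_reg' (c e t : R) : R :=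
  1 + ((t - c) / sqrt_reg e (t - c) - (t + c) / sqrt_reg e (t + c)) / 2.

Lemma smooth_nonlinearity_trunc d (c e : R) : 0 < e ->
  smooth_nonlinearity d (trunc_reg c e) (trunc_reg' c e).
Proof.
move=> e0.
have HS (u t : R) : is_derive t (1 : R) (fun t => sqrt_reg e (t + u)) ((t + u) / sqrt_reg e (t + u)).
  by have := is_derive_sqrt_reg (- u) t e0; under eq_fun do rewrite opprK; rewrite opprK.
have cS (u : R) : continuous (fun t => sqrt_reg e (t + u)).
  by have := @continuous_sqrt_reg _ e (- u) e0; under eq_fun do rewrite opprK.
have nz (t : R) : sqrt_reg e t != 0 by rewrite gt_eqF// sqrt_reg_gt0.
have cq (u : R) : continuous (fun t : R => (t + u) / sqrt_reg e (t + u)).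
  move=> t; apply: (@cvgM _ _ _ _ (fun t : R => t + u)).
    by apply: cvgD; [exact: cvg_id|exact: cvg_cst].
  exact: (cvgV (nz (t + u)) (cS u t)).
have q1 (t : R) : `|t / sqrt_reg e t| <= 1.
  rewrite normrM normfV (gtr0_norm (sqrt_reg_gt0 t e0)).
  by rewrite ler_pdivrMr ?sqrt_reg_gt0// mul1r normr_le_sqrt_reg.
split.
- by rewrite /trunc_reg add0r sub0r add0r /sqrt_reg sqrrN subrr mul0r.
- move=> t; have H1 := is_derive_sqrt_reg c t e0; have H2 := HS c t.
  have H3 := is_deriveD (is_derive_id t 1) (is_deriveZ 2^-1 (is_deriveB H1 H2)).
  rewrite (_ : trunc_reg c e = id + 2^-1 \*: ((fun t => sqrt_reg e (t - c)) - (fun t => sqrt_reg e (t + c)))).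
    by rewrite (_ : trunc_reg' c e t = 1 + 2^-1 *: ((t - c) / sqrt_reg e (t - c) - (t + c) / sqrt_reg e (t + c)))// [_ *: _]mulrC.
  by apply/funext => s; rewrite /trunc_reg mulrC.
- move=> t; apply: cvgD; first exact: cvg_cst.
  apply: cvgM; last exact: cvg_cst.
  by apply: cvgB; [exact: (cq (- c))|exact: cq].
- move=> t; have := q1 (t - c); have := q1 (t + c); rewrite /trunc_reg' !ler_norml; lra.
- move=> g sg.
  have H1 := smooth_sqrt_reg c e0 sg; have H2 := smooth_sqrt_reg (- c) e0 sg.
  have := smoothD sg (smoothZ 2^-1 (smoothD H1 (smoothZ (-1) H2))).
  congr smooth; apply/funext => x; rewrite /trunc_reg /=.
  change (g x + 2^-1 * (sqrt_reg e (g x - c) + -1 * sqrt_reg e (g x - - c)) =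
    g x + (sqrt_reg e (g x - c) - sqrt_reg e (g x + c)) / 2).
  by rewrite opprK mulN1r mulrC.
Qed.

Lemma smooth_nonlinearity_lipschitz d (k k' : R -> R) : smooth_nonlinearity d k k' ->
  forall a b, `|k a - k b| <= 2 * `|a - b|.
Proof.
move=> [_ dk _ bk _] a b.
wlog ab : a b / a < b => [H|].
  have [/H//|ba|->] := ltgtP a b; last by rewrite !subrr normr0 mulr0.
  by rewrite distrC [in leRHS]distrC; exact: H.
have [c _ kab] : exists2 c, c \in `]a, b[%R & k b - k a = k' c * (b - a).
  have ck : continuous k.
    move=> x; apply: differentiable_continuous.
    by apply/derivable1_diffP; have [] := dk x.
  exact: (@MVT _ k k' a b ab (fun x _ => dk x) (continuous_subspaceT ck)).
by rewrite distrC kab normrM distrC ler_wpM2r.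
Qed.

Definition trunc (c t : R) : R := t + (`|t - c| - `|t + c|) / 2.

(** The slope of [trunc c] away from |t| = c, with the value 0 chosen at |t| = c. This makes it an
    indicator, which is what the algebra of the truncated gradients uses. *)
Definition trunc' (c t : R) : R := (c < `|t|)%R%:R.

Lemma truncE (c t : R) : 0 <= c ->
  trunc c t = if c < t then t - c else if t < - c then t + c else 0.
Proof.
move=> c0; rewrite /trunc; case: ltP => ct.
  by rewrite !gtr0_norm; lra.
case: ltP => tc; first by rewrite !ltr0_norm; lra.
by rewrite ler0_norm ?ger0_norm; lra.
Qed.

Lemma trunc'E (c t : R) : 0 <= c ->
  trunc' c t = if c < t then 1 else if t < - c then 1 else 0.
Proof. by move=> c0; rewrite /trunc' ltr_normr ltrNr; case: ltP => //=; case: ltP. Qed.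

Let delta n : R := n.+1%:R^-1.

Let delta_gt0 n : 0 < delta n. Proof. by rewrite invr_gt0. Qed.

Let cvg_delta : delta n @[n --> \oo] --> (0 : R).
Proof. exact: cvg_harmonic. Qed.

(** With parameter delta^4 the regularized absolute value exceeds t by at most delta^2, which is at
    most delta times its own value once t >= delta. Hence the slope is within delta of 1. *)
Let sg_ge (t : R) n : delta n <= t -> `|t / sqrt_reg (delta n ^+ 2 ^+ 2) t - 1| <= delta n.
Proof.
move=> dt; have t0 : 0 < t := lt_le_trans (delta_gt0 n) dt.
have d20 : 0 < delta n ^+ 2 by rewrite exprn_gt0.
have S0 : 0 < sqrt_reg (delta n ^+ 2 ^+ 2) t by rewrite sqrt_reg_gt0// exprn_gt0.
have H1 := sqrt_reg_le t d20.
have H2 := @normr_le_sqrt_reg _ _ t (exprn_gt0 2 d20).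
rewrite gtr0_norm// in H1; rewrite gtr0_norm// in H2.
have -> : t / sqrt_reg (delta n ^+ 2 ^+ 2) t - 1 = - ((sqrt_reg (delta n ^+ 2 ^+ 2) t - t) / sqrt_reg (delta n ^+ 2 ^+ 2) t).
  by field; rewrite gt_eqF.
have q0 : 0 <= (sqrt_reg (delta n ^+ 2 ^+ 2) t - t) / sqrt_reg (delta n ^+ 2 ^+ 2) t.
  by rewrite divr_ge0// ?subr_ge0// ltW.
have q1 : (sqrt_reg (delta n ^+ 2 ^+ 2) t - t) / sqrt_reg (delta n ^+ 2 ^+ 2) t <= delta n.
  rewrite ler_pdivrMr//; apply: (@le_trans _ _ (delta n ^+ 2)); first lra.
  rewrite expr2 ler_wpM2l// ?(ltW (delta_gt0 n))//; lra.
by rewrite normrN ger0_norm.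
Qed.

(* The shift of the corners by [delta n] makes the regularized slopes converge
   to [0] also at [`|t| = c]. *)
Definition trunc_seq (c : R) n := trunc_reg (c + delta n) (delta n ^+ 2 ^+ 2).
Definition trunc_seq' (c : R) n := trunc_reg' (c + delta n) (delta n ^+ 2 ^+ 2).

Lemma smooth_nonlinearity_trunc_seq d c n :
  smooth_nonlinearity d (trunc_seq c n) (trunc_seq' c n).
Proof. by apply: smooth_nonlinearity_trunc; rewrite !exprn_gt0. Qed.

Let sg_le (t : R) n : t <= - delta n -> `|t / sqrt_reg (delta n ^+ 2 ^+ 2) t + 1| <= delta n.
Proof.
move=> dt; have := @sg_ge (- t) n; rewrite lerNr => /(_ dt).
rewrite /sqrt_reg sqrrN => H; rewrite -normrN opprD -mulNr; exact: H.
Qed.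

Lemma cvg_trunc_seq (c t : R) : trunc_seq c n t @[n --> \oo] --> trunc c t.
Proof.
apply/cvgrPdist_le => e e0; near=> n.
have d0 := delta_gt0 n.
have d1 : delta n <= 1 by rewrite invf_le1// ler1n.
have dd : delta n ^+ 2 <= delta n by rewrite expr2 ler_piMr// ltW.
(* Each absolute value is off by at most [delta n] from the shift and by [delta n ^+ 2] from the
   regularization; half the sum of the two errors is then below [e]. *)
have de : delta n <= e / 3.
  by near: n; apply: (cvgr_le _ cvg_delta); apply: divr_gt0.
have d20 : 0 < delta n ^+ 2 by rewrite exprn_gt0.
rewrite /trunc /trunc_seq /trunc_reg.
have := sqrt_reg_le (t - (c + delta n)) d20.
have := @normr_le_sqrt_reg _ _ (t - (c + delta n)) (exprn_gt0 2 d20).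
have := sqrt_reg_le (t + (c + delta n)) d20.
have := @normr_le_sqrt_reg _ _ (t + (c + delta n)) (exprn_gt0 2 d20).
have := ler_distD (t - c) (t - (c + delta n)) 0.
have := ler_distD (t - (c + delta n)) (t - c) 0.
have := ler_distD (t + c) (t + (c + delta n)) 0.
have := ler_distD (t + (c + delta n)) (t + c) 0.
rewrite !subr0.
have -> : t - c - (t - (c + delta n)) = delta n by lra.
have -> : t + c - (t + (c + delta n)) = - delta n by lra.
have -> : t - (c + delta n) - (t - c) = - delta n by lra.
have -> : t + (c + delta n) - (t + c) = delta n by lra.
rewrite normrN (gtr0_norm d0) => H1 H2 H3 H4 H5 H6 H7 H8; rewrite ler_norml; lra.
Unshelve. all: by end_near. Qed.

Lemma cvg_trunc_seq' (c t : R) : 0 <= c ->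
  trunc_seq' c n t @[n --> \oo] --> trunc' c t.
Proof.
move=> c0; rewrite trunc'E//.
apply/cvgrPdist_le => e e0; rewrite /trunc_seq' /trunc_reg'.
have [ct|ct] := ltP c t; last have [tc|tc] := ltP t (- c).
- near=> n.
  have d0 := delta_gt0 n.
  have de : delta n <= e by near: n; exact: (cvgr_le _ cvg_delta).
  have d1 : delta n <= (t - c) / 2.
    by near: n; apply: (cvgr_le _ cvg_delta); apply: divr_gt0 => //; rewrite subr_gt0.
  have /sg_ge : delta n <= t - (c + delta n) by lra.
  have /sg_ge : delta n <= t + (c + delta n) by lra.
  by rewrite !ler_norml; lra.
- near=> n.
  have d0 := delta_gt0 n.
  have de : delta n <= e by near: n; exact: (cvgr_le _ cvg_delta).
  have d1 : delta n <= (- c - t) / 2.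
    by near: n; apply: (cvgr_le _ cvg_delta); apply: divr_gt0 => //; rewrite subr_gt0.
  have /sg_le : t - (c + delta n) <= - delta n by lra.
  have /sg_le : t + (c + delta n) <= - delta n by lra.
  by rewrite !ler_norml; lra.
- near=> n.
  have d0 := delta_gt0 n.
  have de : delta n <= e by near: n; exact: (cvgr_le _ cvg_delta).
  have /sg_le : t - (c + delta n) <= - delta n by lra.
  have /sg_ge : delta n <= t + (c + delta n) by lra.
  by rewrite !ler_norml; lra.
Unshelve. all: by end_near. Qed.

Lemma trunc_seq'_le2 (c t : R) n : `|trunc_seq' c n t| <= 2.
Proof. by have [_ _ _] := smooth_nonlinearity_trunc_seq 0 c n. Qed.

Lemma trunc_seq_le (c t : R) n : `|trunc_seq c n t| <= 2 * `|t|.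
Proof.
have H := smooth_nonlinearity_trunc_seq 0 c n.
by have := smooth_nonlinearity_lipschitz H t 0; have [-> _ _ _ _] := H; rewrite !subr0.
Qed.

End truncation_regularization.

(** * Square integrable functions *)

Section square_integrable.
Context d (T : measurableType d) (R : realType) (mu : {measure set T -> \bar R}).
Variables (D : set T) (mD : measurable D).
Implicit Types f g : T -> R.

Definition L2 f := measurable_fun D f /\
  mu.-integrable D (EFin \o (fun x => f x ^+ 2)).

(** A square with infinite integral gets the value 0 here, so upper bounds on [I2] are informative
    only together with [L2]. *)
Definition I2 f : R := \int[mu]_(x in D) (f x ^+ 2).

Lemma I2_ge0 f : 0 <= I2 f.
Proof. by apply: Rintegral_ge0 => x _; exact: sqr_ge0. Qed.

Lemma I2E f : L2 f -> (I2 f)%:E = (\int[mu]_(x in D) (f x ^+ 2)%:E)%E.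
Proof. by move=> [_ fi]; rewrite /I2 /Rintegral fineK//; exact: integrable_fin_num. Qed.

Lemma measurable_sqr f : measurable_fun D f -> measurable_fun D (fun x => f x ^+ 2).
Proof. by move=> mf; exact: measurable_funX. Qed.

Lemma integrable_dom f g : measurable_fun D f ->
  (forall x, D x -> `|f x| <= g x) -> mu.-integrable D (EFin \o g) ->
  mu.-integrable D (EFin \o f).
Proof.
move=> mf fg gi; apply: le_integrable gi => //; first exact/measurable_EFinP.
by move=> x Dx /=; rewrite lee_fin (le_trans (fg _ Dx))// ler_norm.
Qed.

Lemma L2_dom f g (c : R) : measurable_fun D f -> L2 g ->
  (forall x, D x -> `|f x| <= c * `|g x|) -> L2 f.
Proof.
move=> mf [mg gi] fg; split=> //.
apply: (@integrable_dom _ (fun x => c ^+ 2 * g x ^+ 2)).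
- exact: measurable_sqr.
- move=> x Dx; rewrite ger0_norm ?sqr_ge0// -exprMn -(real_normK (num_real (f x))).
  rewrite -(real_normK (num_real (c * g x))) ler_sqr ?nnegrE// normrM.
  by rewrite (le_trans (fg _ Dx))// ler_wpM2r// ler_norm.
- by have := integrableZl mD (c ^+ 2) gi.
Qed.

Lemma L2D f g : L2 f -> L2 g -> L2 (fun x => f x + g x).
Proof.
move=> [mf fi] [mg gi]; split; first exact: measurable_funD.
apply: (@integrable_dom _ (fun x => 2 * f x ^+ 2 + 2 * g x ^+ 2)).
- by apply: measurable_sqr; exact: measurable_funD.
- move=> x Dx; rewrite ger0_norm ?sqr_ge0//.
  by have := sqr_ge0 (f x - g x); rewrite sqrrB sqrrD; lra.
- exact: (integrableD mD (integrableZl mD 2 fi) (integrableZl mD 2 gi)).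
Qed.

Lemma L2N f : L2 f -> L2 (fun x => - f x).
Proof.
move=> Lf; apply: (@L2_dom _ f 1) => //; last by move=> x _; rewrite normrN mul1r.
by case: Lf => mf _; exact: measurableT_comp.
Qed.

Lemma L2B f g : L2 f -> L2 g -> L2 (fun x => f x - g x).
Proof. by move=> Lf Lg; apply: (L2D Lf); exact: L2N. Qed.

Lemma integrable_L2M f g : L2 f -> L2 g -> mu.-integrable D (EFin \o (fun x => f x * g x)).
Proof.
move=> [mf fi] [mg gi]; apply: (@integrable_dom _ (fun x => f x ^+ 2 + g x ^+ 2)).
- exact: measurable_funM.
- move=> x _; rewrite ler_norml.
  by have := sqr_ge0 (f x - g x); have := sqr_ge0 (f x + g x); rewrite sqrrB sqrrD; lra.
- exact: (integrableD mD fi gi).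
Qed.

(** A substitute for the triangle inequality that follows from (f - g)^2 >= 0 and avoids square
    roots; the factor 2 is harmless for convergence and only enlarges the Sobolev constant. *)
Lemma I2D f g : L2 f -> L2 g -> I2 (fun x => f x + g x) <= 2 * I2 f + 2 * I2 g.
Proof.
move=> Lf Lg; have [_ fgi] := L2D Lf Lg; case: Lf Lg => mf fi [mg gi].
rewrite -!RintegralZl// -RintegralD//; last 2 first.
- exact: (integrableZl mD 2 fi).
- exact: (integrableZl mD 2 gi).
apply: le_Rintegral => //; first exact: (integrableD mD (integrableZl mD 2 fi) (integrableZl mD 2 gi)).
by move=> x _; have := sqr_ge0 (f x - g x); rewrite sqrrB sqrrD; lra.
Qed.

Lemma I2N f : I2 (fun x => - f x) = I2 f.
Proof. by apply: eq_Rintegral => x _; rewrite sqrrN. Qed.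

Lemma integral_norm_mul_le f g : L2 f -> L2 g ->
  (\int[mu]_(x in D) (`|f x| * `|g x|)%:E <=
   (Num.sqrt (I2 f) * Num.sqrt (I2 g))%:E)%E.
Proof.
move=> Lf Lg.
have mn h : L2 h -> measurable_fun D (fun x => `|h x|) by move=> [mh _]; exact: measurableT_comp.
have aux h : L2 h -> ((\int[mu]_(x in D) (`|h x| `^ 2)%:E) `^ 2^-1 = (Num.sqrt (I2 h))%:E)%E.
  move=> Lh; rewrite poweR12_sqrt; last by apply: integral_ge0 => x _; rewrite lee_fin powR_ge0.
  rewrite (_ : (\int[mu]_(x in D) _ = (I2 h)%:E)%E)// I2E//.
  by apply: eq_integral => x _; rewrite powR_mulrn// real_normK// num_real.
rewrite EFinM -!aux//; apply: hoelder_ge0 => //; [exact: mn|exact: mn|].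
by rewrite [RHS](splitr 1) mul1r.
Qed.

Lemma Rintegral_norm_le f g : L2 f -> L2 g ->
  `|\int[mu]_(x in D) (f x * g x)| <= Num.sqrt (I2 f) * Num.sqrt (I2 g).
Proof.
move=> Lf Lg; have fgi := integrable_L2M Lf Lg.
rewrite -lee_fin EFin_normr_Rintegral//.
apply: (le_trans (le_abse_integral _ mD _)); first by case/integrableP: fgi.
apply: le_trans (integral_norm_mul_le Lf Lg).
by under eq_integral do rewrite /= normrM.
Qed.

Lemma I2_dominated_cvg0 (f : nat -> T -> R) g :
  (forall n, measurable_fun D (f n)) -> L2 g ->
  (forall n x, D x -> `|f n x| <= `|g x|) ->
  {ae mu, forall x, D x -> f n x @[n --> \oo] --> (0 : R)} ->
  I2 (f n) @[n --> \oo] --> (0 : R).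
Proof.
move=> mf [mg gi] fg f0.
have ff : {ae mu, forall x, D x -> (f n x ^+ 2)%:E @[n --> \oo] --> 0%E}.
  apply: filterS f0 => x + Dx => /(_ Dx) fx0.
  apply: cvg_EFin; first exact: nearW.
  rewrite (_ : fine \o _ = (fun n => f n x * f n x)); last by apply/funext => n; rewrite /= expr2.
  by rewrite -[X in _ --> X](mulr0 0); exact: cvgM.
have fgae : {ae mu, forall x n, D x -> (`|(f n x ^+ 2)%:E| <= (g x ^+ 2)%:E)%E}.
  apply: aeW => x n Dx; rewrite abse_EFin lee_fin ger0_norm ?sqr_ge0//.
  rewrite -(real_normK (num_real (f n x))) -(real_normK (num_real (g x))).
  by rewrite ler_sqr ?nnegrE// fg.
have mf2 n : measurable_fun D (fun x => (f n x ^+ 2)%:E).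
  by apply/measurable_EFinP; exact: measurable_sqr.
have [_ _ ] := dominated_convergence mD mf2 (measurable_cst (0%E : \bar R)) ff gi fgae.
by rewrite integral0 => H; apply: fine_cvg.
Qed.

(** The sum of the squares has a finite integral, hence is finite almost everywhere, so its terms
    tend to 0. The explicit rate spares the extraction of a subsequence. *)
Lemma I2_summable_ae_cvg0 (f : nat -> T -> R) : (forall n, L2 (f n)) ->
  (forall n, I2 (f n) <= 1 / (2 ^ n.+1)%:R) ->
  {ae mu, forall x, D x -> f n x @[n --> \oo] --> (0 : R)}.
Proof.
move=> Lf If.
pose S x := (\sum_(n <oo) (f n x ^+ 2)%:E)%E.
have mS : measurable_fun D S.
  apply: ge0_emeasurable_sum => [n x Dx _|n _]; first by rewrite lee_fin sqr_ge0.
  by apply/measurable_EFinP/measurable_sqr; case: (Lf n).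
have S0 x : (0 <= S x)%E by apply: nneseries_ge0 => n _ _; rewrite lee_fin sqr_ge0.
have Si : mu.-integrable D S.
  apply/integrableP; split=> //.
  under eq_integral do rewrite gee0_abs//.
  rewrite integral_nneseries//; last 2 first.
  - by move=> n; apply/measurable_EFinP/measurable_sqr; case: (Lf n).
  - by move=> n x _; rewrite lee_fin sqr_ge0.
  apply: (@le_lt_trans _ _ (\sum_(n <oo) (1 / (2 ^ n.+1)%:R : R)%:E)%E).
    apply: lee_nneseries => n _; first by move=> _; apply: integral_ge0 => x _; rewrite lee_fin sqr_ge0.
    by rewrite -(I2E (Lf n)) lee_fin.
  by apply: le_lt_trans (ltry 1); apply: epsilon_trick0.
have := integrable_ae mD Si; apply: filterS => x + Dx => /(_ Dx) Sfin.
have cvgS : cvgn (series (fun n => f n x ^+ 2)).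
  apply: nondecreasing_is_cvgn.
    by apply: nondecreasing_series => n _ _; exact: sqr_ge0.
  exists (fine (S x)) => _ [n _ <-].
  rewrite -lee_fin fineK// /series/= -sumEFin.
  by apply: nneseries_lim_ge => k _ _; rewrite lee_fin sqr_ge0.
have /cvgrPdist_lt H := cvg_series_cvg_0 cvgS.
apply/cvgrPdist_lt => e e0; near=> n.
have : `|0 - f n x ^+ 2| < e ^+ 2 by near: n; apply: H; rewrite exprn_gt0.
by rewrite !sub0r !normrN normrX ltr_pXn2r// nnegrE ltW.
Unshelve. all: by end_near. Qed.

End square_integrable.

(** * The space H10 *)

Section test_functions.
Context {R : realType} {d : nat}.
Implicit Types (Om : set 'rV[R]_d) (f g phi : 'rV[R]_d -> R).

Lemma tsupport_out f x : ~ tsupport f x -> \forall y \near x, f y = 0.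
Proof.
move=> nx; have : open (~` tsupport f) by rewrite openC; exact: closed_closure.
rewrite openE => /(_ x nx); apply: filterS => y ny.
by apply: contrapT => /eqP fy; apply: ny; apply: subset_closure.
Qed.

Lemma tsupport_partial f i : tsupport (partial i f) `<=` tsupport f.
Proof.
rewrite /tsupport (closure_id (closure [set x | f x != 0])).1; last exact: closed_closure.
apply: closureS => x /= dfx; apply: contrapT => /tsupport_out nx.
move/eqP: dfx; apply.
rewrite /partial (_ : 'D_(delta_mx ord0 i) f x = 'D_(delta_mx ord0 i) (cst 0) x).
  exact: derive_cst.
exact: near_eq_derive.
Qed.

Lemma tsupport_norm_lt f : compact (tsupport f) ->
  exists M : R, forall x, M < `|x| -> ~ tsupport f x.
Proof.
move=> /compact_bounded[M [_ HM]]; exists (M + 1) => x Mx tx.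
have M1 : M < M + 1 by rewrite ltrDl.
by have /= := HM _ M1 _ tx; rewrite leNgt Mx.
Qed.

Lemma tsupport_eq0 f x : ~ tsupport f x -> f x = 0.
Proof. by move/tsupport_out/nbhs_singleton. Qed.

Lemma smooth_Cc f : smooth f -> compact (tsupport f) -> Cc f.
Proof.
move=> sf /tsupport_norm_lt[M HM]; split; first exact: smooth_continuous.
by exists M => x /HM; exact: tsupport_eq0.
Qed.

Lemma test_function_partial Om phi i : test_function Om phi -> test_function Om (partial i phi).
Proof.
move=> [sf cf fO]; split; first exact: smooth_partial.
  apply: subclosed_compact cf _; first exact: closed_closure.
  exact: tsupport_partial.
by apply: subset_trans fO; exact: tsupport_partial.
Qed.

Lemma test_function_Cc Om phi : test_function Om phi -> Cc phi.
Proof. by move=> [sf cf _]; exact: smooth_Cc. Qed.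

Lemma test_function_C1c Om phi : test_function Om phi -> C1c phi.
Proof.
move=> tf; split; first exact: test_function_Cc tf.
move=> i; split; first by apply: smooth_derivable; case: tf.
exact: test_function_Cc (test_function_partial i tf).
Qed.

Lemma test_function_out Om phi x : test_function Om phi -> ~ Om x -> phi x = 0.
Proof. by move=> [_ _ fO] nx; apply: tsupport_eq0 => /fO. Qed.

Lemma test_function_sub Om f phi : smooth f -> (forall x, phi x = 0 -> f x = 0) ->
  test_function Om phi -> test_function Om f.
Proof.
move=> sf f0 [_ cphi phiO].
have sub : tsupport f `<=` tsupport phi.
  by apply: closureS => x /=; apply: contra => /eqP/f0 ->.
split=> //; last exact: subset_trans phiO.
by apply: subclosed_compact cphi sub; exact: closed_closure.
Qed.

Lemma test_functionD Om f g : test_function Om f -> test_function Om g ->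
  test_function Om (f + g).
Proof.
move=> [sf cf fO] [sg cg gO].
have sub : tsupport (f + g) `<=` tsupport f `|` tsupport g.
  rewrite -closureU; apply: closureS => x /= fgx.
  have [fx|fx] := eqVneq (f x) 0; [right|by left].
  by apply: contra fgx => /eqP gx; apply/eqP; rewrite -(addr0 0) -{1}fx -gx.
split; first exact: smoothD.
  by apply: subclosed_compact (compactU cf cg) sub; exact: closed_closure.
by apply: (subset_trans sub) => x [/fO|/gO].
Qed.

Lemma test_functionM Om f g : smooth f -> test_function Om g ->
  test_function Om (f * g).
Proof.
move=> sf tg; apply: (test_function_sub _ _ tg).
  by apply: smoothM => //; case: tg.
by move=> x gx; apply/eqP; rewrite mulf_eq0 gx eqxx orbT.
Qed.

Lemma test_functionN Om f : test_function Om f -> test_function Om (- f).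
Proof.
move=> tf; have := test_functionM (smooth_cst (-1)) tf.
by congr test_function; apply/funext => x; exact: mulN1r.
Qed.

Lemma test_function_comp Om (k k' : R -> R) phi : smooth_nonlinearity d k k' ->
  test_function Om phi -> test_function Om (k \o phi).
Proof.
move=> [k0 _ _ _ sk] tf; apply: (test_function_sub _ _ tf); first by apply: sk; case: tf.
by move=> x /= ->.
Qed.

Lemma partialD f g i : smooth f -> smooth g -> partial i (f + g) = partial i f + partial i g.
Proof.
by move=> sf sg; apply/funext => x; rewrite /partial deriveD//; exact: smooth_derivable.
Qed.

Lemma partialN f i : smooth f -> partial i (- f) = - partial i f.
Proof.
by move=> sf; apply/funext => x; rewrite /partial deriveN//; exact: smooth_derivable.
Qed.

Lemma partial_comp (k k' : R -> R) f i : smooth_nonlinearity d k k' -> smooth f ->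
  partial i (k \o f) = fun x => k' (f x) * partial i f x.
Proof.
move=> [_ dk _ _ _] sf; apply/funext => x; rewrite /partial.
have Hf : is_derive x (delta_mx ord0 i) f (partial i f x).
  by apply: DeriveDef => //; exact: smooth_derivable.
by have [_ ->] := is_derive_comp_dir (dk (f x)) Hf.
Qed.

End test_functions.

(** * Square integrable pairs and their energy on a bounded open set *)

Section bounded_open_set.
Context {R : realType} {d : nat} (Om : set 'rV[R]_d).
Hypotheses (oOm : open Om) (bOm : bounded_set Om).
Local Notation mu := (lebesgue_rV d : {measure set 'rV[R]_d -> \bar R}).
Local Notation L2 := (L2 mu Om).
Local Notation I2 := (I2 mu Om).
Implicit Types (y z w : sobolev_pair R d) (f g phi : 'rV[R]_d -> R).

Lemma measurable_bounded_open : measurable Om.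
Proof. exact: open_measurable_rV. Qed.
Let mOm := measurable_bounded_open.

Lemma bounded_open_measure_lty : (mu Om < +oo)%E.
Proof.
case: bOm => M [_ HM]; apply: (@bounded_set_measure_finite _ _ _ (M + 1)) => //.
by move=> x Ox; apply: (HM (M + 1)) => //; rewrite ltrDl.
Qed.

Lemma L2_Cc f : Cc f -> L2 f.
Proof.
move=> Cf; have mf : measurable_fun setT f by apply: continuous_measurable_rV; case: Cf.
have [B B0 fB] := Cc_bounded Cf; split; first exact: measurable_funTS.
apply: measurable_bounded_integrable => //; first exact: bounded_open_measure_lty.
  by apply: measurable_funX; exact: measurable_funTS.
exists (B ^+ 2); split; first exact: num_real.
move=> M BM x _ /=; apply: le_trans (ltW BM).
by rewrite normrX ler_sqr ?nnegrE.
Qed.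

Lemma Lp2P f : Lp Om 2%:E f <-> L2 f.
Proof.
have aux : (\int[mu]_x (`|((EFin \o f \_ Om) x)| `^ 2) = \int[mu]_(x in Om) (f x ^+ 2)%:E)%E.
  rewrite [RHS]integral_mkcond; apply: eq_integral => x _ /=.
  rewrite !patchE; case: ifPn => [_|_]; first by rewrite powR_mulrn// real_normK// num_real.
  by rewrite normr0 powR0.
split=> [[mf]|[mf fi]].
  rewrite /Lp_norm unlock aux => foo; split=> //; apply/integrableP; split.
    by apply/measurable_EFinP; exact: measurable_sqr.
  under eq_integral do rewrite /= ger0_norm ?sqr_ge0//.
  rewrite ltNge leye_eq; apply/eqP => H; move: foo.
  by rewrite H poweRyr ?ltxx// invr_eq0.
split=> //; rewrite /Lp_norm unlock aux -I2E//.
by apply: poweR_lty; exact: ltry.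
Qed.

(** The square of [H1_norm], preferred because sums and limits are then estimated without square
    roots. *)
Definition energy y : R := I2 y.1 + \sum_i I2 (y.2 i).

Definition L2_pair y := L2 y.1 /\ forall i, L2 (y.2 i).

Lemma energy_ge0 y : 0 <= energy y.
Proof. by rewrite addr_ge0 ?I2_ge0// sumr_ge0// => i _; exact: I2_ge0. Qed.

Lemma sqr_H1_norm y : H1_norm Om y ^+ 2 = energy y.
Proof. by rewrite sqr_sqrtr// energy_ge0. Qed.

Lemma H1_norm_lt y (e : R) : 0 < e -> (H1_norm Om y < e) = (energy y < e ^+ 2).
Proof.
move=> e0; have n0 : 0 <= H1_norm Om y by exact: sqrtr_ge0.
by rewrite -sqr_H1_norm ltr_pXn2r// nnegrE ltW.
Qed.

Lemma H1P y : H1 Om y <-> L2_pair y /\ forall i, weak_partial Om i y.1 (y.2 i).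
Proof.
split=> [[/Lp2P ? H]|[[? ?] H]].
  by split=> [|i]; [split=> // i; have [/Lp2P] := H i|have [_] := H i].
by split; [exact/Lp2P|move=> i; split=> //; exact/Lp2P].
Qed.

Lemma H10_L2 y : H10 Om y -> L2_pair y.
Proof. by move=> [/H1P[]]. Qed.

Lemma L2_pairD y z : L2_pair y -> L2_pair z -> L2_pair (y + z).
Proof.
by move=> [y1 y2] [z1 z2]; split=> [|i]; [exact: (L2D mOm)|exact: (L2D mOm (y2 i) (z2 i))].
Qed.

Lemma L2_pairN y : L2_pair y -> L2_pair (- y).
Proof.
by move=> [y1 y2]; split=> [|i]; [exact: (L2N mOm)|exact: (L2N mOm (y2 i))].
Qed.

Lemma L2_pairB y z : L2_pair y -> L2_pair z -> L2_pair (y - z).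
Proof. by move=> Ly Lz; apply: L2_pairD => //; exact: L2_pairN. Qed.

Lemma energyD y z : L2_pair y -> L2_pair z ->
  energy (y + z) <= 2 * energy y + 2 * energy z.
Proof.
move=> [y1 y2] [z1 z2]; rewrite /energy !mulrDr addrACA lerD//.
  exact: (I2D mOm).
by rewrite !mulr_sumr -big_split/=; apply: ler_sum => i _; exact: (I2D mOm (y2 i) (z2 i)).
Qed.

Lemma energyN y : energy (- y) = energy y.
Proof.
rewrite /energy; congr (_ + _); first exact: I2N.
by apply: eq_bigr => i _; exact: I2N.
Qed.

Lemma energyB y z : L2_pair y -> L2_pair z ->
  energy (y - z) <= 2 * energy y + 2 * energy z.
Proof. by move=> Ly Lz; rewrite -(energyN z); apply: energyD => //; exact: L2_pairN. Qed.

End bounded_open_set.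

(** * H10 as a closed vector space *)

Section H10_space.
Context {R : realType} {d : nat} (Om : set 'rV[R]_d).
Hypotheses (oOm : open Om) (bOm : bounded_set Om).
Local Notation mu := (lebesgue_rV d : {measure set 'rV[R]_d -> \bar R}).
Local Notation L2 := (L2 mu Om).
Local Notation I2 := (I2 mu Om).
Implicit Types (y z w : sobolev_pair R d) (f g phi : 'rV[R]_d -> R).
Let mOm := measurable_bounded_open oOm.

Lemma L2_test phi : test_function Om phi -> L2 phi.
Proof. by move=> tf; apply: L2_Cc => //; exact: test_function_Cc tf. Qed.

Lemma L2_partial_test phi i : test_function Om phi -> L2 (partial i phi).
Proof. by move=> tf; apply: L2_test; exact: test_function_partial. Qed.

(** Integration by parts: the derivative of the product of two test functions has integral 0 on the
    whole space, and the integrals over [Om] extend to it because the integrands vanish outside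
    [Om]. *)
Lemma weak_partial_test phi i : test_function Om phi -> weak_partial Om i phi (partial i phi).
Proof.
move=> tf psi tp.
have mkT (h : 'rV[R]_d -> R) : (forall x, ~ Om x -> h x = 0) ->
    \int[mu]_(x in Om) h x = \int[mu]_x h x.
  move=> h0; rewrite Rintegral_mkcond; apply: eq_Rintegral => x _.
  by rewrite patchE; case: ifPn => // /negP nx; rewrite h0// => Ox; apply: nx; rewrite inE.
have tpi := test_function_partial i tp; have tfi := test_function_partial i tf.
have ip := integrable_L2M mOm (L2_test tf) (L2_test tpi).
have iq := integrable_L2M mOm (L2_test tfi) (L2_test tp).
apply/eqP; rewrite -addr_eq0 -RintegralD// mkT; last first.
  by move=> x nx; rewrite (test_function_out tf nx) (test_function_out tp nx) mul0r mulr0 addr0.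
have sf : smooth phi by case: tf.
have := integral_partial_eq0 i (test_function_C1c (test_functionM sf tp)).
rewrite /Rintegral => H; apply/eqP; rewrite -[RHS]/(fine 0%E) -H; congr fine.
apply: eq_integral => x _; congr EFin.
rewrite {3}/partial deriveM; [|exact: smooth_derivable|].
  by rewrite [partial i phi x * _]mulrC.
by apply: smooth_derivable; case: tp.
Qed.

Let lt_quarters (a b c : R) : a < c / 4 -> b < c / 4 -> 2 * a + 2 * b < c.
Proof. lra. Qed.

Lemma I2_eq0 f : (forall x, Om x -> f x = 0) -> I2 f = 0.
Proof.
move=> f0; rewrite /I2 /Rintegral (integral0_eq mu) => [//|x Ox].
by rewrite f0// expr0n.
Qed.

Lemma H10_test phi : test_function Om phi -> H10 Om (with_gradient phi).
Proof.
move=> tf; split; first apply/(H1P oOm); last first.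
  move=> e e0; exists phi; split => //.
  rewrite H1_norm_lt// subrr /energy I2_eq0// add0r big1 ?exprn_gt0// => i _.
split; last by move=> i; exact: weak_partial_test.
by split; [exact: L2_test|move=> i; exact: L2_partial_test].
Qed.

Lemma L2_with_gradient phi : test_function Om phi -> L2_pair Om (with_gradient phi).
Proof. by move=> tf; have [/(H1P oOm)[]] := H10_test tf. Qed.

Lemma weak_partialD y z i : L2_pair Om y -> L2_pair Om z ->
  weak_partial Om i y.1 (y.2 i) -> weak_partial Om i z.1 (z.2 i) ->
  weak_partial Om i (y + z).1 ((y + z).2 i).
Proof.
move=> [y1 y2] [z1 z2] wy wz phi tf.
have Lp := L2_partial_test i tf; have Lf := L2_test tf.
rewrite (@eq_Rintegral _ _ _ mu Om (fun x => y.1 x * partial i phi x + z.1 x * partial i phi x)); last first.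
  by move=> x _; rewrite -mulrDl.
rewrite [in RHS](@eq_Rintegral _ _ _ mu Om (fun x => y.2 i x * phi x + z.2 i x * phi x)); last first.
  by move=> x _; rewrite -mulrDl.
rewrite !RintegralD//; try exact: (integrable_L2M mOm).
by rewrite (wy _ tf) (wz _ tf) opprD.
Qed.

Lemma weak_partialN y i : L2_pair Om y -> weak_partial Om i y.1 (y.2 i) ->
  weak_partial Om i (- y).1 ((- y).2 i).
Proof.
move=> [y1 y2] wy phi tf.
have Lp := L2_partial_test i tf; have Lf := L2_test tf.
rewrite (@eq_Rintegral _ _ _ mu Om (fun x => -1 * (y.1 x * partial i phi x))); last first.
  by move=> x _; rewrite mulrA mulN1r.
rewrite [in RHS](@eq_Rintegral _ _ _ mu Om (fun x => -1 * (y.2 i x * phi x))); last first.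
  by move=> x _; rewrite mulrA mulN1r.
rewrite !RintegralZl//; try exact: (integrable_L2M mOm).
by rewrite (wy _ tf) mulrN.
Qed.

Lemma H10_weak_partial y i : H10 Om y -> weak_partial Om i y.1 (y.2 i).
Proof. by move=> [/(H1P oOm)[_]]. Qed.

Lemma H10_approx y (e : R) : H10 Om y -> 0 < e ->
  exists2 phi, test_function Om phi & energy Om (y - with_gradient phi) < e.
Proof.
move=> [_ H] e0; have se0 : 0 < Num.sqrt e by rewrite sqrtr_gt0.
have [phi [tf]] := H _ se0; rewrite H1_norm_lt// sqr_sqrtr ?ltW// => He.
by exists phi.
Qed.

(** Only square integrability of [y] is assumed: its second component is a weak gradient because
    both sides of the defining identity are continuous in L^2 by the Cauchy-Schwarz inequality. *)
Lemma H10_closed y : L2_pair Om y ->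
  (forall e : R, 0 < e -> exists2 z, H10 Om z & energy Om (y - z) < e) -> H10 Om y.
Proof.
move=> Ly Hy; split; first apply/(H1P oOm); last first.
  move=> e e0; have e4 : 0 < e ^+ 2 / 4 by rewrite divr_gt0// exprn_gt0.
  have [z Hz yz] := Hy _ e4; have [phi tf zf] := H10_approx Hz e4.
  exists phi; split=> //; rewrite H1_norm_lt//.
  have Lz := H10_L2 oOm Hz; have Lf := L2_with_gradient tf.
  rewrite -(subrKA z); apply: le_lt_trans (energyD oOm _ _) _.
  - exact: L2_pairB.
  - exact: L2_pairB.
  - by lra.
split=> // i phi tf; apply/eqP; rewrite -subr_eq0 opprK -normr_le0; apply/ler_addgt0Pl => e e0.
have Lp := L2_partial_test i tf; have Lf := L2_test tf.
(* An L^2 error of e / B is multiplied by the norms of [phi] and its derivative, whose sum is below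
   [B]; the [+ 1] keeps [B] positive. *)
pose B := Num.sqrt (I2 (partial i phi)) + Num.sqrt (I2 phi) + 1.
have B0 : 0 < B by rewrite ltr_wpDl// addr_ge0 ?sqrtr_ge0.
have eB : 0 < (e / B) ^+ 2 by rewrite exprn_gt0// divr_gt0.
have [z Hz yz] := Hy _ eB; have Lz := H10_L2 oOm Hz.
have Lyz := L2_pairB oOm Ly Lz.
have wz := H10_weak_partial i Hz tf.
have split1 (f g h : 'rV[R]_d -> R) : L2 f -> L2 g -> L2 h ->
    \int[mu]_(x in Om) (f x * h x) = \int[mu]_(x in Om) ((f x - g x) * h x) + \int[mu]_(x in Om) (g x * h x).
  move=> L1 L2' L3; rewrite -RintegralD//; last 2 first.
  - by apply: (integrable_L2M mOm) => //; exact: (L2B mOm).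
  - exact: (integrable_L2M mOm).
  by apply: eq_Rintegral => x _; rewrite -mulrDl subrK.
case: (Ly) (Lz) => y1 y2 [z1 z2].
rewrite (split1 y.1 z.1 _ y1 z1 Lp) (split1 (y.2 i) (z.2 i) _ (y2 i) (z2 i) Lf) wz.
rewrite addrACA addNr addr0.
apply: le_trans (ler_normD _ _) _.
have H1 := Rintegral_norm_le mOm (L2B mOm y1 z1) Lp.
have H2 := Rintegral_norm_le mOm (L2B mOm (y2 i) (z2 i)) Lf.
have K1 : Num.sqrt (I2 (fun x => y.1 x - z.1 x)) <= e / B.
  rewrite -[leRHS]gtr0_norm ?divr_gt0// -sqrtr_sqr ler_wsqrtr// (le_trans _ (ltW yz))//.
  by rewrite /energy lerDl sumr_ge0// => j _; exact: I2_ge0.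
have K2 : Num.sqrt (I2 (fun x => y.2 i x - z.2 i x)) <= e / B.
  rewrite -[leRHS]gtr0_norm ?divr_gt0// -sqrtr_sqr ler_wsqrtr// (le_trans _ (ltW yz))//.
  rewrite /energy (bigD1 i)//= addrCA lerDl addr_ge0 ?I2_ge0//.
  by rewrite sumr_ge0// => j _; exact: I2_ge0.
apply: (@le_trans _ _ (e / B * B)); last by rewrite addr0 divfK ?gt_eqF.
apply: (le_trans (lerD H1 H2)).
have q0 : 0 < e / B by rewrite divr_gt0.
have M1 := ler_wpM2r (sqrtr_ge0 (I2 (partial i phi))) K1.
have M2 := ler_wpM2r (sqrtr_ge0 (I2 phi)) K2.
move: q0 M1 M2; set q := e / B; rewrite /B; lra.
Qed.

Lemma H10D y z : H10 Om y -> H10 Om z -> H10 Om (y + z).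
Proof.
move=> Hy Hz; have Ly := H10_L2 oOm Hy; have Lz := H10_L2 oOm Hz.
split.
  apply/(H1P oOm); split; first exact: L2_pairD.
  by move=> i; apply: weak_partialD => //; exact: H10_weak_partial.
move=> e e0; have e4 : 0 < e ^+ 2 / 4 by rewrite divr_gt0// exprn_gt0.
have [f tf yf] := H10_approx Hy e4; have [g tg zg] := H10_approx Hz e4.
exists (f + g); split; first exact: test_functionD.
rewrite H1_norm_lt//.
have -> : y + z - with_gradient (f + g) = (y - with_gradient f) + (z - with_gradient g).
  rewrite addrACA -opprD; congr (_ - _); congr (_, _).
  by apply/funext => i; rewrite /= partialD//; [case: tf|case: tg].
have Lf := L2_with_gradient tf; have Lg := L2_with_gradient tg.
have := energyD oOm (L2_pairB oOm Ly Lf) (L2_pairB oOm Lz Lg).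
move/le_lt_trans; apply.
exact: (lt_quarters yf zg).
Qed.

Lemma H10N y : H10 Om y -> H10 Om (- y).
Proof.
move=> Hy; have Ly := H10_L2 oOm Hy; split.
  apply/(H1P oOm); split; first exact: L2_pairN.
  by move=> i; apply: weak_partialN => //; exact: H10_weak_partial.
move=> e e0; have e2 : 0 < e ^+ 2 by rewrite exprn_gt0.
have [f tf yf] := H10_approx Hy e2.
exists (- f); split; first exact: test_functionN.
have E : with_gradient (- f) = - with_gradient f.
  by congr (_, _); apply/funext => i; rewrite /= partialN//; case: tf.
rewrite H1_norm_lt; last exact: e0.
by rewrite E -opprD energyN; exact: yf.
Qed.

Lemma H10B y z : H10 Om y -> H10 Om z -> H10 Om (y - z).
Proof. by move=> Hy Hz; exact: (H10D Hy (H10N Hz)). Qed.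

(** The summable rate is chosen so that convergence in energy also gives convergence almost
    everywhere, needed for dominated convergence in the chain rule and for Fatou's lemma in the
    Sobolev inequality. *)
Lemma H10_approx_seq y : H10 Om y -> exists phi : nat -> 'rV[R]_d -> R,
  [/\ forall n, test_function Om (phi n),
      forall n, energy Om (y - with_gradient (phi n)) <= 1 / (2 ^ n.+1)%:R &
      {ae mu, forall x, Om x -> phi n x @[n --> \oo] --> y.1 x}].
Proof.
move=> Hy; have Ly := H10_L2 oOm Hy.
have H n : exists phi, test_function Om phi /\ energy Om (y - with_gradient phi) <= 1 / (2 ^ n.+1)%:R.
  have [|phi tf /ltW He] := @H10_approx y (1 / (2 ^ n.+1)%:R) Hy.
    by rewrite divr_gt0// ltr0n expn_gt0.
  by exists phi.
have [phi Hphi] := choice H; exists phi.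
have tphi n : test_function Om (phi n) by have [] := Hphi n.
split=> [//|n|]; first by have [] := Hphi n.
have LD n : L2 (fun x => y.1 x - phi n x).
  by apply: (L2B mOm); [case: Ly|exact: L2_test].
have ID n : I2 (fun x => y.1 x - phi n x) <= 1 / (2 ^ n.+1)%:R.
  have [_] := Hphi n; apply: le_trans.
  by rewrite /energy lerDl sumr_ge0// => i _; exact: I2_ge0.
have := I2_summable_ae_cvg0 mOm LD ID; apply: filterS => x + Ox => /(_ Ox) H0.
rewrite (_ : (fun n => phi n x) = (fun n => y.1 x - (y.1 x - phi n x))); last first.
  by apply/funext => n; rewrite subKr.
by rewrite -[X in _ --> X]subr0; apply: cvgB => //; exact: cvg_cst.
Qed.

End H10_space.

Lemma cvg_sum0 (R : realType) (I : Type) (r : seq I) (f : I -> nat -> R) :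
  (forall i, f i n @[n --> \oo] --> (0 : R)) ->
  \sum_(i <- r) f i n @[n --> \oo] --> (0 : R).
Proof.
move=> f0; elim: r => [|i r IH].
  by under eq_fun do rewrite big_nil; exact: cvg_cst.
under eq_fun do rewrite big_cons.
by have := cvgD (f0 i) IH; rewrite addr0; exact.
Qed.

Lemma cvg_inv_exp2 (R : realType) : (1 / (2 ^ n.+1)%:R : R) @[n --> \oo] --> (0 : R).
Proof.
have := @cvg_geometric R (1 / 2) (1 / 2).
rewrite gtr0_norm; last lra.
move=> /(_ ltac:(lra)); apply: cvg_trans; apply: near_eq_cvg; near=> n.
by rewrite /geometric /= natrX exprS expr_div_n expr1n; field; rewrite expf_neq0.
Unshelve. all: by end_near. Qed.

(** * Composition and truncation in H10 *)

Section H10_chain_rule.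
Context {R : realType} {d : nat} (Om : set 'rV[R]_d).
Hypotheses (oOm : open Om) (bOm : bounded_set Om).
Local Notation mu := (lebesgue_rV d : {measure set 'rV[R]_d -> \bar R}).
Local Notation L2 := (L2 mu Om).
Local Notation I2 := (I2 mu Om).
Implicit Types (y z w : sobolev_pair R d) (f g phi : 'rV[R]_d -> R) (k : R -> R).
Let mOm := measurable_bounded_open oOm.

Lemma H10_limit y (z : nat -> sobolev_pair R d) : L2_pair Om y ->
  (forall n, H10 Om (z n)) ->
  I2 (fun x => y.1 x - (z n).1 x) @[n --> \oo] --> (0 : R) ->
  (forall i, I2 (fun x => y.2 i x - (z n).2 i x) @[n --> \oo] --> (0 : R)) ->
  H10 Om y.
Proof.
move=> Ly Hz H1 H2; apply: (H10_closed oOm bOm Ly) => e e0.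
have : energy Om (y - z n) @[n --> \oo] --> (0 : R).
  rewrite -[X in _ --> X](addr0 0); apply: cvgD; first exact: H1.
  exact: cvg_sum0.
move=> /cvgr_lt/(_ e e0)[n _ Hn]; exists (z n); first exact: Hz.
exact: (Hn n (leqnn n)).
Qed.

Definition comp_pair k (k' : R -> R) w : sobolev_pair R d :=
  (k \o w.1, fun i x => k' (w.1 x) * w.2 i x).

Lemma L2_comp_pair k (k' : R -> R) w : L2_pair Om w ->
  measurable_fun Om (k \o w.1) -> measurable_fun Om (k' \o w.1) ->
  (forall t, `|k t| <= 2 * `|t|) -> (forall t, `|k' t| <= 2) ->
  L2_pair Om (comp_pair k k' w).
Proof.
move=> [w1 w2] mk mk' kle k'le; split=> [|i].
  by apply: (L2_dom mOm mk w1) => x _; exact: kle.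
apply: (L2_dom mOm _ (w2 i)) => [|x _]; last by rewrite normrM ler_wpM2r.
by apply: measurable_funM => //; case: (w2 i).
Qed.

(** The approximants are [k \o phi n]. Their gradient error splits as (k'(w) - k'(phi_n)) grad w +
    k'(phi_n) (grad w - grad phi_n): the first term tends to 0 by dominated convergence, as [k'] is
    continuous and bounded, and the second is controlled by the energy of w - phi_n. *)
Lemma H10_comp k (k' : R -> R) w : smooth_nonlinearity d k k' -> H10 Om w ->
  H10 Om (comp_pair k k' w).
Proof.
move=> Hk Hw; have Lw := H10_L2 oOm Hw; have [w1 w2] := Lw.
have [k0 dk ck' bk' _] := Hk.
have klip := smooth_nonlinearity_lipschitz Hk.
have ck : continuous k.
  move=> x; apply: differentiable_continuous.
  by apply/derivable1_diffP; have [] := dk x.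
have mk : measurable_fun setT k by exact: continuous_measurable_fun.
have mk' : measurable_fun setT k' by exact: continuous_measurable_fun.
have mw1 : measurable_fun Om w.1 by case: w1.
have kle t : `|k t| <= 2 * `|t| by have := klip t 0; rewrite k0 !subr0.
have Ly : L2_pair Om (comp_pair k k' w).
  by apply: L2_comp_pair => //; exact: measurableT_comp.
have [phi [tphi ephi aphi]] := H10_approx_seq oOm bOm Hw.
have L1 n : L2 (fun x => w.1 x - phi n x).
  by apply: (L2B mOm) => //; exact: L2_test.
have I1 n : I2 (fun x => w.1 x - phi n x) <= 1 / (2 ^ n.+1)%:R.
  apply: le_trans (ephi n).
  by rewrite /energy lerDl sumr_ge0// => i _; exact: I2_ge0.
have L2i n i : L2 (fun x => w.2 i x - partial i (phi n) x).
  by apply: (L2B mOm) => //; exact: L2_partial_test.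
have I2i n i : I2 (fun x => w.2 i x - partial i (phi n) x) <= 1 / (2 ^ n.+1)%:R.
  apply: le_trans (ephi n).
  rewrite /energy (bigD1 i)//= addrCA lerDl addr_ge0 ?I2_ge0//.
  by rewrite sumr_ge0// => j _; exact: I2_ge0.
have mphi n : measurable_fun Om (phi n).
  apply: measurable_funTS; apply: continuous_measurable_rV.
  by case: (test_function_Cc (tphi n)).
apply: (@H10_limit _ (fun n => with_gradient (k \o phi n)) Ly).
- by move=> n; apply: H10_test => //; exact: (test_function_comp Hk).
- apply: (@squeeze_cvgr _ _ _ _ (cst 0) (fun n => 4 * (1 / (2 ^ n.+1)%:R))).
  + apply: nearW => n; rewrite I2_ge0/=.
    apply: (@le_trans _ _ (4 * I2 (fun x => w.1 x - phi n x))); last by rewrite ler_wpM2l.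
    rewrite -(RintegralZl 4 mOm (proj2 (L1 n))).
    have mkk : measurable_fun Om (fun x => k (w.1 x) - k (phi n x)).
      by apply: measurable_funB; exact: (measurableT_comp mk).
    have Lkk : L2 (fun x => k (w.1 x) - k (phi n x)).
      by apply: (L2_dom mOm mkk (L1 n)) => x _; exact: klip.
    apply: le_Rintegral => //; [exact: (proj2 Lkk)|exact: (integrableZl mOm 4 (proj2 (L1 n)))|].
    move=> x _; rewrite -(real_normK (num_real (_ - k _))) -(real_normK (num_real (_ - phi n x))).
    rewrite (_ : 4 = 2 ^+ 2 :> R); last by rewrite -natrX.
    by rewrite -exprMn ler_sqr ?nnegrE// ?mulr_ge0.
  + exact: cvg_cst.
  + by rewrite -[X in _ --> X](mulr0 4); apply: cvgMr; exact: cvg_inv_exp2.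
- move=> i.
  pose J n := I2 (fun x => (k' (w.1 x) - k' (phi n x)) * w.2 i x).
  have mdk n : measurable_fun Om (fun x => k' (w.1 x) - k' (phi n x)).
    by apply: measurable_funB; exact: (measurableT_comp mk').
  have mwi : measurable_fun Om (w.2 i) by case: (w2 i).
  have mJ n : measurable_fun Om (fun x => (k' (w.1 x) - k' (phi n x)) * w.2 i x).
    exact: measurable_funM.
  have bJ n x : `|(k' (w.1 x) - k' (phi n x)) * w.2 i x| <= 4 * `|w.2 i x|.
    rewrite normrM ler_wpM2r// (le_trans (ler_normB _ _))//.
    have := bk' (w.1 x); have := bk' (phi n x); lra.
  have LJ n : L2 (fun x => (k' (w.1 x) - k' (phi n x)) * w.2 i x).
    by apply: (L2_dom mOm (mJ n) (w2 i)) => x _; exact: bJ.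
  have L4 : L2 (fun x => 4 * w.2 i x).
    apply: (L2_dom (c := 4) mOm _ (w2 i)); first exact: measurable_funM.
    by move=> x _; rewrite normrM ger0_norm.
  have cJ : J n @[n --> \oo] --> (0 : R).
    apply: (I2_dominated_cvg0 mOm mJ L4).
      by move=> n x _; rewrite [leRHS]normrM (ger0_norm (ler0n R 4)).
    apply: filterS aphi => x + Ox => /(_ Ox) Hx.
    rewrite -[X in _ --> X](mul0r (w.2 i x)); apply: cvgM; last exact: cvg_cst.
    rewrite -[X in _ --> X](subrr (k' (w.1 x))); apply: cvgB; first exact: cvg_cst.
    exact: (cvg_comp _ _ Hx (ck' (w.1 x))).
  have LK n : L2 (fun x => k' (phi n x) * (w.2 i x - partial i (phi n) x)).
    apply: (L2_dom (c := 2) mOm _ (L2i n i)).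
      by apply: measurable_funM; [exact: (measurableT_comp mk')|case: (L2i n i)].
    by move=> x _; rewrite normrM ler_wpM2r.
  apply: (@squeeze_cvgr _ _ _ _ (cst 0) (fun n => 2 * J n + 2 * (4 * (1 / (2 ^ n.+1)%:R)))).
  + apply: nearW => n; rewrite I2_ge0/=.
    rewrite (_ : I2 _ = I2 (fun x => (k' (w.1 x) - k' (phi n x)) * w.2 i x +
        k' (phi n x) * (w.2 i x - partial i (phi n) x))); last first.
      apply: eq_Rintegral => x _; rewrite (partial_comp _ Hk); last by case: (tphi n).
      by congr (_ ^+ 2); ring.
    apply: (le_trans (I2D mOm (LJ n) (LK n))); rewrite lerD2l ler_wpM2l//.
    apply: (@le_trans _ _ (4 * I2 (fun x => w.2 i x - partial i (phi n) x))); last by rewrite ler_wpM2l.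
    rewrite -(RintegralZl 4 mOm (proj2 (L2i n i))).
    apply: le_Rintegral => //; [exact: (proj2 (LK n))|exact: (integrableZl mOm 4 (proj2 (L2i n i)))|].
    move=> x _; rewrite exprMn ler_wpM2r ?sqr_ge0//.
    rewrite -(real_normK (num_real (k' _))) (_ : 4 = 2 ^+ 2 :> R); last by rewrite -natrX.
    by rewrite ler_sqr ?nnegrE.
  + exact: cvg_cst.
  + rewrite -[X in _ --> X](addr0 0); apply: cvgD.
      by rewrite -[X in _ --> X](mulr0 2); exact: cvgMr.
    rewrite -[X in _ --> X](mulr0 2); apply: cvgMr.
    by rewrite -[X in _ --> X](mulr0 4); apply: cvgMr; exact: cvg_inv_exp2.
Qed.

Lemma measurable_trunc (c : R) f : 0 <= c -> measurable_fun Om f ->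
  measurable_fun Om (trunc c \o f) /\ measurable_fun Om (trunc' c \o f).
Proof.
move=> c0 mf; have H n := smooth_nonlinearity_trunc_seq d c n.
split.
  apply: (@measurable_fun_cvg _ _ _ _ (fun n => trunc_seq c n \o f)) => [n|x _].
    apply: measurableT_comp mf; apply: continuous_measurable_fun => x.
    apply: differentiable_continuous; apply/derivable1_diffP.
    by have [_ dk _ _ _] := H n; have [] := dk x.
  exact: cvg_trunc_seq.
apply: (@measurable_fun_cvg _ _ _ _ (fun n => trunc_seq' c n \o f)) => [n|x _].
  apply: measurableT_comp mf; apply: continuous_measurable_fun.
  by have [] := H n.
exact: cvg_trunc_seq'.
Qed.

Lemma trunc_le (c t : R) : 0 <= c -> `|trunc c t| <= `|t|.
Proof.
move=> c0; rewrite truncE//; case: ltP => [ct|tc].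
  by rewrite !gtr0_norm; lra.
by case: ltP => [tc'|_]; [rewrite !ltr0_norm; lra|rewrite normr0].
Qed.

Lemma trunc'_le1 (c t : R) : `|trunc' c t| <= 1.
Proof. by rewrite /trunc'; case: (c < _); rewrite ?normr1 ?normr0. Qed.

(** Dominated convergence along the smooth profiles, with majorants 3 |w| and 3 |grad w|. Pointwise
    convergence of the slopes at every real, including |t| = c, is essential: the set {|w| = c} may
    have positive measure. *)
Lemma H10_trunc (c : R) w : 0 <= c -> H10 Om w ->
  H10 Om (comp_pair (trunc c) (trunc' c) w).
Proof.
move=> c0 Hw; have Lw := H10_L2 oOm Hw; have [w1 w2] := Lw.
have Hk n := smooth_nonlinearity_trunc_seq d c n.
have mw1 : measurable_fun Om w.1 by case: w1.
have [mt mt'] := measurable_trunc c0 mw1.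
have Ly : L2_pair Om (comp_pair (trunc c) (trunc' c) w).
  apply: L2_comp_pair => // t.
    by apply: le_trans (trunc_le _ c0) _; have := normr_ge0 t; lra.
  by apply: le_trans (trunc'_le1 _ _) _; lra.
have Hz n := H10_comp (Hk n) Hw.
have Lz n := H10_L2 oOm (Hz n).
apply: (@H10_limit _ (fun n => comp_pair (trunc_seq c n) (trunc_seq' c n) w) Ly Hz).
- have L3 : L2 (fun x => 3 * w.1 x).
    apply: (L2_dom (c := 3) mOm _ w1); first exact: measurable_funM.
    by move=> x _; rewrite normrM ger0_norm.
  have mn n : measurable_fun Om (fun x => trunc c (w.1 x) - trunc_seq c n (w.1 x)).
    by apply: measurable_funB => //; case: (Lz n) => -[].
  apply: (I2_dominated_cvg0 mOm mn L3).
    move=> n x _; apply: (le_trans (ler_normB _ _)).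
    rewrite normrM (ger0_norm (ler0n R 3)).
    by have := trunc_le (w.1 x) c0; have := trunc_seq_le c (w.1 x) n; lra.
  apply: aeW => x _; rewrite -[X in _ --> X](subrr (trunc c (w.1 x))).
  by apply: cvgB; [exact: cvg_cst|exact: cvg_trunc_seq].
- move=> i; have L3 : L2 (fun x => 3 * w.2 i x).
    apply: (L2_dom (c := 3) mOm _ (w2 i)); first by apply: measurable_funM => //; case: (w2 i).
    by move=> x _; rewrite normrM ger0_norm.
  have mn n : measurable_fun Om (fun x => trunc' c (w.1 x) * w.2 i x - trunc_seq' c n (w.1 x) * w.2 i x).
    have [_ /(_ i)[m1 _]] := Lz n; have [_ /(_ i)[m2 _]] := Ly.
    exact: (measurable_funB m2 m1).
  apply: (I2_dominated_cvg0 mOm mn L3).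
    move=> n x _; rewrite -mulrBl !normrM (ger0_norm (ler0n R 3)) ler_wpM2r//.
    apply: (le_trans (ler_normB _ _)).
    by have := trunc'_le1 c (w.1 x); have := trunc_seq'_le2 c (w.1 x) n; lra.
  apply: aeW => x _; rewrite -[X in _ --> X](subrr (trunc' c (w.1 x) * w.2 i x)).
  apply: cvgB; first exact: cvg_cst.
  by apply: cvgM; [exact: cvg_trunc_seq'|exact: cvg_cst].
Qed.

End H10_chain_rule.

(** * The Sobolev inequality in H10 *)

Section fatou_ae.
Context d (T : measurableType d) (R : realType) (mu : {measure set T -> \bar R}).

(** Fatou's lemma, with the lower limit identified almost everywhere with [g]; it carries the
    Sobolev bound from test functions to their limit. *)
Lemma ae_cvg_integral_le (D : set T) (f : nat -> T -> R) (g : T -> R) (b : \bar R) :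
  measurable D -> (forall n, measurable_fun D (f n)) -> measurable_fun D g ->
  (forall n x, D x -> 0 <= f n x) -> (forall x, D x -> 0 <= g x) ->
  {ae mu, forall x, D x -> f n x @[n --> \oo] --> g x} ->
  (\forall n \near \oo, (\int[mu]_(x in D) (f n x)%:E <= b)%E) ->
  (\int[mu]_(x in D) (g x)%:E <= b)%E.
Proof.
move=> mD mf mg f0 g0 fg fb.
have mEf n : measurable_fun D (fun x => (f n x)%:E) by exact/measurable_EFinP.
have ml : measurable_fun D (fun x => limn_einf (fun n => (f n x)%:E)).
  have -> : (fun x => limn_einf (fun n => (f n x)%:E)) =
     (-%E \o (fun x => limn_esup (fun n => - (f n x)%:E)%E)) by [].
  apply: measurableT_comp => //; apply: measurable_fun_limn_esup => n.
  exact: measurableT_comp.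
have l0 x : D x -> (0 <= limn_einf (fun n => (f n x)%:E))%E.
  move=> Dx; rewrite limn_einf_lim; apply: lime_ge; first exact: is_cvg_einfs.
  apply: nearW => n; apply: le_ereal_inf_tmp => _ [m _ <-].
  by rewrite lee_fin f0.
apply: (@le_trans _ _ (\int[mu]_(x in D) limn_einf (fun n => (f n x)%:E))%E).
  rewrite le_eqVlt; apply/orP; left; apply/eqP; apply: ge0_ae_eq_integral => //.
  - exact/measurable_EFinP.
  - apply: filterS fg => x + Dx => /(_ Dx) fgx.
    have cE : (f n x)%:E @[n --> \oo] --> (g x)%:E by apply: cvg_EFin; [exact: nearW|exact: fgx].
    rewrite is_cvg_limn_einfE; last by apply/cvg_ex; exists (g x)%:E.
    exact/esym/cvg_lim.
apply: (le_trans (fatou mu mD mEf _)); first by move=> n x Dx; rewrite lee_fin f0.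
rewrite limn_einf_lim; apply: lime_le; first exact: is_cvg_einfs.
apply: filterS fb => n; apply: le_trans.
by apply: ereal_inf_lbound; exists n => /=.
Qed.

End fatou_ae.

Section power_integral.
Context dT (T : measurableType dT) (R : realType) (mu : {measure set T -> \bar R}).
Variable D : set T.
Implicit Types f : T -> R.

Definition Iq (q : R) f : \bar R := (\int[mu]_(x in D) (`|f x| `^ q)%:E)%E.

Lemma Iq_ge0 q f : (0 <= Iq q f)%E.
Proof. by apply: integral_ge0 => x _; rewrite lee_fin powR_ge0. Qed.

Lemma measurable_norm_powR q f : measurable_fun D f ->
  measurable_fun D (fun x => `|f x| `^ q).
Proof.
by move=> mf; apply: (measurableT_comp (measurable_powR q)); exact: measurableT_comp.
Qed.

(** Hoelder's inequality against the constant 1 with exponents q / m and its conjugate. For m = q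
    the conjugate would be infinite, so that case is settled separately. *)
Lemma Iq_le_pow (q m : R) f : measurable D -> 0 < m <= q -> measurable_fun D f ->
  (Iq m f <= Iq q f `^ (m / q) * mu D `^ (1 - m / q))%E.
Proof.
move=> mD /andP[m0]; rewrite le_eqVlt => /predU1P[<-|mq] mf.
  by rewrite divff ?gt_eqF// subrr poweRe0 mule1 poweRe1 ?Iq_ge0.
have q0 : 0 < q by exact: lt_trans mq.
have mq1 : m / q < 1 by rewrite ltr_pdivrMr// mul1r.
have mq0 : 0 < m / q by rewrite divr_gt0.
have s0 : 0 < (1 - m / q)^-1 by rewrite invr_gt0 subr_gt0.
have qm0 : 0 < q / m by rewrite divr_gt0.
have H := @hoelder_ge0 _ _ _ mu D (fun x => `|f x| `^ m) (cst 1) (q / m) (1 - m / q)^-1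
  mD (measurable_norm_powR m mf) (measurable_cst _) _ _ qm0 s0 _.
have := H (fun x _ => powR_ge0 _ _) (fun x _ => @ler01 R).
rewrite invrK invf_div addrC subrK => /(_ erefl) {}H.
rewrite [leLHS](_ : _ = (\int[mu]_(x in D) (`|f x| `^ m * cst 1 x)%:E)%E); last first.
  by apply: eq_integral => x _; rewrite mulr1.
move: H; have -> : (\int[mu]_(x in D) ((`|f x| `^ m) `^ (q / m))%:E = Iq q f)%E.
  by apply: eq_integral => x _; rewrite -powRrM mulrCA divff ?mulr1// gt_eqF.
have -> // : (\int[mu]_(x in D) ((cst 1 x : R) `^ (1 - m / q)^-1)%:E = mu D)%E.
under eq_integral do rewrite powR1.
by rewrite integral_cst// mul1e.
Qed.

End power_integral.

Section sobolev_embedding.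
Context {R : realType} {d : nat} (Om : set 'rV[R]_d).
Hypotheses (oOm : open Om) (bOm : bounded_set Om).
Local Notation mu := (lebesgue_rV d : {measure set 'rV[R]_d -> \bar R}).
Local Notation L2 := (L2 mu Om).
Local Notation I2 := (I2 mu Om).
Local Notation Iq := (Iq mu Om).
Implicit Types (y z w : sobolev_pair R d) (f g phi : 'rV[R]_d -> R) (k : R -> R).
Let mOm := measurable_bounded_open oOm.

Lemma Iq_Cc_lty q phi : 0 < q -> Cc phi -> (Iq q phi < +oo)%E.
Proof.
move=> q0 Cphi; have [B B0 HB] := Cc_bounded Cphi.
have mphi : measurable_fun Om phi.
  by apply: measurable_funTS; apply: continuous_measurable_rV; case: Cphi.
apply: (@le_lt_trans _ _ (\int[mu]_(x in Om) (cst (B `^ q)%:E x))%E).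
  apply: ge0_le_integral => //.
  - by apply/measurable_EFinP; exact: measurable_norm_powR.
  - by move=> x _; rewrite lee_fin ge0_ler_powR ?nnegrE// ltW.
rewrite integral_cst// lte_mul_pinfty ?lee_fin ?powR_ge0//.
exact: bounded_open_measure_lty.
Qed.

Lemma integral_supp (h : 'rV[R]_d -> R) : (forall x, ~ Om x -> h x = 0) ->
  (\int[mu]_x (h x)%:E = \int[mu]_(x in Om) (h x)%:E)%E.
Proof.
move=> h0; rewrite [RHS]integral_mkcond; apply: eq_integral => x _.
by rewrite patchE; case: ifPn => // /negP nx; rewrite h0// => Ox; apply: nx; rewrite inE.
Qed.

Lemma test_powR_C1c q phi : 2 < q -> test_function Om phi ->
  let r := 1 / 2 + q / 4 in
  let f x := (phi x ^+ 2) `^ r in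
  C1c f /\
  forall i x, partial i f x = 2 * r * phi x * (phi x ^+ 2) `^ (r - 1) * partial i phi x.
Proof.
move=> q2 tphi r f; have r1 : 1 < r by rewrite /r; lra.
have [[cphi [M HM]] dphi] := test_function_C1c tphi.
have Hf i x : is_derive x (delta_mx ord0 i) f
    (2 * r * phi x * (phi x ^+ 2) `^ (r - 1) * partial i phi x).
  apply: (is_derive_comp_dir (is_derive_powR_sqr (phi x) r1)).
  by apply: DeriveDef => //; have [dp _] := dphi i.
have pf i : partial i f = fun x => 2 * r * phi x * (phi x ^+ 2) `^ (r - 1) * partial i phi x.
  by apply/funext => x; have [_ <-] := Hf i x.
have ck : continuous (fun t : R => (t ^+ 2) `^ r).
  move=> t; apply: differentiable_continuous; apply/derivable1_diffP.
  by have [] := is_derive_powR_sqr t r1.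
split; last by move=> i x; rewrite pf.
split.
  split; first by move=> x; exact: (cvg_comp _ _ (cphi x) (ck (phi x))).
  by exists M => x /HM; rewrite /f => ->; rewrite expr0n powR0// gt_eqF//; lra.
move=> i; split; first by move=> x; have [] := Hf i x.
have [_ [cp _]] := dphi i.
rewrite pf; split; last by exists M => x /HM ->; rewrite mulr0 !mul0r.
have ck' : continuous (fun t : R => 2 * r * t * (t ^+ 2) `^ (r - 1)) := continuous_powR_sqr r1.
move=> x; apply: (@continuousM _ _ (fun x => 2 * r * phi x * (phi x ^+ 2) `^ (r - 1))).
  exact: (continuous_comp (cphi x) (ck' (phi x))).
exact: cp.
Qed.

Lemma powR_sqr (t r : R) : (t ^+ 2) `^ r = `|t| `^ (2 * r).
Proof. by rewrite powRrM powR_mulrn// real_normK// num_real. Qed.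

(** Each partial derivative has modulus (1 + q/2) |phi|^(q/2) |partial_i phi|, to which the
    Cauchy-Schwarz inequality applies. Bounding each one by the full energy produces the factor
    d. *)
Lemma grad1_test_powR q phi : 2 < q -> test_function Om phi ->
  (grad1 (fun x => (phi x ^+ 2) `^ (1 / 2 + q / 4))%R <=
   (d%:R * (1 + q / 2) * Num.sqrt (fine (Iq q phi)) *
     Num.sqrt (energy Om (with_gradient phi)))%:E)%E.
Proof.
move=> q2 tphi; have [_ pf] := test_powR_C1c q2 tphi.
have Cphi := test_function_Cc tphi.
have q0 : 0 < q by lra.
have mphi : measurable_fun Om phi.
  by apply: measurable_funTS; apply: continuous_measurable_rV; case: Cphi.
have sqE x : (`|phi x| `^ (q / 2)) ^+ 2 = `|phi x| `^ q.
  by rewrite -powR_mulrn ?powR_ge0// -powRrM divfK.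
have Lq : L2 (fun x => `|phi x| `^ (q / 2)).
  split; first exact: measurable_norm_powR.
  apply/integrableP; split.
    by apply/measurable_EFinP; apply: measurable_funX; exact: measurable_norm_powR.
  under eq_integral do rewrite /= sqE ger0_norm ?powR_ge0//.
  exact: Iq_Cc_lty.
have IE : I2 (fun x => `|phi x| `^ (q / 2)) = fine (Iq q phi).
  by rewrite /I2 /Rintegral /Iq; congr fine; apply: eq_integral => x _; rewrite sqE.
have c0 : 0 <= 1 + q / 2 by lra.
have step i : (\int[mu]_x (`|partial i (fun x => (phi x ^+ 2) `^ (1 / 2 + q / 4)) x|%R)%:E <=
   ((1 + q / 2) * Num.sqrt (fine (Iq q phi)) * Num.sqrt (energy Om (with_gradient phi)))%:E)%E.
  have tp := test_function_partial i tphi.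
  have Lp := L2_test oOm bOm tp.
  rewrite integral_supp; last by move=> x nx; rewrite pf (test_function_out tp nx) mulr0 normr0.
  rewrite (eq_integral (fun x => ((1 + q / 2)%:E *
     (`|(`|phi x| `^ (q / 2))| * `|partial i phi x|)%:E)%E)); last first.
    move=> x _; rewrite pf -EFinM; congr EFin; rewrite !normrM mulrA; congr (_ * _).
    rewrite powR_sqr !(ger0_norm (powR_ge0 _ _)) -mulrA; congr (_ * _).
      rewrite ger0_norm; last by lra.
      rewrite ger0_norm; by lra.
    have [->|p0] := eqVneq `|phi x| 0; first by rewrite mul0r powR0// gt_eqF//; lra.
    rewrite -{1}(powRr1 (normr_ge0 (phi x))) -powRD ?p0 ?implybT//; congr (_ `^ _); lra.
  rewrite ge0_integralZl_EFin//; last first.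
    apply/measurable_EFinP; apply: measurable_funM.
      by case: Lq => mq _; exact: measurableT_comp.
    by case: Lp => mp _; exact: measurableT_comp.
  rewrite -mulrA EFinM lee_wpmul2l ?lee_fin//.
  apply: (le_trans (integral_norm_mul_le mOm Lq Lp)); rewrite IE lee_fin ler_wpM2l//.
  apply: ler_wsqrtr; rewrite /energy (bigD1 i)//= addrCA lerDl addr_ge0 ?I2_ge0//.
  by rewrite sumr_ge0// => j _; exact: I2_ge0.
rewrite /grad1; apply: (le_trans (lee_sum _ (fun i _ => step i))).
by rewrite sumEFin lee_fin sumr_const card_ord -!mulrA mulr_natl.
Qed.

End sobolev_embedding.

Lemma gagliardo_nirenberg (R : realType) d (f h : 'rV[R]_d -> R) : (0 < d)%N ->
  C1c f -> measurable_fun setT h -> (forall x, 0 <= h x) ->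
  (\int[lebesgue_rV d]_x (`|f x| * h x `^ (d%:R^-1))%:E <=
  grad1 f * (\int[lebesgue_rV d]_x (h x)%:E) `^ (d%:R^-1))%E.
Proof. by case: d f h => // n f h _; exact: gagliardo_nirenberg_rV. Qed.

Section sobolev_inequality.
Context {R : realType} {d : nat} (Om : set 'rV[R]_d).
Hypotheses (oOm : open Om) (bOm : bounded_set Om) (d0 : (0 < d)%N).
Local Notation mu := (lebesgue_rV d : {measure set 'rV[R]_d -> \bar R}).
Implicit Types (y z w : sobolev_pair R d) (f g phi : 'rV[R]_d -> R).
Let mOm := measurable_bounded_open oOm.
Variable q : R.
Hypotheses (q2 : 2 < q) (qd : q * (d%:R - 2) <= 2 * d%:R).

Let q0 : 0 < q. Proof. by move: q2; lra. Qed.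
Let dR0 : 0 < d%:R :> R. Proof. by rewrite ltr0n. Qed.

(** Chosen so that |phi|^(1 + q/2) (|phi|^m)^(1/d) = |phi|^q. The hypothesis [qd] amounts to m <= q,
    which allows the L^m integral to be bounded by the L^q integral. *)
Let m := d%:R * (q / 2 - 1).

Let m0 : 0 < m.
Proof. by rewrite mulr_gt0//; move: q2; lra. Qed.

Let mq : m <= q.
Proof. by rewrite /m; move: qd; lra. Qed.

Let V := fine (mu Om).

Let VE : V%:E = mu Om.
Proof. by rewrite fineK// ge0_fin_numE//; exact: bounded_open_measure_lty. Qed.

Let C0 := d%:R * (1 + q / 2) * V `^ ((1 - m / q) / d%:R).

(** With x the integral of |phi|^q and N the energy norm, the pairing gives x <= C0 N x^(1/2)
    x^(m/(q d)), and 1/2 + m/(q d) = 1 - 1/q. Dividing by x^(1 - 1/q) leaves the claim; x = 0 is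
    treated apart. *)
Lemma sobolev_test phi : test_function Om phi ->
  fine (Iq mu Om q phi) `^ q^-1 <= C0 * Num.sqrt (energy Om (with_gradient phi)).
Proof.
move=> tphi; have [C1f _] := test_powR_C1c q2 tphi.
have Cphi := test_function_Cc tphi.
have mphi : measurable_fun setT phi.
  by apply: continuous_measurable_rV; case: Cphi.
have := @gagliardo_nirenberg R d _ (fun x => `|phi x| `^ m) d0 C1f
  (measurable_norm_powR m mphi) (fun x => powR_ge0 _ _).
have r0 : 1 / 2 + q / 4 != 0 by rewrite gt_eqF//; move: q2; lra.
have phi0 x : ~ Om x -> phi x = 0 by move=> nx; exact: (test_function_out tphi nx).
rewrite (@integral_supp _ _ Om); last first.
  by move=> x /phi0 ->; rewrite expr0n powR0// normr0 mul0r.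
have -> : (\int[mu]_(x in Om) (`|(phi x ^+ 2) `^ (1 / 2 + q / 4)| *
   (`|phi x| `^ m) `^ d%:R^-1)%:E = Iq mu Om q phi)%E.
  apply: eq_integral => x _; rewrite ger0_norm ?powR_ge0// powR_sqr -powRrM.
  rewrite (_ : m * d%:R^-1 = q / 2 - 1); last by rewrite /m mulrAC divff ?mul1r// gt_eqF.
  have [->|p0] := eqVneq `|phi x| 0.
    by rewrite !powR0 ?mul0r// gt_eqF//; move: q2; lra.
  rewrite -powRD ?p0 ?implybT//; congr (_ `^ _)%:E; lra.
rewrite (@integral_supp _ _ Om); last by move=> x /phi0 ->; rewrite normr0 powR0// gt_eqF.
set x := fine (Iq mu Om q phi).
have xE : Iq mu Om q phi = x%:E.
  by rewrite fineK// ge0_fin_numE ?Iq_ge0// Iq_Cc_lty.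
have x0 : 0 <= x by rewrite fine_ge0// Iq_ge0.
move=> H; have {}H := le_trans H (lee_pmul (grad1_ge0 _) (poweR_ge0 _ _)
  (grad1_test_powR oOm bOm q2 tphi) (le_poweR _ (Iq_ge0 _ _ _ _)
  (Iq_le_pow mu (q := q) (m := m) mOm _ (measurable_funTS mphi)))).
have {}H := H (ltac:(by rewrite invr_ge0 ltW)) (ltac:(by rewrite m0 mq)).
have EP : ((x%:E `^ (m / q) * V%:E `^ (1 - m / q)) `^ d%:R^-1 =
    ((x `^ (m / q) * V `^ (1 - m / q)) `^ d%:R^-1)%:E)%E by [].
move: H; rewrite xE -VE EP -EFinM lee_fin [fine x%:E]/=.
set N := Num.sqrt (energy _ _).
have [->|xn0] := eqVneq x 0.
  by move=> _; rewrite powR0 ?invr_eq0 ?gt_eqF// mulr_ge0 ?sqrtr_ge0// !mulr_ge0 ?powR_ge0//; move: q2; lra.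
have xp : 0 < x by rewrite lt_def xn0.
rewrite -powR12_sqrt// powRM ?powR_ge0// -!powRrM.
have -> : m / q * d%:R^-1 = 1 - q^-1 - 2^-1.
  by rewrite /m; field; rewrite !gt_eqF.
have E1 : x `^ 2^-1 * x `^ (1 - q^-1 - 2^-1) = x `^ (1 - q^-1).
  by rewrite -powRD ?xn0 ?implybT//; congr (_ `^ _); lra.
have E2 : x = x `^ q^-1 * x `^ (1 - q^-1).
  by rewrite -powRD ?xn0 ?implybT// addrC subrK powRr1.
have E3 : 0 < x `^ (1 - q^-1) by exact: powR_gt0.
rewrite [leRHS](_ : _ = C0 * N * x `^ (1 - q^-1)); last by rewrite -E1 /C0; ring.
by rewrite [leLHS]E2 ler_pM2r.
Qed.

Lemma sobolev_H10 : exists2 C : R, 0 < C & forall w, H10 Om w ->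
  (Iq mu Om q w.1 < +oo)%E /\ (fine (Iq mu Om q w.1) `^ q^-1) ^+ 2 <= C * energy Om w.
Proof.
have C00 : 0 <= C0 by rewrite !mulr_ge0 ?powR_ge0//; move: q2; lra.
(* The 2 comes from [energyB], applied to phi_n = w - (w - phi_n); the [+ 1] only makes the constant
   positive. *)
exists (2 * C0 ^+ 2 + 1); first by rewrite ltr_wpDl// mulr_ge0// sqr_ge0.
move=> w Hw; have Lw := H10_L2 oOm Hw.
have [phi [tphi ephi aphi]] := H10_approx_seq oOm bOm Hw.
have E0 := energy_ge0 Om w; set E := energy Om w in E0 *.
have mw : measurable_fun Om w.1 by case: Lw => -[].
have bound (e : R) : 0 < e -> (Iq mu Om q w.1 <= ((C0 * Num.sqrt (2 * E + e)) `^ q)%:E)%E.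
  move=> e0; apply: (@ae_cvg_integral_le _ _ _ mu Om (fun n x => `|phi n x| `^ q)) => //.
  - move=> n; apply: measurable_norm_powR; apply: measurable_funTS.
    by apply: continuous_measurable_rV; case: (test_function_Cc (tphi n)).
  - exact: measurable_norm_powR.
  - have q21 : 1 < q / 2 by move: q2; lra.
    have ck : continuous (fun t : R => (t ^+ 2) `^ (q / 2)).
      move=> t; apply: differentiable_continuous; apply/derivable1_diffP.
      by have [] := is_derive_powR_sqr t q21.
    have kE (t : R) : `|t| `^ q = (t ^+ 2) `^ (q / 2).
      by rewrite powR_sqr mulrC divfK.
    apply: filterS aphi => x + Ox => /(_ Ox) Hx.
    under eq_fun do rewrite kE; rewrite kE.
    exact: (cvg_comp _ _ Hx (ck (w.1 x))).
  - near=> n.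
    have He : 1 / (2 ^ n.+1)%:R <= e / 2.
      by near: n; apply: (cvgr_le _ (@cvg_inv_exp2 R)); rewrite divr_gt0.
    have Lp := L2_with_gradient oOm bOm (tphi n).
    have En : energy Om (with_gradient (phi n)) <= 2 * E + e.
      have := energyB oOm Lw (L2_pairB oOm Lw Lp).
      rewrite subKr => /le_trans; apply; rewrite lerD2l.
      apply: (@le_trans _ _ (2 * (e / 2))); last by rewrite mulrC divfK.
      by rewrite ler_pM2l// (le_trans (ephi n)).
    have Ifin := Iq_Cc_lty oOm bOm q0 (test_function_Cc (tphi n)).
    rewrite -/(Iq mu Om q (phi n)) -[Iq _ _ _ _]fineK ?ge0_fin_numE ?Iq_ge0// lee_fin.
    have xq : fine (Iq mu Om q (phi n)) = (fine (Iq mu Om q (phi n)) `^ q^-1) `^ q.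
      by rewrite -powRrM mulVf ?gt_eqF// powRr1// fine_ge0// Iq_ge0.
    rewrite xq; apply: ge0_ler_powR; rewrite ?nnegrE ?powR_ge0 ?(mulr_ge0 C00 (sqrtr_ge0 _)) ?(ltW q0)//.
    apply: (le_trans (sobolev_test (tphi n))); rewrite ler_wpM2l//.
    exact: ler_wsqrtr.
have Ifin : (Iq mu Om q w.1 < +oo)%E := le_lt_trans (bound 1 ltr01) (ltry _).
split=> //.
have IE : Iq mu Om q w.1 = (fine (Iq mu Om q w.1))%:E by rewrite fineK// ge0_fin_numE// Iq_ge0.
apply: (@le_trans _ _ (2 * C0 ^+ 2 * E)); last by rewrite ler_wpM2r// lerDl.
apply/ler_addgt0Pl => e e0.
(* Scaled so that after squaring, multiplication by C0^2 leaves an error of at most [e], even if C0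
   = 0. *)
have e1 : 0 < e / (C0 ^+ 2 + 1) by rewrite divr_gt0// ltr_wpDl// sqr_ge0.
have := bound _ e1; rewrite IE lee_fin => H.
have S0 : 0 <= C0 * Num.sqrt (2 * E + e / (C0 ^+ 2 + 1)) by rewrite mulr_ge0// sqrtr_ge0.
have H2 : fine (Iq mu Om q w.1) `^ q^-1 <= C0 * Num.sqrt (2 * E + e / (C0 ^+ 2 + 1)).
  have E1 (t : R) : 0 <= t -> t = (t `^ q) `^ q^-1.
    by move=> t0; rewrite -powRrM divff ?powRr1// gt_eqF.
  rewrite [leRHS](E1 _ S0).
  apply: ge0_ler_powR.
  - by rewrite invr_ge0 (ltW q0).
  - by rewrite nnegrE fine_ge0// Iq_ge0.
  - by rewrite nnegrE; exact: powR_ge0.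
  - exact: H.
have H3 : (fine (Iq mu Om q w.1) `^ q^-1) ^+ 2 <= (C0 * Num.sqrt (2 * E + e / (C0 ^+ 2 + 1))) ^+ 2.
  by apply: lerXn2r; rewrite ?nnegrE; [exact: powR_ge0|exact: S0|exact: H2].
apply: (le_trans H3); rewrite exprMn sqr_sqrtr; last first.
  by apply: addr_ge0; [exact: mulr_ge0|exact: ltW].
have e2 : C0 ^+ 2 * (e / (C0 ^+ 2 + 1)) <= e.
  rewrite mulrA ler_pdivrMr; last by rewrite ltr_wpDl ?sqr_ge0.
  by rewrite mulrC ler_wpM2l ?(ltW e0)// lerDl.
by rewrite mulrDr addrC lerD// mulrA [C0 ^+ 2 * 2]mulrC.
Unshelve. all: by end_near. Qed.

End sobolev_inequality.

(** * The level set iteration *)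

Section stampacchia_iteration.
Context {R : realType}.

(* The solution D of D^q = 2^q V^(b - 1) / rho with rho = 2^(- q / (b - 1)), for
   which the levels k_n = D M (1 - 2^-n) satisfy g(k_n) <= V rho^n. *)
Definition stampacchia_const (q b V : R) : R :=
  (2 `^ q * 2 `^ (q / (b - 1)) * V `^ (b - 1)) `^ q^-1.

Lemma stampacchia_const_gt0 q b V : 0 < V -> 0 < stampacchia_const q b V.
Proof. by move=> V0; rewrite powR_gt0// !mulr_gt0 ?powR_gt0. Qed.

(** The decay g(k_n) <= V rho^n is proved by induction. The shrinking gaps cost a factor 2^q per
    step, while the exponent b > 1 gains rho^(b - 1) per step, and the two cancel. As all levels
    stay below D M, monotonicity of [g] leaves g(D M) <= V rho^n for every n. *)
Lemma stampacchia (q b V M : R) (g : R -> R) : 0 < q -> 1 < b -> 0 < V -> 0 < M ->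
  (forall t, 0 <= g t) -> (forall t, g t <= V) ->
  (forall s t, s <= t -> g t <= g s) ->
  (forall s t, 0 <= s -> s < t -> g t <= (M / (t - s)) `^ q * g s `^ b) ->
  g (stampacchia_const q b V * M) = 0.
Proof.
move=> q0 b1 V0 M0 g0 gV gd gst; set D := stampacchia_const q b V.
have D0 : 0 < D by exact: stampacchia_const_gt0.
have b10 : 0 < b - 1 by rewrite subr_gt0.
pose rho : R := 2 `^ (- (q / (b - 1))).
have rho0 : 0 < rho by exact: powR_gt0.
have rho1 : rho < 1.
  rewrite /rho powRN invf_lt1 ?powR_gt0//.
  apply: (@le_lt_trans _ _ (1 `^ (q / (b - 1)))); first by rewrite powR1.
  by apply: gt0_ltr_powR; rewrite ?nnegrE ?divr_gt0// ltr1n.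
pose a : R := 2 `^ q.
have a0 : 0 < a by exact: powR_gt0.
have DE : D `^ q = a / rho * V `^ (b - 1).
  rewrite /D /stampacchia_const -powRrM mulVf ?gt_eqF// powRr1; last first.
    by rewrite !mulr_ge0 ?powR_ge0.
  by congr (_ * _ * _); rewrite /rho powRN invrK.
(* This is rho^(b - 1) = 2^(-q): the superlinear gain exactly offsets the factor 2^q from halving
   the gap. *)
have rhob : rho `^ b = rho / a.
  rewrite /rho /a -powRrM -powRN -powRD; last by rewrite pnatr_eq0 implybT.
  by congr (_ `^ _); field; rewrite gt_eqF.
have Vb : V `^ b = V * V `^ (b - 1).
  by rewrite mulr_powRB1 ?ltW// (lt_trans ltr01).
pose k n : R := D * M * (1 - 1 / 2 ^+ n).
have P2 n : 0 < (2 : R) ^+ n by rewrite exprn_gt0.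
have k0 n : 0 <= k n.
  apply: mulr_ge0; first by rewrite mulr_ge0 ?ltW.
  by rewrite subr_ge0 mul1r invf_le1// exprn_ege1// ler1n.
have kS n : k n.+1 - k n = D * M / 2 ^+ n.+1.
  by rewrite /k exprS; field; rewrite gt_eqF.
have claim n : g (k n) <= V * rho ^+ n.
  elim: n => [|n IH]; first by rewrite expr0 mulr1 gV.
  have kk : k n < k n.+1 by rewrite -subr_gt0 kS divr_gt0 ?mulr_gt0.
  apply: (le_trans (gst _ _ (k0 n) kk)); rewrite kS.
  have -> : M / (D * M / 2 ^+ n.+1) = 2 ^+ n.+1 / D.
    by field; rewrite !gt_eqF.
  apply: (@le_trans _ _ ((2 ^+ n.+1 / D) `^ q * (V * rho ^+ n) `^ b)).
    apply: ler_wpM2l; first exact: powR_ge0.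
    have b0 : 0 <= b := ltW (lt_trans ltr01 b1).
    apply: (ge0_ler_powR b0 _ _ IH); first exact: g0.
    by rewrite nnegrE mulr_ge0 ?(ltW V0)// exprn_ge0// ltW.
  have E1 : (2 ^+ n.+1 / D) `^ q = a ^+ n.+1 / D `^ q.
    rewrite powRM ?(ltW (P2 _)) ?invr_ge0 ?(ltW D0)//; congr (_ * _).
      by rewrite -(powR_mulrn n.+1 (ler0n R 2)) -(powR_mulrn n.+1 (ltW a0)) /a powRAC.
    by rewrite -powR_inv1 ?(ltW D0)// -powRrM mulN1r powRN.
  have E2 : (V * rho ^+ n) `^ b = V `^ b * (rho / a) ^+ n.
    rewrite powRM ?(ltW V0) ?exprn_ge0 ?(ltW rho0)//; congr (_ * _).
    by rewrite -rhob -(powR_mulrn n (ltW rho0)) -(powR_mulrn n (powR_ge0 rho b)) powRAC.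
  rewrite E1 E2.
  (* The choice of [D] turns the recursive bound into V rho^(n + 1) with equality. *)
  rewrite DE Vb expr_div_n !exprS le_eqVlt; apply/orP; left; apply/eqP.
  by field; rewrite !gt_eqF ?exprn_gt0 ?powR_gt0.
have gDn n : g (D * M) <= V * rho ^+ n.
  have h : 1 - 1 / 2 ^+ n <= 1 :> R by rewrite gerBl divr_ge0// ltW.
  apply: le_trans (claim n); apply: gd; apply: ler_piMr h.
  by rewrite mulr_ge0 ?(ltW D0) ?(ltW M0).
apply/eqP; rewrite eq_le g0 andbT; apply/ler_addgt0Pl => e e0; rewrite addr0.
have : V * rho ^+ n @[n --> \oo] --> (0 : R).
  by apply: cvg_geometric; rewrite gtr0_norm.
move=> /cvgr_le/(_ e e0)[n _ Hn].
exact: le_trans (gDn n) (Hn n (leqnn n)).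
Qed.

End stampacchia_iteration.

(** * The variational inequality *)

Section holder_on_level_set.
Context dT (T : measurableType dT) (R : realType) (mu : {measure set T -> \bar R}).

(** Hoelder's inequality with [p] and its conjugate p', followed by the passage from L^p' to L^q on
    [A], where [f] lives; this costs |A|^(1/p' - 1/q). The condition on [p] and [q] says p' < q. *)
Lemma holder_support (D A : set T) (p q : R) (u f : T -> R) :
  measurable D -> measurable A -> A `<=` D ->
  measurable_fun D u -> measurable_fun D f -> (forall x, D x -> ~ A x -> f x = 0) ->
  1 < p -> 0 < q -> p^-1 + q^-1 < 1 ->
  (\int[mu]_(x in D) (`|u x| * `|f x|)%:E <=
   Iq mu D p u `^ p^-1 * (Iq mu D q f `^ q^-1 * mu A `^ (1 - p^-1 - q^-1)))%E.
Proof.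
move=> mD mA AD mu_ mf f0 p1 q0 pq.
have p0 : 0 < p by exact: lt_trans p1.
have ip1 : p^-1 < 1 by rewrite invf_lt1.
have iq0 : 0 < q^-1 by rewrite invr_gt0.
pose p' := (1 - p^-1)^-1.
have p'0 : 0 < p' by rewrite invr_gt0 subr_gt0.
have p'q : p' < q.
  by rewrite -[ltRHS]invrK ltf_pV2 ?posrE ?invr_gt0 ?subr_gt0//; lra.
have := @hoelder_ge0 _ _ _ mu D (fun x => `|u x|) (fun x => `|f x|) p p' mD
  (measurableT_comp (@normr_measurable R setT) mu_) (measurableT_comp (@normr_measurable R setT) mf)
  (fun x _ => normr_ge0 _) (fun x _ => normr_ge0 _) p0 p'0.
have ip' : p'^-1 = 1 - p^-1 by rewrite /p' invrK.
rewrite ip' addrC subrK => /(_ erefl) /le_trans; apply.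
apply: lee_wpmul2l; first exact: poweR_ge0.
have H : (Iq mu D p' f <= Iq mu D q f `^ (p' / q) * mu A `^ (1 - p' / q))%E.
  have -> : Iq mu D p' f = Iq mu A p' f.
    rewrite /Iq [LHS]integral_mkcond [RHS]integral_mkcond; apply: eq_integral => x _.
    rewrite !patchE; have [xA|xA] := boolP (x \in A).
      by rewrite mem_set//; apply: AD; rewrite inE in xA.
    case: ifPn => // xD; rewrite f0 ?normr0 ?powR0 ?gt_eqF//; first by rewrite inE in xD.
    by move=> Ax; move/negP: xA; apply; rewrite inE.
  have mfA : measurable_fun A f by exact: measurable_funS mf.
  have p'q' : 0 < p' <= q by rewrite p'0 ltW.
  apply: (le_trans (Iq_le_pow mu mA p'q' mfA)).
  apply: lee_wpmul2r; first exact: poweR_ge0.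
  apply: le_poweR; [by rewrite divr_ge0 ?ltW|exact: Iq_ge0|].
  apply: ge0_subset_integral => //.
  by apply/measurable_EFinP; exact: measurable_norm_powR.
apply: (@le_trans _ _ ((Iq mu D q f `^ (p' / q) * mu A `^ (1 - p' / q)) `^ (1 - p^-1))%E).
  by apply: le_poweR => //; [rewrite subr_ge0 ltW|exact: Iq_ge0].
rewrite poweRM ?poweR_ge0// -!poweRrM.
have -> : p' / q * (1 - p^-1) = q^-1.
  by rewrite mulrAC mulVf ?mul1r// gt_eqF// subr_gt0.
have -> : (1 - p' / q) * (1 - p^-1) = 1 - p^-1 - q^-1.
  by rewrite mulrBl mul1r mulrAC mulVf ?mul1r// gt_eqF// subr_gt0.
exact: lexx.
Qed.

End holder_on_level_set.

(** * Essentially bounded functions and the norms of the statement *)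

Section essentially_bounded.
Context {R : realType} {d : nat} (Om : set 'rV[R]_d).
Hypotheses (mOm : measurable Om).
Local Notation mu := (lebesgue_rV d : {measure set 'rV[R]_d -> \bar R}).
Implicit Types f g : 'rV[R]_d -> R.

Lemma Lp_norm_fin (p : R) f : p != 0 -> Lp_norm Om p%:E f = (Iq mu Om p f `^ p^-1)%E.
Proof.
move=> p0; rewrite /Lp_norm unlock.
have -> // : (\int[mu]_x (`|(EFin \o f \_ Om) x| `^ p) = Iq mu Om p f)%E.
rewrite /Iq [RHS]integral_mkcond; apply: eq_integral => x _ /=.
by rewrite !patchE; case: ifPn => // _; rewrite normr0 powR0.
Qed.

Lemma Lp_norm_oo_le f (c : R) : 0 <= c ->
  {ae mu, forall x, Om x -> `|f x| <= c} -> (Lp_norm Om +oo f <= c%:E)%E.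
Proof.
(* The norm for exponent infinity is an essential supremum when the whole space has positive measure
   and 0 by convention otherwise. *)
move=> c0 fc; rewrite /Lp_norm unlock; case: ifP => [_|_]; last by rewrite lee_fin.
apply/ess_supP; apply: filterS fc => x H /=; rewrite patchE.
by case: ifPn => [xO|_]; rewrite lee_fin ?normr0//; apply: H; rewrite inE in xO.
Qed.

Lemma Lp_oo_bounded f : Lp Om +oo f ->
  exists2 c : R, 0 <= c & {ae mu, forall x, Om x -> `|f x| <= c}.
Proof.
move=> [mf]; rewrite /Lp_norm unlock; case: ifPn => [mu0 H|].
  have H0 : (0 <= ess_sup mu (abse \o (EFin \o f \_ Om)))%E.
    by apply: ess_sup_gee => //; apply: nearW => x /=; rewrite lee_fin.
  exists (fine (ess_sup mu (abse \o (EFin \o f \_ Om)))); first exact: fine_ge0.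
  have := ess_sup_ge mu (abse \o (EFin \o f \_ Om)); apply: filterS => x + Ox.
  rewrite /= patchE mem_set// -lee_fin fineK//.
  by rewrite ge0_fin_numE.
rewrite -leNgt => muT _; exists 0 => //; exists setT; split => //.
by apply/eqP; rewrite eq_le muT/=.
Qed.

Lemma integrable_Lp_oo_mul f g : Lp Om +oo f -> mu.-integrable Om (EFin \o g) ->
  mu.-integrable Om (EFin \o (fun x => f x * g x)).
Proof.
move=> Lf gi; have [c c0 fc] := Lp_oo_bounded Lf; have [mf _] := Lf.
have mg : measurable_fun Om g by apply/measurable_EFinP; case/integrableP: gi.
apply/integrableP; split; first by apply/measurable_EFinP; exact: measurable_funM.
have cgi : mu.-integrable Om (EFin \o (fun x => c * g x)) := integrableZl mOm c gi.
have /integrableP[_] := cgi; apply: le_lt_trans.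
apply: ae_ge0_le_integral => //.
- by apply/measurable_EFinP; apply: measurableT_comp => //; exact: measurable_funM.
- by apply/measurable_EFinP; apply: measurableT_comp => //; exact: measurable_funM.
apply: filterS fc => x + Ox => /(_ Ox) fx.
by rewrite /= lee_fin !normrM ler_wpM2r// (le_trans fx)// ler_norm.
Qed.

Lemma Rintegral_ae_ge0 f : measurable_fun Om f ->
  {ae mu, forall x, Om x -> 0 <= f x} -> 0 <= \int[mu]_(x in Om) f x.
Proof.
move=> mf f0; rewrite /Rintegral (@ae_eq_integral _ _ _ mu _ (fun x => (`|f x|)%:E))//.
- by apply: fine_ge0; exact: integral_ge0.
- exact/measurable_EFinP.
- by apply/measurable_EFinP; exact: measurableT_comp.
- by apply: filterS f0 => x + Ox => /(_ Ox) fx; rewrite ger0_norm.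
Qed.

End essentially_bounded.

(** * Testing the variational inequalities with truncations *)

Section truncated_test_function.
Context {R : realType} {d : nat} (Om : set 'rV[R]_d).
Hypotheses (oOm : open Om) (bOm : bounded_set Om).
Local Notation mu := (lebesgue_rV d : {measure set 'rV[R]_d -> \bar R}).
Variables (a : 'I_d -> 'I_d -> 'rV[R]_d -> R) (b : 'I_d -> 'rV[R]_d -> R)
  (gam : 'rV[R]_d -> R).
Hypotheses (a_Linfty : forall i j : 'I_d, Lp Om +oo%E (a i j))
  (b_Linfty : forall i : 'I_d, Lp Om +oo%E (b i))
  (gam_Linfty : Lp Om +oo%E gam)
  (gam_ge0 : {ae mu, forall x : 'rV[R]_d, Om x -> 0 <= gam x}).
Implicit Types (y z w v : sobolev_pair R d).
Let mOm := measurable_bounded_open oOm.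

Lemma integrable_Rsum (I : Type) (r : seq I) (f : I -> 'rV[R]_d -> R) :
  (forall i, mu.-integrable Om (EFin \o f i)) ->
  mu.-integrable Om (EFin \o (fun x => \sum_(i <- r) f i x)).
Proof.
move=> fi; elim: r => [|i r IH].
  by under eq_fun do rewrite big_nil; exact: integrable0.
by under eq_fun do rewrite big_cons; exact: (integrableD mOm (fi i) IH).
Qed.

Definition elliptic_integrand y v (x : 'rV[R]_d) : R :=
  \sum_i \sum_j a i j x * y.2 j x * v.2 i x +
  \sum_i b i x * y.2 i x * v.1 x + gam x * y.1 x * v.1 x.

Lemma integrable_elliptic_integrand y v : L2_pair Om y -> L2_pair Om v ->
  mu.-integrable Om (EFin \o elliptic_integrand y v).
Proof.
move=> [y1 y2] [v1 v2].
have H (c f g : 'rV[R]_d -> R) : Lp Om +oo c -> L2 mu Om f -> L2 mu Om g ->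
    mu.-integrable Om (EFin \o (fun x => c x * f x * g x)).
  move=> Lc Lf Lg; under eq_fun do rewrite -mulrA.
  exact: (integrable_Lp_oo_mul mOm Lc (integrable_L2M mOm Lf Lg)).
have H1 : mu.-integrable Om (EFin \o (fun x => \sum_i \sum_j a i j x * y.2 j x * v.2 i x)).
  by apply: integrable_Rsum => i; apply: integrable_Rsum => j; exact: H.
have H2 : mu.-integrable Om (EFin \o (fun x => \sum_i b i x * y.2 i x * v.1 x)).
  by apply: integrable_Rsum => i; exact: H.
exact: (integrableD mOm (integrableD mOm H1 H2) (H _ _ _ gam_Linfty y1 v1)).
Qed.

Lemma elliptic_integrand_difference y1 y2 v x :
  elliptic_integrand y1 (- v) x + elliptic_integrand y2 v x = - elliptic_integrand (y1 - y2) v x.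
Proof.
rewrite /elliptic_integrand addrACA [X in X + _]addrACA !opprD; congr (_ + _ + _).
- rewrite -big_split/= -sumrN; apply: eq_bigr => i _.
  rewrite -big_split/= -sumrN; apply: eq_bigr => j _.
  (* The conversion exposes the pointwise values behind the componentwise operations on pairs, so
     that [ring] sees scalars. *)
  change (a i j x * y1.2 j x * - v.2 i x + a i j x * y2.2 j x * v.2 i x =
    - (a i j x * (y1.2 j x - y2.2 j x) * v.2 i x)); ring.
- rewrite -big_split/= -sumrN; apply: eq_bigr => i _.
  change (b i x * y1.2 i x * - v.1 x + b i x * y2.2 i x * v.1 x =
    - (b i x * (y1.2 i x - y2.2 i x) * v.1 x)); ring.
- change (gam x * y1.1 x * - v.1 x + gam x * y2.1 x * v.1 x =
    - (gam x * (y1.1 x - y2.1 x) * v.1 x)); ring.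
Qed.

Lemma trunc_mul_trunc' (c t : R) : 0 <= c -> trunc' c t * trunc c t = trunc c t.
Proof.
by move=> c0; rewrite trunc'E// truncE//; case: ltP => _;
  [rewrite mul1r|case: ltP => _; rewrite ?mul1r ?mulr0].
Qed.

Lemma trunc'_idem (c t : R) : trunc' c t * trunc' c t = trunc' c t.
Proof. by rewrite /trunc'; case: (c < _); rewrite ?mulr1 ?mulr0. Qed.

Lemma sqr_trunc_le (c t : R) : 0 <= c -> trunc c t ^+ 2 <= t * trunc c t.
Proof.
move=> c0; rewrite truncE//; case: ltP => [ct|_].
  by rewrite expr2 ler_wpM2r; lra.
by case: ltP => [tc|_]; [rewrite expr2 ler_wnM2r; lra|rewrite expr0n mulr0].
Qed.

(** Let chi be the indicator of {|w| > c}. Then grad z = chi grad w, z = chi z and chi^2 = chi, so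
    the second- and first-order terms do not distinguish w from z. Only the zero-order term does,
    and its excess is nonnegative by [sqr_trunc_le] and the sign of [gam]. *)
Lemma elliptic_integrand_trunc (c : R) w x : 0 <= c -> let z := comp_pair (trunc c) (trunc' c) w in
  elliptic_integrand w z x = elliptic_integrand z z x + gam x * (w.1 x * z.1 x - z.1 x ^+ 2).
Proof.
move=> c0 z; rewrite /elliptic_integrand -!addrA; congr (_ + _).
  apply: eq_bigr => i _; apply: eq_bigr => j _ /=.
  rewrite -[in LHS](trunc'_idem c (w.1 x)); ring.
congr (_ + _); last by rewrite /=; ring.
apply: eq_bigr => i _ /=.
rewrite -[in LHS](trunc_mul_trunc' (w.1 x) c0); ring.
Qed.

(** The truncation r lies between 0 and s - t, so s - r and t + r lie between s and t and have the
    same sum. The inequality is then convexity of the absolute value, checked by cases on signs. *)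
Lemma abs_trunc_le (c s t : R) : 0 <= c ->
  `|s - trunc c (s - t)| + `|t + trunc c (s - t)| <= `|s| + `|t|.
Proof.
move=> c0; rewrite truncE//.
have H (r : R) : 0 <= r <= s - t \/ s - t <= r <= 0 -> `|s - r| + `|t + r| <= `|s| + `|t|.
  have N (x : R) : (0 <= x /\ `|x| = x) \/ (x < 0 /\ `|x| = - x).
    by case: (lerP 0 x) => x0; [left; rewrite ger0_norm|right; rewrite ltr0_norm].
  by case: (N s) => -[s0 ->]; case: (N t) => -[t0 ->]; case: (N (s - r)) => -[sr ->];
    case: (N (t + r)) => -[tr ->]; case=> /andP[h1 h2]; lra.
apply: H; case: ltP => [h|h]; first by left; apply/andP; split; lra.
case: ltP => [h'|h']; first by right; apply/andP; split; lra.
have [st|st] := lerP 0 (s - t); [left|right]; apply/andP; split; lra.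
Qed.

Lemma integrable_L2 (f : 'rV[R]_d -> R) : L2 mu Om f -> mu.-integrable Om (EFin \o f).
Proof.
move=> Lf; have L1 : L2 mu Om (cst 1).
  split; first exact: measurable_cst.
  apply/integrableP; split; first by apply/measurable_EFinP; apply: measurable_sqr; exact: measurable_cst.
  under eq_integral do rewrite /= expr1n normr1.
  by rewrite integral_cst// mul1e bounded_open_measure_lty.
by have := integrable_L2M mOm Lf L1; under eq_fun do rewrite mulr1.
Qed.

(** Integrability of the products with [z] is assumed because splitting the integral of (u1 - u2) z
    requires it; it will follow from the Sobolev inequality and Hoelder's inequality. *)
Lemma truncated_test_function (c : R) (u1 u2 : 'rV[R]_d -> R) y1 y2 : 0 <= c ->
  let z := comp_pair (trunc c) (trunc' c) (y1 - y2) in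
  mu.-integrable Om (EFin \o (fun x => u1 x * z.1 x)) ->
  mu.-integrable Om (EFin \o (fun x => u2 x * z.1 x)) ->
  is_S Om (elliptic_form Om a b gam) (L_functional Om u1) y1 ->
  is_S Om (elliptic_form Om a b gam) (L_functional Om u2) y2 ->
  elliptic_form Om a b gam z z <= \int[mu]_(x in Om) ((u1 x - u2 x) * z.1 x).
Proof.
move=> c0 z iu1 iu2 [Hy1 V1] [Hy2 V2].
have Hw := H10B oOm bOm Hy1 Hy2.
have Hz : H10 Om z by exact: H10_trunc.
have Ly1 := H10_L2 oOm Hy1; have Ly2 := H10_L2 oOm Hy2; have Lz := H10_L2 oOm Hz.
have Lw := H10_L2 oOm Hw.
have := V1 _ (H10B oOm bOm Hy1 Hz); have := V2 _ (H10D oOm bOm Hy2 Hz).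
have -> : y2 + z - y2 = z by rewrite addrAC subrr add0r.
have -> : y1 - z - y1 = - z by rewrite addrAC subrr add0r.
move=> W2 W1.
have E1 : L_functional Om u1 (- z) = - \int[mu]_(x in Om) (u1 x * z.1 x).
  rewrite -[RHS]mulN1r -(RintegralZl (-1) mOm iu1); apply: eq_Rintegral => x _.
  by rewrite mulN1r -mulrN.
have E2 : L_functional Om u2 z = \int[mu]_(x in Om) (u2 x * z.1 x) by [].
have E3 : \int[mu]_(x in Om) ((u1 x - u2 x) * z.1 x) =
   \int[mu]_(x in Om) (u1 x * z.1 x) - \int[mu]_(x in Om) (u2 x * z.1 x).
  by rewrite -RintegralB//; apply: eq_Rintegral => x _; rewrite mulrBl.
have E4 : elliptic_form Om a b gam y1 (- z) + elliptic_form Om a b gam y2 z =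
   - elliptic_form Om a b gam (y1 - y2) z.
  rewrite /elliptic_form -RintegralD//; last 2 first.
  - exact: (integrable_elliptic_integrand Ly1 (L2_pairN oOm Lz)).
  - exact: (integrable_elliptic_integrand Ly2 Lz).
  rewrite -[RHS]mulN1r -(RintegralZl (-1) mOm (integrable_elliptic_integrand Lw Lz)).
  by apply: eq_Rintegral => x _; rewrite mulN1r; exact: elliptic_integrand_difference.
have ig : mu.-integrable Om (EFin \o (fun x => gam x * ((y1 - y2).1 x * z.1 x - z.1 x ^+ 2))).
  apply: (integrable_Lp_oo_mul mOm gam_Linfty).
  exact: (integrableB mOm (integrable_L2M mOm (proj1 Lw) (proj1 Lz)) (proj2 (proj1 Lz))).
have E5 : elliptic_form Om a b gam z z <= elliptic_form Om a b gam (y1 - y2) z.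
  have -> : elliptic_form Om a b gam (y1 - y2) z = elliptic_form Om a b gam z z +
      \int[mu]_(x in Om) (gam x * ((y1 - y2).1 x * z.1 x - z.1 x ^+ 2)).
    rewrite /elliptic_form -RintegralD//; last exact: (integrable_elliptic_integrand Lz Lz).
    by apply: eq_Rintegral => x _; exact: (elliptic_integrand_trunc (y1 - y2) x c0).
  rewrite lerDl; apply: Rintegral_ae_ge0 => //.
    by apply/measurable_EFinP; case/integrableP: ig.
  apply: filterS gam_ge0 => x + Ox => /(_ Ox) g0; apply: mulr_ge0 => //.
  by rewrite subr_ge0; exact: sqr_trunc_le.
have E6 : \int[mu]_(x in Om) `|(y1 - z).1 x| + \int[mu]_(x in Om) `|(y2 + z).1 x| <=
   \int[mu]_(x in Om) `|y1.1 x| + \int[mu]_(x in Om) `|y2.1 x|.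
  have ia f : L2 mu Om f -> mu.-integrable Om (EFin \o (fun x => `|f x|)).
    by move=> Lf; exact: (integrable_abse (integrable_L2 Lf)).
  have i1 := ia _ (proj1 Ly1); have i2 := ia _ (proj1 Ly2).
  have i3 := ia _ (proj1 (L2_pairB oOm Ly1 Lz)); have i4 := ia _ (proj1 (L2_pairD oOm Ly2 Lz)).
  rewrite -!RintegralD//; apply: le_Rintegral => //.
  - exact: (integrableD mOm i3 i4).
  - exact: (integrableD mOm i1 i2).
  - by move=> x _; exact: abs_trunc_le.
move: W1 W2 E4 E5 E6; rewrite E1 E2 E3.
(* Only linear relations between these numbers remain; making them opaque leaves a problem of linear
   arithmetic. *)
set A1 := elliptic_form _ _ _ _ _ (- z); set A2 := elliptic_form _ _ _ _ y2 z.
set A3 := elliptic_form _ _ _ _ (y1 - y2) z; set A4 := elliptic_form _ _ _ _ z z.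
set I1 := \int[_]_(x in _) (u1 x * _); set I2 := \int[_]_(x in _) (u2 x * _).
set J1 := \int[_]_(x in _) `|(y1 - z).1 x|; set J2 := \int[_]_(x in _) `|(y2 + z).1 x|.
set J3 := \int[_]_(x in _) `|y1.1 x|; set J4 := \int[_]_(x in _) `|y2.1 x|.
clearbody A1 A2 A3 A4 I1 I2 J1 J2 J3 J4.
lra.
Qed.

End truncated_test_function.

(** * Choice of the Sobolev exponent and conclusion *)

(** For d > 2 the critical exponent 2 d/(d - 2) is taken, with 2/q = 1 - 2/d, so the last condition
    is exactly p > d/2. For d <= 2 the second condition holds for every positive q, and any q above
    2 p/(p - 1) will do. *)
Lemma sobolev_exponent (R : realType) (d : nat) (p : R) : Num.max (d%:R / 2) 1 < p ->
  exists q : R, [/\ 2 < q, q * (d%:R - 2) <= 2 * d%:R & 2 * q^-1 < 1 - p^-1].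
Proof.
rewrite gt_max => /andP[dp p1]; have p0 : 0 < p by lra.
have d0 : 0 <= d%:R :> R by [].
have [d2|d2] := lerP (d%:R : R) 2.
  have pp : 0 < p - 1 by lra.
  have pq : 0 < 2 * p / (p - 1) + 1 by rewrite ltr_wpDl// divr_ge0//; lra.
  exists (2 * p / (p - 1) + 1); split.
  - rewrite -ltrBlDr ltr_pdivlMr//; lra.
  - have : 0 <= (2 * p / (p - 1) + 1) * (2 - d%:R) by apply: mulr_ge0; lra.
    by lra.
  - rewrite ltr_pdivrMr//.
    have -> : (1 - p^-1) * (2 * p / (p - 1) + 1) = 2 + (1 - p^-1).
      by field; rewrite !gt_eqF.
    by rewrite ltrDl subr_gt0 invf_lt1.
have dd : 0 < d%:R - 2 :> R by lra.
have dpos : 0 < d%:R :> R by lra.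
exists (2 * d%:R / (d%:R - 2)); split.
- by rewrite ltr_pdivlMr//; lra.
- by rewrite divfK// gt_eqF.
- have -> : 2 * (2 * d%:R / (d%:R - 2))^-1 = 1 - (d%:R / 2)^-1 :> R.
    by field; rewrite !gt_eqF.
  by rewrite ltrD2l ltrN2 ltf_pV2 ?posrE// divr_gt0.
Qed.

(** This feeds Chebyshev's inequality: where |w| > t, the truncation at level s is at least t - s in
    modulus. *)
Lemma le_trunc (R : realType) (s t : R) : 0 <= s -> `|t| - s <= `|trunc s t|.
Proof.
move=> s0; rewrite truncE//; case: ltP => [st|ts].
  by rewrite !gtr0_norm; lra.
case: ltP => [ts'|st]; first by rewrite !ltr0_norm; lra.
by rewrite normr0 subr_le0 ler_norml ts st.
Qed.

Lemma trunc_out (R : realType) (s t : R) : 0 <= s -> ~ (s < `|t|) -> trunc s t = 0.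
Proof.
move=> s0 /negP; rewrite -leNgt ler_norml => /andP[h1 h2]; rewrite truncE//.
by rewrite ltNge h2/= ltNge h1.
Qed.

Lemma powR_div_mul (R : realType) (B h G s q : R) : 0 <= B -> 0 < h ->
  (B / h) `^ q * G `^ (s * q) = (B * G `^ s) `^ q / h `^ q.
Proof.
move=> B0 h0; rewrite !powRM ?powR_ge0 ?invr_ge0 ?(ltW h0)// powRrM -!mulrA; congr (_ * _).
by rewrite -powR_inv1 ?(ltW h0)// -powRrM mulN1r powRN mulrC.
Qed.

Theorem lemma3p9 (R : realType) (d : nat) (Om : set 'rV[R]_d)
    (a : 'I_d -> 'I_d -> 'rV[R]_d -> R) (b : 'I_d -> 'rV[R]_d -> R)
    (gam : 'rV[R]_d -> R) (p : R)
    (d_ge1 : (1 <= d)%N)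
    (Om_domain : bounded_domain Om)
    (Om_cone : cone_condition Om)
    (a_Linfty : forall i j : 'I_d, Lp Om +oo%E (a i j))
    (b_Linfty : forall i : 'I_d, Lp Om +oo%E (b i))
    (gam_Linfty : Lp Om +oo%E gam)
    (gam_ge0 : {ae lebesgue_rV d, forall x : 'rV[R]_d, Om x -> 0 <= gam x})
    (A_coercive : coercive Om (elliptic_form Om a b gam))
    (p_gt : Num.max (d%:R / 2) 1 < p) :
  exists K : R, 0 < K /\
    forall u1 u2 : 'rV[R]_d -> R, Lp Om p%:E u1 -> Lp Om p%:E u2 ->
    forall y1 y2 : sobolev_pair R d,
      is_S Om (elliptic_form Om a b gam) (L_functional Om u1) y1 ->
      is_S Om (elliptic_form Om a b gam) (L_functional Om u2) y2 ->
      (Lp_norm Om +oo (y1.1 \- y2.1)%R <= K%:E * Lp_norm Om p%:E (u1 \- u2)%R)%E.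
Proof.
have [oOm _ _ bOm] := Om_domain; have mOm := measurable_bounded_open oOm.
have [q [q2 qd qp]] := sobolev_exponent p_gt.
have p1 : 1 < p by move: p_gt; rewrite gt_max => /andP[].
have p0 : 0 < p by exact: lt_trans p1.
have q0 : 0 < q by exact: lt_trans q2.
have iq0 : 0 < q^-1 by rewrite invr_gt0.
have [C C0 HC] := sobolev_H10 oOm bOm d_ge1 q2 qd.
have [al [al0 Hal]] := A_coercive.
set mu : {measure set 'rV[R]_d -> \bar R} := lebesgue_rV d.
(* [sig] is the power of the level set measure lost to Hoelder's inequality. After raising to the
   power q it becomes [be] = q (1 - 1/p) - 1, which exceeds 1 exactly when 2/q < 1 - 1/p. *)
pose sig := 1 - p^-1 - q^-1.
have sig0 : 0 < sig by rewrite /sig; lra.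
pose be := sig * q.
have be1 : 1 < be by rewrite /be -ltr_pdivrMr// mul1r /sig; lra.
have pq : p^-1 + q^-1 < 1 by lra.
have muOm := bounded_open_measure_lty oOm bOm.
(* Any upper bound of the measure serves the iteration; the [+ 1] makes its positivity immediate. *)
pose V := fine (mu Om) + 1.
have V0 : 0 < V by rewrite ltr_wpDl// fine_ge0.
pose D := stampacchia_const q be V.
have D0 : 0 < D by exact: stampacchia_const_gt0.
have Ca0 : 0 < C / al by rewrite divr_gt0.
have K0 : 0 < D * (C / al) by rewrite mulr_gt0.
exists (D * (C / al)); split => //.
move=> u1 u2 Lu1 Lu2 y1 y2 S1 S2.
pose u := (u1 \- u2)%R; rewrite -/u.
(* If the norm of u1 - u2 is infinite the right-hand side is infinite, since the constant is
   positive; this makes Minkowski's inequality unnecessary. *)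
have [->|Ufin] := eqVneq (Lp_norm Om p%:E u) +oo%E.
  by rewrite gt0_muley ?lte_fin// leey.
have p_neq0 : p != 0 by rewrite gt_eqF.
have mu1 : measurable_fun Om u1 by case: Lu1.
have mu2 : measurable_fun Om u2 by case: Lu2.
have mu_ : measurable_fun Om u by exact: measurable_funB.
have UE : Lp_norm Om p%:E u = (fine (Lp_norm Om p%:E u))%:E.
  by rewrite fineK// ge0_fin_numE ?Lnorm_ge0// ltey.
set U := fine (Lp_norm Om p%:E u) in UE.
have U0 : 0 <= U by rewrite fine_ge0// Lnorm_ge0.
have Hy1 : H10 Om y1 by case: S1.
have Hy2 : H10 Om y2 by case: S2.
have Hw := H10B oOm bOm Hy1 Hy2.
pose w := (y1 - y2).1.
have mw : measurable_fun Om w by have [[]] := H10_L2 oOm Hw.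
pose A (t : R) := Om `&` [set x | t < `|w x|].
have mA t : measurable (A t).
  have := measurableT_comp (@normr_measurable R setT) mw.
  by move=> /(_ mOm _ (measurable_itv `]t, +oo[)); congr measurable; apply/seteqP; split => x /=;
    rewrite in_itv/= andbT.
have AOm t : A t `<=` Om by move=> x [].
have mAfin t : (mu (A t) < +oo)%E.
  by apply: le_lt_trans muOm; apply: le_measure; rewrite ?inE//; exact: AOm.
pose g t := fine (mu (A t)).
have gE t : mu (A t) = (g t)%:E by rewrite fineK// ge0_fin_numE.
have key s t : 0 <= s -> s < t -> g t <= (C / al * U / (t - s)) `^ q * g s `^ be.
  move=> s0 st; pose z := comp_pair (trunc s) (trunc' s) (y1 - y2).
  have Hz : H10 Om z by exact: H10_trunc.
  have mz : measurable_fun Om z.1 by have [[]] := H10_L2 oOm Hz.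
  have [Iz Ez] := HC _ Hz.
  have z0 x : Om x -> ~ A s x -> z.1 x = 0.
    by move=> Ox nA; apply: trunc_out => // h; apply: nA.
  pose n := fine (Iq mu Om q z.1) `^ q^-1.
  have n0 : 0 <= n by exact: powR_ge0.
  have IzE : Iq mu Om q z.1 = (n `^ q)%:E.
    rewrite /n -powRrM mulVf ?gt_eqF// powRr1 ?fine_ge0 ?Iq_ge0// fineK//.
    by rewrite ge0_fin_numE// Iq_ge0.
  have Izr : (Iq mu Om q z.1 `^ q^-1 = n%:E)%E.
    by rewrite IzE poweR_EFin -powRrM divff ?gt_eqF// powRr1.
  (* [holder_support] is used with all of [Om] as the level set, where its vanishing condition is
     vacuous: only finiteness is wanted. *)
  have iu (v : 'rV[R]_d -> R) : Lp Om p%:E v -> mu.-integrable Om (EFin \o (fun x => v x * z.1 x)).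
    move=> [mv]; rewrite Lp_norm_fin// => vfin; apply/integrableP; split.
      by apply/measurable_EFinP; exact: measurable_funM.
    rewrite (eq_integral (fun x => (`|v x| * `|z.1 x|)%:E)); last first.
      by move=> x _; rewrite abse_EFin normrM.
    have HS := holder_support mu mOm mOm (@subset_refl _ Om) mv mz
      (fun x Ox nOx => False_ind _ (nOx Ox)) p1 q0 pq.
    apply: (le_lt_trans HS).
    rewrite Izr lte_mul_pinfty ?poweR_ge0 ?ge0_fin_numE ?poweR_ge0//.
    by rewrite lte_mul_pinfty ?lee_fin// poweR_lty.
  have iuz : mu.-integrable Om (EFin \o (fun x => u x * z.1 x)).
    by have := integrableB mOm (iu _ Lu1) (iu _ Lu2); under eq_fun do rewrite -EFinB -mulrBl.
  have T := truncated_test_function oOm bOm a_Linfty b_Linfty gam_Linfty gam_ge0 s0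
    (iu _ Lu1) (iu _ Lu2) S1 S2.
  have HU : \int[mu]_(x in Om) (u x * z.1 x) <= U * (n * g s `^ sig).
    rewrite -lee_fin; apply: (@le_trans _ _ (\int[mu]_(x in Om) (`|u x| * `|z.1 x|)%:E)%E).
      apply: (@le_trans _ _ (`|\int[mu]_(x in Om) (u x * z.1 x)|%:E)%E); first by rewrite lee_fin ler_norm.
      rewrite EFin_normr_Rintegral//; apply: (le_trans (le_abse_integral _ mOm _)).
        by case/integrableP: iuz.
      by under eq_integral do rewrite /= normrM.
    apply: (le_trans (holder_support mu mOm (mA s) (AOm s) mu_ mz z0 p1 q0 pq)).
    by rewrite -Lp_norm_fin// UE Izr gE poweR_EFin -!EFinM.
  have n_le : n <= C / al * U * g s `^ sig.
    have := Hal _ Hz; rewrite sqr_H1_norm => Hc.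
    have : n ^+ 2 <= C / al * (U * (n * g s `^ sig)).
      apply: (le_trans Ez); rewrite -mulrA ler_pM2l// ler_pdivlMl//.
      exact: (le_trans Hc (le_trans T HU)).
    (* The estimate is quadratic in [n] on the left and linear on the right, so one factor is
       cancelled, unless [n] is 0. *)
    have [->|nn0] := eqVneq n 0; first by rewrite !mulr_ge0 ?powR_ge0 ?(ltW C0) ?invr_ge0 ?(ltW al0).
    have np : 0 < n by rewrite lt_def nn0.
    by rewrite (_ : C / al * _ = C / al * U * g s `^ sig * n) ?expr2 ?ler_pM2r//; ring.
  have ts0 : 0 < t - s by rewrite subr_gt0.
  have cheb : g t * (t - s) `^ q <= n `^ q.
    rewrite -lee_fin -IzE EFinM -gE muleC -integral_cst//.
    apply: (@le_trans _ _ (\int[mu]_(x in A t) (`|z.1 x| `^ q)%:E)%E).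
      apply: ge0_le_integral => //.
      - by move=> x _; rewrite lee_fin powR_ge0.
      - by apply/measurable_EFinP; apply: measurable_norm_powR; exact: measurable_funS mz.
      - move=> x [_ tx] /=; rewrite lee_fin; apply: ge0_ler_powR; rewrite ?nnegrE ?(ltW q0) ?(ltW ts0)//.
        by apply: le_trans (le_trunc _ s0); rewrite lerD2r ltW.
    apply: ge0_subset_integral => //; first by apply/measurable_EFinP; exact: measurable_norm_powR.
  have B0 : 0 <= C / al * U by apply: mulr_ge0 U0; exact: ltW.
  rewrite (powR_div_mul _ _ _ B0 ts0) ler_pdivlMr; last exact: powR_gt0.
  apply: (le_trans cheb); apply: (ge0_ler_powR (ltW q0)) n_le; first exact: n0.
  by rewrite nnegrE; apply: mulr_ge0 B0 _; exact: powR_ge0.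
apply/lee_addgt0Pr => e e0.
(* The second term makes [M] positive even if U = 0, and dividing by [D] makes the final level D M
   exceed the desired bound by exactly [e]. *)
pose M := C / al * U + e / D.
have M0 : 0 < M by rewrite ltr_wpDl ?divr_gt0// mulr_ge0// ltW.
have gDM : g (D * M) = 0.
  apply: (stampacchia q0 be1 V0 M0) => [t|t|s t st|s t s0 st].
  - exact: fine_ge0.
  - rewrite /V ler_wpDr// fine_le ?ge0_fin_numE//.
    by apply: le_measure; rewrite ?inE//; exact: AOm.
  - rewrite fine_le ?ge0_fin_numE//; apply: le_measure; rewrite ?inE//.
    by move=> x [Ox tx]; split => //=; exact: le_lt_trans tx.
  - apply: (le_trans (key s t s0 st)); rewrite ler_wpM2r ?powR_ge0//.
    have ts0 : 0 < t - s by rewrite subr_gt0.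
    have ca : 0 <= C / al * U by rewrite mulr_ge0// ltW.
    apply: ge0_ler_powR; rewrite ?nnegrE ?(ltW q0)//.
    + by rewrite divr_ge0// ltW.
    + by rewrite divr_ge0// ltW.
    + by rewrite ler_pM2r ?invr_gt0// lerDl divr_ge0// ltW.
rewrite UE -EFinM -EFinD.
have -> : D * (C / al) * U + e = D * M by rewrite /M; field; rewrite !gt_eqF.
apply: Lp_norm_oo_le; first by rewrite mulr_ge0// ltW.
(* The superlevel set at D M, shown null by the iteration, is the exceptional set of the essential
   bound. *)
exists (A (D * M)); split => //; first by rewrite [LHS]gE gDM.
move=> x /= /not_implyP[Ox /negP]; rewrite -ltNge => h.
by split.
Qed.
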